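(* Let $\alpha\in\mathbb{R}$, $1<p\leq\infty$, and let $q$ be the exponent conjugate to $p$. Let $f\in H(\mathbb{D})$ be a $\mathcal{U}$-frequently hypercyclic function for $T_\alpha$. Then - if $\alpha<\frac1{\max(2,q)}$, then $\limsup_{r\to1^-}\big((1-r)^{\frac1{\max(2,q)}-\alpha}M_p(f,r)\big)>0$; - if $\alpha=\frac1{\max(2,q)}$, then $\limsup_{r\to1^-}M_p(f,r)=+\infty$; - if $\alpha>\frac1{\max(2,q)}$, then $\limsup_{r\to1^-}M_p(f,r)>0$. For $\alpha\neq\frac1{\max(2,q)}$ these results are optimal in the following sense: for all $p>1$ (including $p=\infty$) there exist a $\mathcal{U}$-frequently hypercyclic function $f\in H(\mathbb{D})$ for $T_\alpha$ and a constant $C>0$ such that, for every $0<r<1$, $$M_p(f,r)\leq\begin{cases}C(1-r)^{\alpha-\frac1{\max(2,q)}}&\text{if }\alpha<\frac1{\max(2,q)},\\ C&\text{if }\alpha>\frac1{\max(2,q)}.\end{cases}$$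
   Context: $\mathbb{D}$ is the open unit disc in $\mathbb{C}$ and $H(\mathbb{D})$ is the Fréchet space of analytic functions on $\mathbb{D}$ with the topology of uniform convergence on compact subsets. For $\alpha\in\mathbb{R}$ and $n\ge1$ put $w_n(\alpha)=(1+\frac1n)^{\alpha}$; the weighted Taylor shift $T_\alpha:H(\mathbb{D})\to H(\mathbb{D})$ is $T_\alpha\big(\sum_{k\ge0}a_kz^k\big)=\sum_{k\ge0}a_{k+1}w_{k+1}(\alpha)z^k$. The upper density of $A\subset\mathbb{N}$ is $\overline d(A)=\limsup_{n\to\infty}\frac{\#(A\cap\{1,\dots,n\})}{n}$. A function $f\in H(\mathbb{D})$ is $\mathcal{U}$-frequently hypercyclic for $T_\alpha$ if for every non-empty open set $U\subset H(\mathbb{D})$, $\overline d(\{n\in\mathbb{N}:T_\alpha^nf\in U\})>0$. For $0<r<1$, $M_p(f,r)=\big(\frac1{2\pi}\int_0^{2\pi}|f(re^{i\theta})|^p\,d\theta\big)^{1/p}$ if $1\le p<\infty$, and $M_\infty(f,r)=\sup_{0\le t\le2\pi}|f(re^{it})|$. The conjugate exponent $q$ satisfies $\frac1p+\frac1q=1$ ($q=1$ if $p=\infty$). *)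

(* Defs.v *)
From mathcomp Require Import all_boot all_order all_algebra complex.
From mathcomp Require Import all_classical all_reals all_analysis.
Import Order.TTheory GRing.Theory Num.Theory numFieldNormedType.Exports.

Set Implicit Arguments.
Unset Strict Implicit.
Unset Printing Implicit Defensive.

Local Open Scope classical_set_scope.
Local Open Scope ring_scope.
Local Open Scope complex_scope.

(* The alias R[i]^o, convertible to R[i], carries the topology given by the
   modulus and the structure of a normed space over R[i]; derivatives of
   functions between copies of it are therefore complex derivatives. *)
Notation Cplx R := (R[i]^o) (only parsing).

(* The modulus `|z| has type R[i]; this is the same number in R. *)
Definition modulus {R : realType} (z : Cplx R) : R := complex.Re `|z|.

Definition unit_disc {R : realType} : set (Cplx R) := [set z | `|z| < 1].

Definition analytic_at {R : realType} (f : Cplx R -> Cplx R) (z0 : Cplx R) :=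
  exists a : (Cplx R)^nat,
    \forall z \near z0, series (fun k => a k * (z - z0) ^+ k) @ \oo --> f z.

(* H(D).  Its elements are encoded as functions on the whole plane that are
   analytic on the disc, with arbitrary values elsewhere: neither the topology
   nor any of the notions below looks at the values outside the disc. *)
Definition analytic_disc {R : realType} : set (Cplx R -> Cplx R) :=
  [set f | forall z, unit_disc z -> analytic_at f z].

Definition compact_in_disc {R : realType} (K : set (Cplx R)) : Prop :=
  compact K /\ K `<=` unit_disc.

(* The topology of uniform convergence on the compact subsets of the disc;
   H(D) has the topology induced on analytic_disc. *)
Definition disc_fun (R : realType) :=
  {family @compact_in_disc R, Cplx R -> Cplx R}.

Definition taylor_coef {R : realType} (f : Cplx R -> Cplx R) (k : nat) :
  Cplx R := derive1n k f 0 / (k`!)%:R.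

Definition shift_weight {R : realType} (alpha : R) (n : nat) : R :=
  (1 + n%:R^-1) `^ alpha.

Definition taylor_shift {R : realType} (alpha : R) (f : Cplx R -> Cplx R) :
    Cplx R -> Cplx R :=
  fun z => limn (series (fun k =>
    taylor_coef f k.+1 * (shift_weight alpha k.+1)%:C * z ^+ k : Cplx R)).

Definition upper_density (R : realType) (A : set nat) : \bar R :=
  limn_esup (fun n => ((count (mem A) (iota 1 n))%:R / n%:R : R)%:E).

(* The open subsets of H(D) are the traces U `&` analytic_disc of the open
   subsets U of disc_fun. *)
Definition U_frequently_hypercyclic {R : realType} (alpha : R)
    (f : Cplx R -> Cplx R) : Prop :=
  forall U : set (disc_fun R), open U ->
    (exists2 g, analytic_disc g & U g) ->
    (0 < upper_density R [set n | analytic_disc (iter n (taylor_shift alpha) f)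
                                /\ U (iter n (taylor_shift alpha) f)])%E.

Definition circle_pt {R : realType} (r t : R) : Cplx R :=
  (r * cos t) +i* (r * sin t).

Definition integral_mean {R : realType} (p : \bar R) (f : Cplx R -> Cplx R)
    (r : R) : \bar R :=
  (match p with
   | p0%:E => (((2 * pi)^-1)%:E *
        \int[lebesgue_measure]_(t in `[0%R, (2 * pi)%R])
          (modulus (f (circle_pt r t)) `^ p0)%:E) `^ p0^-1
   | +oo => ereal_sup
        [set (modulus (f (circle_pt r t)))%:E | t in `[0%R, (2 * pi)%R]]
   | -oo => 0 (* not used: p > 1 *)
   end)%E.

(* Main.v *)
Require Import Defs.
From mathcomp Require Import all_boot all_order all_algebra complex.
From mathcomp Require Import all_classical all_reals all_analysis.
From mathcomp Require Import measurable_realfun.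
From mathcomp Require Import ring lra zify.
Import Order.TTheory GRing.Theory Num.Theory numFieldNormedType.Exports.

(** Put Q = max(2, q), s = 1 / Q, and let P = min(p, 2) be the exponent
conjugate to Q; let a_n be the Taylor coefficients of f.  The value at the
origin of T^n f is a_n (n+1)^alpha ([iter_shift_at0]), and everything is read
off from the sizes of these numbers.

Lower bounds.  Since f visits the open set of all g with |g(0)| > 1 along a set
of positive upper density, |a_n| (n+1)^alpha > 1 for all n in such a set.
Pairing f on the circle of radius r with the trigonometric polynomial whose
coefficients are the phases of a_n, for n in a finite set S, and using Hoelder's
inequality gives the sum over S of |a_n| r^n <= M_p(f, r) |S|^(1/P)
([restricted_hausdorff_young]): the L^Q norm of a polynomial with |S| unimodular
coefficients is at most |S|^(1/P), by interpolation between the sup norm and the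
L^2 norm.  With S in [0, N] of size comparable to N and r = 1 - 1/(2N) this reads
N^(1-alpha) <= C M_p(f, r) N^(1/P), that is M_p(f, r) >= c (1-r)^(alpha-s)
([subcritical_growth]).  For alpha > s a single nonzero coefficient is enough
([supercritical_bound]).  For alpha = s each scale N contributes only a constant
to the pairing.  Take J scales, each chosen so sparse with respect to the
preceding ones that the Q-th powers of the L^Q norms almost add up
([critical_step]); then J <= C M_p(f, r) J^(1/Q) for every J, so that M_p(f, r)
is unbounded ([critical_unbounded]).

Optimality.  The function is a sum of blocks
N_j^(-alpha) z^(N_j) F_j(z^d) q_j(z), where q_j runs through a countable dense set
of polynomial targets, each taken infinitely often, with the k-th coefficient
multiplied by (k+1)^alpha, and F_j is a flat polynomial of length comparable to
m_j = N_j / h: at least a fixed proportion of its coefficients are equal to one,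
while its p-mean is at most C m_j^s ([flat_polynomials]).  For p >= 2 these are
the Rudin-Shapiro polynomials, for p < 2 products of two geometric sums.  At the
times N_j + d i for which the i-th coefficient of F_j is one, T^n f is close to
the target ([shift_near]); along n = 2 N_j these times have density at least
1/(4h) ([good_density]).  The j-th block has p-mean at most C N_j^(s-alpha) r^(N_j)
and N_j is lacunary, so the sum of these bounds is O((1-r)^(alpha-s)) if alpha < s
and O(1) if alpha > s ([lacunary_pos], [lacunary_neg]).

Both halves use that a function which is locally a power series at each point of
the disc is the sum of one power series on the whole disc
([analytic_has_series]).  It is obtained here from averages over the vertices of
regular polygons in place of contour integrals. *)

Set Implicit Arguments.
Unset Strict Implicit.
Unset Printing Implicit Defensive.

Local Open Scope classical_set_scope.
Local Open Scope ring_scope.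

(** * The real modulus of a complex number *)

Section modulus_theory.
Local Open Scope complex_scope.
Context {R : realType}.
Local Notation C := (Cplx R).
Implicit Types (x y : R) (z w : C).

Lemma normE z : `|z| = (modulus z)%:C.
Proof. by rewrite /modulus normc_def. Qed.

Lemma modulusE z : modulus z = Num.sqrt (complex.Re z ^+ 2 + complex.Im z ^+ 2).
Proof. by rewrite /modulus normc_def. Qed.

Lemma modulus_ge0 z : 0 <= modulus z.
Proof. by rewrite modulusE sqrtr_ge0. Qed.
#[local] Hint Extern 0 (is_true (Order.le _ (modulus _))) => solve [apply: modulus_ge0] : core.

Lemma modulus_sqr z : modulus z ^+ 2 = complex.Re z ^+ 2 + complex.Im z ^+ 2.
Proof. by rewrite modulusE sqr_sqrtr// addr_ge0 ?sqr_ge0. Qed.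

Lemma modulusM z w : modulus (z * w) = modulus z * modulus w.
Proof. by apply: complexI; rewrite rmorphM/= -!normE normrM. Qed.

Lemma modulusD z w : modulus (z + w) <= modulus z + modulus w.
Proof. by rewrite -lecR rmorphD/= -!normE ler_normD. Qed.

Lemma modulusN z : modulus (- z) = modulus z.
Proof. by rewrite /modulus normrN. Qed.

Lemma modulusBC z w : modulus (z - w) = modulus (w - z).
Proof. by rewrite -modulusN opprB. Qed.

Lemma modulus0 : modulus (0 : C) = 0.
Proof. by rewrite /modulus normr0. Qed.

Lemma modulus1 : modulus (1 : C) = 1.
Proof. by rewrite /modulus normr1. Qed.

Lemma modulus_eq0 z : (modulus z == 0) = (z == 0).
Proof.
by rewrite -(inj_eq (@complexI R)) -normE normr_eq0.
Qed.

Lemma modulus_gt0 z : (0 < modulus z) = (z != 0).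
Proof. by rewrite lt_neqAle modulus_ge0 andbT eq_sym modulus_eq0. Qed.

Lemma modulusV z : modulus (z^-1) = (modulus z)^-1.
Proof.
have [->|z0] := eqVneq z 0; first by rewrite invr0 modulus0 invr0.
apply: (mulfI (x := modulus z)); first by rewrite modulus_eq0.
by rewrite -modulusM !mulfV ?modulus1// modulus_eq0.
Qed.

Lemma modulusX z n : modulus (z ^+ n) = modulus z ^+ n.
Proof. by elim: n => [|n IH]; rewrite ?expr0 ?modulus1// !exprS modulusM IH. Qed.

Lemma modulus_real x : modulus (x%:C : C) = `|x|.
Proof. by rewrite modulusE/= expr0n addr0 sqrtr_sqr. Qed.

Lemma modulus_nat n : modulus (n%:R : C) = n%:R.
Proof.
rewrite (_ : n%:R = (n%:R : R)%:C :> C) ?modulus_real ?ger0_norm//.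
by rewrite rmorph_nat.
Qed.

Lemma modulus_sum (I : Type) (r : seq I) (P : pred I) (F : I -> C) :
  modulus (\sum_(i <- r | P i) F i) <= \sum_(i <- r | P i) modulus (F i).
Proof.
elim/big_ind2 : _ => //; first by rewrite modulus0.
by move=> a b c d ab cd; rewrite (le_trans (modulusD _ _))// lerD.
Qed.

Lemma modulusB_ge z w : modulus z - modulus w <= modulus (z - w).
Proof.
rewrite lerBlDr; have := modulusD (z - w) w; by rewrite subrK.
Qed.

Lemma Re_le_modulus z : `|complex.Re z| <= modulus z.
Proof.
rewrite -(@ler_pXn2r _ 2) ?nnegrE// modulus_sqr real_normK ?num_real//.
by rewrite lerDl sqr_ge0.
Qed.

Lemma Im_le_modulus z : `|complex.Im z| <= modulus z.
Proof.
rewrite -(@ler_pXn2r _ 2) ?nnegrE// modulus_sqr real_normK ?num_real//.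
by rewrite lerDr sqr_ge0.
Qed.

Lemma modulus_le_ReIm z : modulus z <= `|complex.Re z| + `|complex.Im z|.
Proof.
rewrite {1}[z]complexE (le_trans (modulusD _ _))// modulusM !modulus_real.
by rewrite lerD2l modulusE/= expr0n expr1n add0r sqrtr1 mul1r.
Qed.

(** Conjugation with values in Cplx R, whose arithmetic is that of the regular module. *)
Definition cj z : C := conjc z.

Lemma cjM z w : cj (z * w) = cj z * cj w.
Proof. exact: (rmorphM (@conjc R)). Qed.

Lemma cjB z w : cj (z - w) = cj z - cj w.
Proof. exact: (raddfB (@conjc R)). Qed.

Lemma cj_sum (I : Type) (r : seq I) (P : pred I) (F : I -> C) :
  cj (\sum_(i <- r | P i) F i) = \sum_(i <- r | P i) cj (F i).
Proof. exact: (raddf_sum (@conjc R)). Qed.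

Lemma cj_real x : cj x%:C = x%:C :> C.
Proof. by rewrite /cj/= oppr0. Qed.

Lemma cj_nat n : cj n%:R = n%:R.
Proof. exact: conjc_nat. Qed.

Lemma cjV z : cj z^-1 = (cj z)^-1.
Proof. exact: conjc_inv. Qed.

Lemma modulus_conj z : modulus (cj z) = modulus z.
Proof. by case: z => a b; rewrite !modulusE/= sqrrN. Qed.

Lemma mulJ z : z * cj z = (modulus z ^+ 2)%:C.
Proof.
by rewrite modulus_sqr; case: z => a b/=; apply/eqP;
   rewrite eq_complex/=; apply/andP; split; apply/eqP; ring.
Qed.

Lemma unit_discE z : unit_disc z <-> modulus z < 1.
Proof. by rewrite /unit_disc/= normE (_ : 1 = 1%:C :> C)// ltcR. Qed.

Lemma nbhsCP z (A : set C) :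
  nbhs z A <-> exists2 d, 0 < d & forall w, modulus (w - z) < d -> A w.
Proof.
split.
  move=> /nbhs_ballP[e /= e0 eA]; exists (complex.Re e).
    by move: e0; rewrite ltcE/= => /andP[].
  move=> w wz; apply: eA; rewrite -ball_normE/= distrC normE.
  move: e0; rewrite [e]complexE ltcE/= => /andP[/eqP + e0].
  by rewrite !(mul0r,mulr0,addr0,subr0,add0r,mul1r) => ->; rewrite mulr0 addr0 ltcR.
move=> [d d0 dA]; apply/nbhs_ballP; exists (d%:C); rewrite /= ?ltcR//.
move=> w; rewrite -ball_normE/= distrC normE ltcR => /dA; exact.
Qed.

Lemma cvgCP (u : C ^nat) (l : C) : (u @ \oo --> l) <->
  forall e, 0 < e -> exists N, forall n, (N <= n)%N -> modulus (u n - l) < e.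
Proof.
split.
  move=> ul e e0.
  have /nbhsCP : exists2 d, 0 < d & forall w, modulus (w - l) < d -> modulus (w - l) < e.
    by exists e.
  by move=> /ul[N _ NA]; exists N => n; apply: NA.
move=> H A /nbhsCP[d d0 dA]; have [N NP] := H _ d0.
by exists N => // n /= Nn; apply: dA; apply: NP.
Qed.

End modulus_theory.
#[export] Hint Extern 0 (is_true (Order.le _ (modulus _))) => solve [apply: modulus_ge0] : core.

(** * Convergent series of complex numbers *)

Section cvgsum_theory.
Local Open Scope complex_scope.
Context {R : realType}.
Local Notation C := (Cplx R).
Implicit Types (x y : R) (z w l : C) (a b : nat -> C).

(** Convergence with real tolerances, so that the filters of R[i] are met only in
[cvgsumP]. *)
Definition cvgsum a l := forall e, 0 < e -> exists N, forall n, (N <= n)%N ->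
  modulus (\sum_(k < n) a k - l) < e.

Lemma cvgsumP a l : (series a @ \oo --> l) <-> cvgsum a l.
Proof.
rewrite cvgCP; split=> H e e0; have [N HN] := H e e0; exists N => n /HN;
  by rewrite /series/= big_mkord.
Qed.

Lemma eq_cvgsum a b l : a =1 b -> cvgsum a l -> cvgsum b l.
Proof. by move=> /funext ->. Qed.

Lemma cvgsum_le a l M : (forall n, modulus (\sum_(k < n) a k) <= M) ->
  cvgsum a l -> modulus l <= M.
Proof.
move=> aM al; apply/ler_addgt0Pl => e e0; have [N /(_ N (leqnn _)) HN] := al e e0.
rewrite -(opprK l) modulusN (_ : - l = (\sum_(k < N) a k - l) - \sum_(k < N) a k);
  last by ring.
rewrite (le_trans (modulusD _ _))// modulusN lerD// ltW//.
Qed.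

Lemma cvgsumD a b l l' : cvgsum a l -> cvgsum b l' ->
  cvgsum (fun k => a k + b k) (l + l').
Proof.
move=> al block_coef e e0; have e20 : 0 < e / 2 by lra.
have [N HN] := al _ e20; have [N' HN'] := block_coef _ e20.
exists (maxn N N') => n; rewrite geq_max => /andP[/HN H1 /HN' H2].
rewrite big_split/= opprD addrACA (le_lt_trans (modulusD _ _))//; lra.
Qed.

Lemma cvgsumZ c a l : cvgsum a l -> cvgsum (fun k => c * a k) (c * l).
Proof.
move=> al e e0; have c0 : 0 < modulus c + 1 by have := modulus_ge0 c; lra.
have [N HN] := al (e / (modulus c + 1)) (divr_gt0 e0 c0).
exists N => n /HN; rewrite -mulr_sumr -mulrBr modulusM ltr_pdivlMr// => H.
apply: le_lt_trans H; rewrite [leRHS]mulrC; apply: ler_wpM2r => //; lra.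
Qed.

Lemma cvgsumN a l : cvgsum a l -> cvgsum (fun k => - a k) (- l).
Proof.
by move=> /(cvgsumZ (-1)); rewrite mulN1r; apply: eq_cvgsum => k; rewrite mulN1r.
Qed.

Lemma cvgsumB a b l l' : cvgsum a l -> cvgsum b l' ->
  cvgsum (fun k => a k - b k) (l - l').
Proof. by move=> ? ?; apply: cvgsumD => //; exact: cvgsumN. Qed.

Lemma cvgsum0 : cvgsum (fun=> 0) 0.
Proof. by move=> e e0; exists 0%N => n _; rewrite big1// subrr modulus0. Qed.

Lemma cvgsum_uniq a l l' : cvgsum a l -> cvgsum a l' -> l = l'.
Proof.
move=> al al'; apply/eqP; rewrite -subr_eq0; apply/eqP.
have h : cvgsum (fun=> 0) (l - l').
  by move: (cvgsumB al al'); apply: eq_cvgsum => k; rewrite subrr.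
apply/eqP; rewrite -modulus_eq0 eq_le modulus_ge0 andbT.
by apply: cvgsum_le h => n; rewrite big1// modulus0.
Qed.

Lemma cvgsum_shift n a l :
  cvgsum a l <-> cvgsum (fun k => a (n + k)%N) (l - \sum_(k < n) a k).
Proof.
have E m : \sum_(k < m) a (n + k)%N - (l - \sum_(k < n) a k) =
           \sum_(k < n + m) a k - l.
  by rewrite big_split_ord/=; ring.
split=> H e e0; have [N HN] := H e e0.
  by exists N => m Nm; rewrite E HN// (leq_trans Nm)// leq_addl.
exists (n + N)%N => m nm.
have -> : m = (n + (m - n))%N by rewrite subnKC// (leq_trans (leq_addr _ _) nm).
by rewrite -E HN// leq_subRL ?(leq_trans (leq_addr _ _) nm).
Qed.

Lemma cvgsum_fin n a : (forall k, (n <= k)%N -> a k = 0) ->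
  cvgsum a (\sum_(k < n) a k).
Proof.
move=> a0; apply/(cvgsum_shift n); rewrite subrr.
by apply: eq_cvgsum cvgsum0 => k; rewrite a0// leq_addr.
Qed.

Lemma cvgsum_bounded a l : cvgsum a l -> exists2 M, 0 < M & forall k, modulus (a k) <= M.
Proof.
move=> al; have [N HN] := al 1 ltr01.
exists (\sum_(k < N) modulus (a k) + 2) => [|k].
  by rewrite ltr_wpDl// sumr_ge0.
have [Nk|kN] := leqP N k; last first.
  rewrite (bigD1 (Ordinal kN))//= -!addrA lerDl addr_ge0// sumr_ge0//.
rewrite ler_wpDl ?sumr_ge0//.
have := HN _ (leqW Nk); have := HN _ Nk.
rewrite big_ord_recr/= => H1 H2.
have -> : a k = (\sum_(i < k) a i + a k - l) - (\sum_(i < k) a i - l).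
  by ring.
rewrite (le_trans (modulusD _ _))// modulusN; lra.
Qed.

Lemma sum_geo_le (M t : R) n : 0 <= M -> 0 <= t < 1 ->
  \sum_(k < n) M * t ^+ k <= M / (1 - t).
Proof.
move=> M0 /andP[t0 t1]; rewrite -mulr_sumr ler_wpM2l//.
rewrite -[_^-1]mul1r ler_pdivlMr ?subr_gt0//; have := subrX1 t n => E.
have -> : (\sum_(k < n) t ^+ k) * (1 - t) = 1 - t ^+ n.
  by rewrite -[RHS]opprB E; ring.
by rewrite lerBlDr lerDl exprn_ge0.
Qed.

Lemma cvgsum_geo_le a l (M t : R) : 0 <= t < 1 ->
  (forall k, modulus (a k) <= M * t ^+ k) -> cvgsum a l -> modulus l <= M / (1 - t).
Proof.
move=> t01 aM; have M0 : 0 <= M.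
  by have := aM 0%N; rewrite expr0 mulr1; apply: le_trans.
apply: cvgsum_le => n; rewrite (le_trans (modulus_sum _ _ _))//.
by rewrite (le_trans _ (sum_geo_le n M0 t01))// ler_sum.
Qed.

Lemma cvgsum_geo_tail a l (M t : R) n : 0 <= t < 1 ->
  (forall k, modulus (a k) <= M * t ^+ k) -> cvgsum a l ->
  modulus (l - \sum_(k < n) a k) <= M * t ^+ n / (1 - t).
Proof.
move=> t01 aM /(cvgsum_shift n); apply: cvgsum_geo_le => // k.
by rewrite -mulrA -exprD.
Qed.

Lemma real_geo_cvg (u : nat -> R) (M t : R) : 0 <= t < 1 ->
  (forall k, `|u k| <= M * t ^+ k) -> cvgn (series u).
Proof.
move=> /andP[t0 t1] uM; apply: normed_cvg.
apply: (@series_le_cvg _ _ (geometric M t)) => //= [n|].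
  by rewrite (le_trans _ (uM n)).
by apply: is_cvg_geometric_series; rewrite ger0_norm.
Qed.

Lemma geo_small (M t e : R) : 0 <= t < 1 -> 0 < e ->
  exists N, forall n, (N <= n)%N -> M * t ^+ n < e.
Proof.
move=> /andP[t0 t1] e0; have t1' : `|t| < 1 by rewrite ger0_norm.
have /cvgrPdist_lt/(_ _ e0)[N _ HN] := @cvg_geometric R M t t1'.
exists N => n /HN /=; rewrite sub0r normrN; exact/le_lt_trans/ler_norm.
Qed.

(** Geometric domination suffices as a convergence test: all series below are evaluated
inside the disc of convergence of a power series. *)
Lemma cvgsum_geo a (M t : R) : 0 <= t < 1 ->
  (forall k, modulus (a k) <= M * t ^+ k) -> exists l, cvgsum a l.
Proof.
move=> t01 aM.
have c1 : cvgn (series (fun k => complex.Re (a k))).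
  by apply: (real_geo_cvg t01) => k; rewrite (le_trans (Re_le_modulus _)).
have c2 : cvgn (series (fun k => complex.Im (a k))).
  by apply: (real_geo_cvg t01) => k; rewrite (le_trans (Im_le_modulus _)).
exists ((limn (series (fun k => complex.Re (a k)))) +i*
        (limn (series (fun k => complex.Im (a k))))).
move=> e e0; have e20 : 0 < e / 2 by lra.
move/cvgrPdist_lt/(_ _ e20) : c1 => [N1 _ H1].
move/cvgrPdist_lt/(_ _ e20) : c2 => [N2 _ H2].
exists (maxn N1 N2) => n; rewrite geq_max => /andP[/H1/= + /H2/= +].
rewrite /series/= !big_mkord => h1 h2.
have [ER EI] : complex.Re (\sum_(k < n) a k) = \sum_(k < n) complex.Re (a k) /\
   complex.Im (\sum_(k < n) a k) = \sum_(k < n) complex.Im (a k).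
  elim: n {h1 h2} => [|n [IH1 IH2]]; first by rewrite !big_ord0.
  rewrite !big_ord_recr/= -IH1 -IH2.
  by case: (\sum_(k < n) a k) => ? ?; case: (a n).
rewrite (le_lt_trans (modulus_le_ReIm _))//.
move: ER EI; case: (\sum_(k < n) a k) => p q/= -> ->.
by rewrite distrC [X in _ + X]distrC [ltRHS](splitr e) ltrD.
Qed.

End cvgsum_theory.

(** * Power series and their re-expansion *)

Section power_series.
Local Open Scope complex_scope.
Context {R : realType}.
Local Notation C := (Cplx R).
Implicit Types (x y : R) (z w l : C) (a b : nat -> C) (f g : C -> C).

Definition local_series b z0 f := exists2 d : R, 0 < d &
  forall z, modulus (z - z0) < d -> cvgsum (fun k => b k * (z - z0) ^+ k) (f z).

Definition has_series a f := forall z, modulus z < 1 ->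
  cvgsum (fun k => a k * z ^+ k) (f z).

(** Strict differentiability: both points of the difference quotient move.  Unlike
differentiability at a point, it controls increments between two nearby points,
which is what the uniform estimates along a circle consume. *)
Definition strict_diff f z0 L := forall e : R, 0 < e -> exists2 d, 0 < d &
  forall z w, modulus (z - z0) < d -> modulus (w - z0) < d ->
  modulus (f z - f w - L * (z - w)) <= e * modulus (z - w).

Lemma analytic_atP f z0 : analytic_at f z0 <-> exists b, local_series b z0 f.
Proof.
split=> -[b].
  move=> /nbhsCP[d d0 H]; exists b, d => // z /H /cvgsumP.
  exact.
move=> [d d0 H]; exists b; apply/nbhsCP; exists d => // z /H /cvgsumP.
exact.
Qed.

Lemma cvgsum_coef_bound a z l : cvgsum (fun k => a k * z ^+ k) l ->
  exists2 M, 0 < M & forall k, modulus (a k) * modulus z ^+ k <= M.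
Proof.
by move=> /cvgsum_bounded[M M0 H]; exists M => // k; rewrite -modulusX -modulusM.
Qed.

Lemma real_pt_modulus x : 0 <= x -> modulus (x%:C : C) = x.
Proof. by move=> x0; rewrite modulus_real ger0_norm. Qed.

Lemma has_series_bound a f (r : R) : has_series a f -> 0 <= r < 1 ->
  exists2 M, 0 < M & forall k, modulus (a k) * r ^+ k <= M.
Proof.
move=> af /andP[r0 r1].
have [|M M0 H] := @cvgsum_coef_bound a r%:C (f r%:C).
  by apply: af; rewrite real_pt_modulus.
by exists M => // k; have := H k; rewrite real_pt_modulus.
Qed.

Lemma geo_term a (r s M : R) k : 0 < r -> 0 <= s ->
  modulus (a k) * r ^+ k <= M -> modulus (a k) * s ^+ k <= M * (s / r) ^+ k.
Proof.
move=> r0 s0 H; rewrite expr_div_n mulrA ler_pdivlMr ?exprn_gt0//.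
by rewrite mulrAC ler_wpM2r// exprn_ge0.
Qed.

(** For k >= K, weighting the k-th term of the binomial expansion by 2^(k-K) >= 1
only increases it, and the weighted terms sum to at most
2^(-K) (|z| + 2 |h|)^n.  The factor 2^(-K) makes the tails uniform in n. *)
Lemma binom_tail z h n K :
  modulus ((z + h) ^+ n - \sum_(k < K) z ^+ (n - k) * h ^+ k *+ 'C(n, k)) <=
  2^-1 ^+ K * (modulus z + 2 * modulus h) ^+ n.
Proof.
pose t k := z ^+ (n - k) * h ^+ k *+ 'C(n, k).
have E : (z + h) ^+ n = \sum_(k < K + n.+1) t k.
  rewrite exprDn addnC big_split_ord/= [X in _ = _ + X]big1 ?addr0// => i _.
  by rewrite /t bin_small ?mulr0n//= ltn_addr.
rewrite E big_split_ord/= addrAC subrr add0r (le_trans (modulus_sum _ _ _))//.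
have -> : (modulus z + 2 * modulus h) ^+ n =
    \sum_(k < K + n.+1) modulus z ^+ (n - k) * (2 * modulus h) ^+ k *+ 'C(n, k).
  rewrite exprDn addnC big_split_ord/= [X in _ = _ + X]big1 ?addr0// => i _.
  by rewrite bin_small ?mulr0n//= ltn_addr.
rewrite big_split_ord/= mulrDr ler_wpDl//.
  rewrite mulr_ge0 ?exprn_ge0 ?invr_ge0// sumr_ge0// => i _.
  by rewrite mulrn_wge0// mulr_ge0// exprn_ge0// mulr_ge0.
rewrite mulr_sumr ler_sum// => i _; rewrite /t -[_ *+ 'C(_, _) in leLHS]mulr_natr.
rewrite modulusM modulus_nat modulusM !modulusX exprMn.
set A := modulus z ^+ _; set B := modulus h ^+ _; set c := _%:R.
have A0 : 0 <= A * B * c by rewrite !mulr_ge0 ?exprn_ge0.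
rewrite [leRHS](_ : _ = 2 ^+ i * (A * B * c)).
  have h2 : 1 <= 2 ^+ i :> R by rewrite exprn_ege1// ler1n.
  move: A0 h2; set X := A * B * c; set Y := 2 ^+ i => A0 h2; nra.
rewrite -[_ *+ 'C(_, _)]mulr_natr exprD -/c.
have E2 : 2^-1 ^+ K * 2 ^+ K = 1 :> R by rewrite -exprMn mulVf ?expr1n ?pnatr_eq0.
transitivity ((2^-1 ^+ K * 2 ^+ K) * (2 ^+ i * (A * B * c))); last by rewrite E2 mul1r.
move: (2^-1 ^+ K) (2 ^+ K) (2 ^+ i) => u v w; ring.
Qed.

(** Interchanging the two summations is avoided: by [binom_tail] the first K terms in
h already reproduce the series up to O(2^(-K)).  The price is the condition
|z0| + 2 |h| < r instead of |z0| + |h| < r. *)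
Lemma reexpand a (r M : R) z0 : modulus z0 < r ->
  (forall k, modulus (a k) * r ^+ k <= M) ->
  exists b, (forall k, cvgsum (fun n => a n * (z0 ^+ (n - k) *+ 'C(n, k))) (b k)) /\
  forall h l, modulus z0 + 2 * modulus h < r ->
    cvgsum (fun k => a k * (z0 + h) ^+ k) l -> cvgsum (fun k => b k * h ^+ k) l.
Proof.
move=> zr aM; have r0 : 0 < r by apply: le_lt_trans zr.
have hb k : exists bk, cvgsum (fun n => a n * (z0 ^+ (n - k) *+ 'C(n, k))) bk.
  pose d := (r - modulus z0) / 2; pose s := modulus z0 + d.
  have d0 : 0 < d by rewrite /d; lra.
  have s0 : 0 <= s by rewrite addr_ge0// ltW.
  (* (|z0| + d)^n has the term d^k |z0|^(n-k) C(n, k), which bounds the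
     n-th term of the series for b k *)
  have sr : 0 <= s / r < 1.
    by rewrite divr_ge0 ?(ltW r0)//= ltr_pdivrMr// mul1r /s /d; lra.
  apply: (@cvgsum_geo _ _ (M / d ^+ k) _ sr) => n.
  rewrite mulrAC ler_pdivlMr ?exprn_gt0//.
  apply: le_trans (geo_term r0 s0 (aM n)).
  rewrite modulusM -mulrA ler_wpM2l// /s exprDn -mulr_natr modulusM modulusX modulus_nat.
  have [nk|kn] := ltnP n k.
    rewrite bin_small// mulr0 mul0r sumr_ge0// => i _.
    by rewrite mulrn_wge0// mulr_ge0// exprn_ge0// ltW.
  rewrite (bigD1 (inord k))//= inordK ?ltnS// -[X in _ <= X + _]mulr_natr mulrAC lerDl.
  by rewrite sumr_ge0// => i _; rewrite mulrn_wge0// mulr_ge0// exprn_ge0// ltW.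
pose b k := sval (cid (hb k)); exists b; split=> [k|h l hr al].
  exact: svalP (cid (hb k)).
pose s := modulus z0 + 2 * modulus h.
have s0 : 0 <= s by rewrite addr_ge0// mulr_ge0.
have sr : 0 <= s / r < 1 by rewrite divr_ge0 ?(ltW r0)//= ltr_pdivrMr// mul1r.
have key K : modulus (l - \sum_(k < K) b k * h ^+ k) <= 2^-1 ^+ K * (M / (1 - s / r)).
  have fin : cvgsum (fun n => \sum_(k < K) h ^+ k * (a n * (z0 ^+ (n - k) *+ 'C(n, k))))
                    (\sum_(k < K) h ^+ k * b k).
    elim: K => [|K IH]; first by rewrite big_ord0; apply: eq_cvgsum cvgsum0 => n; rewrite big_ord0.
    rewrite big_ord_recr/=; apply: eq_cvgsum (cvgsumD IH (cvgsumZ _ (svalP (cid (hb K))))).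
    by move=> n; rewrite big_ord_recr.
  rewrite mulrA; under eq_bigr do rewrite mulrC.
  apply: (cvgsum_geo_le sr _ (cvgsumB al fin)) => n.
  have -> : \sum_(k < K) h ^+ k * (a n * (z0 ^+ (n - k) *+ 'C(n, k))) =
            a n * \sum_(k < K) (z0 ^+ (n - k) * h ^+ k *+ 'C(n, k)).
    rewrite mulr_sumr; apply: eq_bigr => k _. by rewrite mulrCA; congr (_ * _); rewrite mulrnAr [h ^+ k * _]mulrC.
  rewrite -mulrBr modulusM -mulrA.
  apply: (@le_trans _ _ (modulus (a n) * (2^-1 ^+ K * s ^+ n))).
    by rewrite ler_wpM2l// binom_tail.
  rewrite mulrCA ler_wpM2l ?exprn_ge0 ?invr_ge0//.
  exact: geo_term r0 s0 (aM n).
move=> e e0; set Q := M / _ in key.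
have Q0 : 0 <= Q.
  rewrite divr_ge0//; last by rewrite subr_ge0 ltW//; case/andP: sr.
  by rewrite (le_trans _ (aM 0%N))// mulr_ge0// exprn_ge0// ltW.
have h2 : 0 <= (2^-1 : R) < 1 by lra.
have [N NP] := geo_small Q h2 e0.
exists N => n /NP; apply: le_lt_trans; rewrite modulusBC mulrC; exact: key.
Qed.

End power_series.

(** * Sums of power series are analytic *)

Section series_analytic.
Local Open Scope complex_scope.
Context {R : realType}.
Local Notation C := (Cplx R).
Implicit Types (x y : R) (z w l : C) (a b : nat -> C) (f g : C -> C).

Lemma cvgsum_at0 a l : cvgsum (fun k => a k * 0 ^+ k) l -> l = a 0%N.
Proof.
move=> al; apply: cvgsum_uniq al _.
have := @cvgsum_fin R 1 (fun k => a k * 0 ^+ k); rewrite big_ord1 expr0 mulr1.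
by apply => -[|k]// _; rewrite expr0n mulr0.
Qed.

Lemma local_series_at a z0 f : local_series a z0 f -> f z0 = a 0%N.
Proof.
move=> [d d0 H]; apply: cvgsum_at0; have := H z0; rewrite subrr modulus0.
exact.
Qed.

Lemma local_series_bound a z0 f : local_series a z0 f ->
  exists2 r, 0 < r & exists2 M, 0 < M & forall k, modulus (a k) * r ^+ k <= M.
Proof.
move=> [d d0 H]; exists (d / 2); first by rewrite divr_gt0.
have d2 : 0 <= d / 2 by rewrite divr_ge0// ltW.
have := H (z0 + (d / 2)%:C); rewrite addrAC subrr add0r real_pt_modulus//.
by move=> /(_ ltac:(lra))/cvgsum_coef_bound; rewrite real_pt_modulus.
Qed.

Lemma subX_le (z w : C) (d : R) n : modulus z <= d -> modulus w <= d ->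
  modulus (z ^+ n.+1 - w ^+ n.+1) <= modulus (z - w) * (n.+1%:R * d ^+ n).
Proof.
move=> zd wd; have d0 : 0 <= d by rewrite (le_trans _ zd).
rewrite subrXX modulusM ler_wpM2l// (le_trans (modulus_sum _ _ _))//.
rewrite mulr_natl -[n.+1 in leRHS]card_ord -sumr_const ler_sum// => i _.
rewrite modulusM !modulusX /= -[X in d ^+ X](@subnK i n) ?exprD; last by rewrite -ltnS.
by rewrite ler_pM ?exprn_ge0// lerXn2r// nnegrE.
Qed.

(** Every term of order at least two is O(t) |z - w| on the ball of radius t, and the
Lipschitz constants (k+2) t^(k+1) of the powers are summable against the
coefficients once t is small compared with the radius of convergence. *)
Lemma local_series_strict_diff b z0 f : local_series b z0 f -> strict_diff f z0 (b 1%N).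
Proof.
move=> bf; have [r r0 [M M0 bM]] := local_series_bound bf; case: bf => d d0 bf e e0.
(* t <= r / 4 gives the ratio 2 t / r <= 1/2, the last bound the constant e *)
pose t := Num.min d (Num.min (r / 4) (e * r ^+ 2 / (4 * M))).
have t0 : 0 < t by rewrite !lt_min d0 !divr_gt0// ?mulr_gt0// ?exprn_gt0.
exists t => // z w zt wt.
have [td tr te] : [/\ t <= d, t <= r / 4 & t <= e * r ^+ 2 / (4 * M)].
  by rewrite /t !ge_min !lexx !orbT.
have h1 := bf z (lt_le_trans zt td); have h2 := bf w (lt_le_trans wt td).
have := cvgsumB h1 h2 => /(cvgsum_shift 2).
rewrite !big_ord_recl big_ord0/= !expr0 !expr1 subrr add0r addr0 -mulrBr.
rewrite (_ : z - z0 - (w - z0) = z - w); last by ring.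
move=> h; set q := 2 * t / r; have q01 : 0 <= q <= 2^-1.
  by rewrite /q divr_ge0 ?mulr_ge0 ?(ltW t0) ?(ltW r0)//= ler_pdivrMr//; lra.
have := @cvgsum_geo_le R _ _ (modulus (z - w) * (M / r * q)) q _ _ h.
have qlt : 0 <= q < 1 by lra.
move=> /(_ qlt) H; apply: le_trans (H _) _.
  move=> k; rewrite -mulrBr modulusM add2n.
  have zt' := ltW zt; have wt' := ltW wt.
  have := ler_wpM2l (modulus_ge0 (b k.+2)) (@subX_le _ _ t k.+1 zt' wt').
  rewrite (_ : z - z0 - (w - z0) = z - w); last by ring.
  move=> /le_trans; apply.
  rewrite mulrCA -[leRHS]mulrA; apply: ler_wpM2l => //; rewrite -[leRHS]mulrA -exprS.
  have nk : k.+2%:R <= 2 ^+ k.+1 :> R.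
    by rewrite -natrX ler_nat ltn_expl.
  apply: (@le_trans _ _ (modulus (b k.+2) * ((2 * t) ^+ k.+1))).
    by rewrite ler_wpM2l// exprMn ler_wpM2r// exprn_ge0 ?ltW.
  rewrite /q expr_div_n mulrA ler_pdivlMr ?exprn_gt0// mulrAC ler_pM2r; last first.
    by rewrite exprn_gt0// mulr_gt0.
  by rewrite ler_pdivlMr// -mulrA -exprSr.
rewrite -[leLHS]mulrA [leRHS]mulrC; apply: ler_wpM2l => //.
rewrite ler_pdivrMr; last by lra.
apply: (@le_trans _ _ (e / 2)); last by nra.
move: te; rewrite ler_pdivlMr ?mulr_gt0// => te.
rewrite /q mulrA ler_pdivrMr// mulrAC ler_pdivrMr//; nra.
Qed.

Lemma strict_diff_derive1 f z0 L : strict_diff f z0 L ->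
  derive1 (f : R[i] -> C) z0 = L.
Proof.
move=> fL; rewrite /derive1; apply: cvg_lim => //.
move=> A /nbhsCP[e e0 eA].
have e20 : 0 < e / 2 by lra.
have [d d0 H] := fL _ e20.
rewrite /dnbhs/= nbhs_filterE; apply/(@nbhsCP R 0); exists d => // h.
rewrite subr0 => hd /= h0; apply: eA.
have := H (h + z0) z0; rewrite subrr modulus0 addrK => /(_ hd d0) H'.
have h0' : 0 < modulus h by rewrite modulus_gt0.
have -> : h^-1 *: (f (h + z0) - f z0) - L = h^-1 * (f (h + z0) - f z0 - L * h).
  by rewrite mulrBr [L * h]mulrC mulrA mulVf ?mul1r.
rewrite modulusM modulusV mulrC ltr_pdivrMr// (le_lt_trans H')//.
by rewrite ltr_pM2r//; lra.
Qed.

Lemma has_series_local_series a f z0 : has_series a f -> modulus z0 < 1 ->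
  exists b, (forall k, cvgsum (fun n => a n * (z0 ^+ (n - k) *+ 'C(n, k))) (b k)) /\
   local_series b z0 f.
Proof.
move=> af z01; pose r := (modulus z0 + 1) / 2.
have r01 : 0 <= r < 1.
  by have := modulus_ge0 z0; rewrite /r; lra.
have zr : modulus z0 < r by rewrite /r; lra.
have [M M0 aM] := has_series_bound af r01.
have [b [b1 b2]] := reexpand zr aM.
exists b; split=> //; exists ((r - modulus z0) / 2) => [|z zd]; first by lra.
apply: b2; first by lra.
rewrite addrC subrK; apply: af.
rewrite -(subrK z0 z) (le_lt_trans (modulusD _ _))//; lra.
Qed.

Lemma has_series_analytic a f : has_series a f -> analytic_disc f.
Proof.
move=> af z /unit_discE z1; have [b [_ bf]] := has_series_local_series af z1.
by apply/analytic_atP; exists b.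
Qed.

(** The derivative at z0 is the linear coefficient of the expansion at z0. *)
Lemma has_series_derive a f : has_series a f ->
  has_series (fun k => a k.+1 *+ k.+1) (derive1 (f : R[i] -> C)).
Proof.
move=> af z z1; have [b [H bf]] := has_series_local_series af z1.
rewrite (strict_diff_derive1 (local_series_strict_diff bf)).
have := H 1%N => /(cvgsum_shift 1).
rewrite big_ord1 bin0n/= mulr0n mulr0 subr0; apply: eq_cvgsum => k.
by rewrite add1n subSS subn0 bin1 mulrnAl mulrnAr.
Qed.

Lemma has_series_deriven a f n : has_series a f ->
  has_series (fun k => a (n + k)%N *+ ((n + k) ^_ n)) (derive1n n (f : R[i] -> C)).
Proof.
move=> af; elim: n => [|n IH].
  by move=> z /af; apply: eq_cvgsum => k; rewrite add0n ffactn0 mulr1n.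
rewrite derive1nS; have := has_series_derive IH.
congr (has_series _ _); apply/funext => k.
by rewrite -mulrnA addnS -addSn ffactnSr addSnnS addKn mulnC.
Qed.

Lemma has_series_taylor a f : has_series a f -> taylor_coef f = a.
Proof.
move=> af; apply/funext => n; rewrite /taylor_coef.
have := has_series_deriven n af => /(_ 0).
rewrite modulus0 ltr01 => /(_ isT)/cvgsum_at0 ->.
rewrite addn0 ffactnn -[X in X / _]mulr_natr mulfK//.
Qed.

Lemma has_series_tail a f (r e : R) : has_series a f -> 0 < r < 1 -> 0 < e ->
  exists N, forall n z, (N <= n)%N -> modulus z <= r ->
  modulus (f z - \sum_(k < n) a k * z ^+ k) <= e.
Proof.
move=> af /andP[r0 r1] e0; pose r' := (r + 1) / 2.
have [rr' r'1] : r < r' /\ 0 <= r' < 1 by split; rewrite /r'; lra.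
have r'0 : 0 < r' by exact: lt_trans rr'.
have [M M0 HM] := has_series_bound af r'1.
have t01 : 0 <= r / r' < 1 by rewrite divr_ge0 ?ltW//= ltr_pdivrMr// mul1r.
have t1 : 0 < 1 - r / r' by rewrite subr_gt0; case/andP: t01.
have [N HN] := geo_small M t01 (mulr_gt0 e0 t1).
exists N => n z Nn zr; have z1 : modulus z < 1 by exact: le_lt_trans r1.
have ak k : modulus (a k * z ^+ k) <= M * (r / r') ^+ k.
  apply: le_trans (geo_term r'0 (ltW r0) (HM k)).
  by rewrite modulusM modulusX ler_wpM2l// lerXn2r ?nnegrE ?modulus_ge0 ?(ltW r0).
apply: le_trans (cvgsum_geo_tail n t01 ak (af z z1)) _.
by rewrite ler_pdivrMr// ltW// HN.
Qed.

End series_analytic.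

(** * Circles and annuli *)

Section circle.
Local Open Scope complex_scope.
Context {R : realType}.
Local Notation C := (Cplx R).
Implicit Types (x y r s t : R) (z w l : C) (a b : nat -> C) (f g : C -> C).

Lemma circle_ptM r s t t' :
  circle_pt r t * circle_pt s t' = circle_pt (r * s) (t + t') :> C.
Proof.
rewrite /circle_pt; apply/eqP; rewrite eq_complex/= cosD sinD.
by apply/andP; split; apply/eqP; ring.
Qed.

Lemma modulus_circle r t : modulus (circle_pt r t) = `|r|.
Proof.
rewrite modulusE/= !exprMn -mulrDr cos2Dsin2 mulr1 sqrtr_sqr//.
Qed.

Lemma circle_pt0 r : circle_pt r 0 = r%:C :> C.
Proof. by rewrite /circle_pt cos0 sin0 mulr1 mulr0. Qed.

Lemma circle_ptX r t n : circle_pt r t ^+ n = circle_pt (r ^+ n) (n%:R * t) :> C.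
Proof.
elim: n => [|n IH]; first by rewrite !expr0 mul0r circle_pt0.
by rewrite !exprS IH circle_ptM -natr1 mulrDl mul1r addrC.
Qed.

Lemma circle_pt_real r t : circle_pt r t = r%:C * circle_pt 1 t :> C.
Proof. by rewrite -circle_pt0 circle_ptM mulr1 add0r. Qed.

Lemma circle_pt_2pi r t : circle_pt r (t + 2 * pi) = circle_pt r t :> C.
Proof.
by rewrite /circle_pt mulr_natl sinD2pi cosD2pi.
Qed.

Lemma circle_pt_eq0 r t : r != 0 -> circle_pt r t != 0 :> C.
Proof. by move=> r0; rewrite -modulus_eq0 modulus_circle normr_eq0. Qed.

Lemma conj_circle r t : cj (circle_pt r t) = circle_pt r (- t).
Proof. by rewrite /cj /circle_pt/= cosN sinN mulrN. Qed.

Lemma derive_small (h : R -> R) (a dh e : R) : is_derive a 1 h dh -> 0 < e ->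
  exists2 d, 0 < d & forall s, 0 < s < d -> `|h (a + s) - h a - dh * s| <= e * s.
Proof.
move=> [hd hv] e0; have := hd; rewrite /derivable => hc.
have : (fun h0 => h0^-1 *: ((h \o shift a) (h0 *: (1:R)) - h a)) @ 0^' --> dh.
  by rewrite -hv /derive.
move=> /cvgrPdist_lt/(_ _ e0).
rewrite /dnbhs/= near_withinE => /nbhs_ballP[d /= d0 H].
exists d => // s /andP[s0 sd].
have := H s; rewrite /ball/= sub0r normrN gtr0_norm// => /(_ sd).
move=> /(_ (lt0r_neq0 s0)) /ltW; rewrite /= [s *: 1]mulr1 [s + a]addrC.
move=> h1; have -> : h (a + s) - h a - dh * s =
    - ((dh - s^-1 *: (h (a + s) - h a)) * s).
  rewrite mulrBl opprB; congr (_ - _).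
  by rewrite /GRing.scale/= mulrAC mulVf ?mul1r ?gt_eqF.
by rewrite normrN normrM (gtr0_norm s0) ler_wpM2r// ltW.
Qed.

Lemma circle_small (e : R) : 0 < e ->
  exists2 d, 0 < d & forall s, 0 < s < d ->
    `|cos s - 1| <= e * s /\ `|sin s - s| <= e * s.
Proof.
move=> e0; have [d1 d10 H1] := derive_small (is_derive_cos (0:R)) e0.
have [d2 d20 H2] := derive_small (is_derive_sin (0:R)) e0.
exists (Num.min d1 d2); first by rewrite lt_min d10.
move=> s; rewrite lt_min => /andP[s0 /andP[s1 s2]].
have := H1 s; rewrite s0 s1 => /(_ isT); have := H2 s; rewrite s0 s2 => /(_ isT).
by rewrite !add0r cos0 sin0 !(oppr0, mul0r, subr0, addr0, mul1r) => ? ?; split.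
Qed.

Lemma continuous_circle (r0 t0 e : R) : 0 < e ->
  \forall x \near (r0, t0), modulus (circle_pt x.1 x.2 - circle_pt r0 t0) < e.
Proof.
move=> e0; have e20 : 0 < e / 2 by lra.
have H1 : (fun x : R * R => x.1 * cos x.2) @ (r0, t0) --> r0 * cos t0.
  apply: (@cvgM _ _ (nbhs (r0, t0)) _ (fun x : R * R => x.1) (fun x : R * R => cos x.2)).
    exact: cvg_fst.
  apply: (@cvg_comp _ _ _ (fun x : R * R => x.2) cos _ (nbhs t0)); first exact: cvg_snd.
  exact: continuous_cos.
have H2 : (fun x : R * R => x.1 * sin x.2) @ (r0, t0) --> r0 * sin t0.
  apply: (@cvgM _ _ (nbhs (r0, t0)) _ (fun x : R * R => x.1) (fun x : R * R => sin x.2)).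
    exact: cvg_fst.
  apply: (@cvg_comp _ _ _ (fun x : R * R => x.2) sin _ (nbhs t0)); first exact: cvg_snd.
  exact: continuous_sin.
move/cvgrPdist_lt/(_ _ e20) : H1 => H1; move/cvgrPdist_lt/(_ _ e20) : H2 => H2.
apply: filterS2 H1 H2 => x /= h1 h2.
rewrite (le_lt_trans (modulus_le_ReIm _))//=.
by rewrite distrC [X in _ + X]distrC [ltRHS](splitr e) ltrD.
Qed.

(** A property that holds locally for small positive s holds on a compact annulus
with one bound on s, because the rectangle of polar coordinates is compact. *)
Lemma annulus_uniform (r1 r2 : R) (P : R -> C -> Prop) :
  (forall z, r1 <= modulus z <= r2 -> exists2 d, 0 < d &
     forall w s, modulus (w - z) < d -> 0 < s < d -> P s w) ->
  0 <= r1 ->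
  exists2 d, 0 < d & forall s r t, 0 < s < d -> r1 <= r <= r2 -> 0 <= t <= 2 * pi ->
    P s (circle_pt r t).
Proof.
move=> H r10.
have K : compact (`[r1, r2] `*` `[0, 2 * pi] : set (R * R)).
  by apply: compact_setX; apply: segment_compact.
have cov : forall x : R * R, (`[r1, r2] `*` `[0, 2 * pi])%classic x ->
  \forall x' \near x & i \near (0 : R)^'+, P i (circle_pt x'.1 x'.2).
  move=> -[r t] /= [/andP[r1r rr2] _].
  have := H (circle_pt r t); rewrite modulus_circle ger0_norm; last first.
    by move: r1r; rewrite bnd_simp; exact: le_trans.
  move: r1r rr2; rewrite !bnd_simp => r1r rr2; rewrite r1r rr2 => /(_ isT)[d d0 dP].
  exists ([set x | modulus (circle_pt x.1 x.2 - circle_pt r t) < d], [set s | 0 < s < d]).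
    split=> /=; first exact: continuous_circle.
    near=> s; apply/andP; split; near: s; first exact: nbhs_right_gt.
    exact: nbhs_right_lt.
  by move=> [x s] /= [xd sd]; exact: dP.
have FF : Filter (at_right (0:R)) by exact: _.
have nc := (compact_near_coveringP _).1 K; have := nc R (at_right (0:R)) (fun (s : R) (x : R * R) => P s (circle_pt x.1 x.2)) _ cov.
move=> /(_ FF); rewrite near_withinE => /nbhs_ballP[d /= d0 dP].
exists d => // s r t /andP[s0 sd] rr tt; have := dP s.
rewrite /ball/= sub0r normrN gtr0_norm// => /(_ sd s0)/(_ (r, t)) /=.
by apply; split; rewrite /= in_itv.
Unshelve. all: by end_near. Qed.

End circle.

(** * Strict differentiability *)

Section mean_value.
Local Open Scope complex_scope.
Context {R : realType}.
Local Notation C := (Cplx R).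
Implicit Types (x y r s t e : R) (z w l : C) (a b : nat -> C) (f g : C -> C).

Lemma strict_diff_cont f z0 L e : strict_diff f z0 L -> 0 < e ->
  exists2 d, 0 < d & forall z, modulus (z - z0) < d -> modulus (f z - f z0) < e.
Proof.
move=> fL e0; have [d d0 H] := fL _ (@ltr01 R).
have L0 : 0 < modulus L + 2 by have := modulus_ge0 L; lra.
exists (Num.min d (e / (modulus L + 2))); first by rewrite lt_min d0 divr_gt0.
move=> z; rewrite lt_min => /andP[zd]; rewrite ltr_pdivlMr// => ze.
have := H z z0 zd; rewrite subrr modulus0 => /(_ d0) h.
rewrite (_ : f z - f z0 = (f z - f z0 - L * (z - z0)) + L * (z - z0)); last by ring.
rewrite (le_lt_trans (modulusD _ _))// modulusM.
have := modulus_ge0 (z - z0); have := modulus_ge0 L; nra.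
Qed.

Lemma strict_diff_eq f g z0 L : (exists2 d : R, 0 < d & forall z, modulus (z - z0) < d -> f z = g z) ->
  strict_diff f z0 L -> strict_diff g z0 L.
Proof.
move=> [d d0 fg] fL e e0; have [d' d'0 H] := fL _ e0.
exists (Num.min d d'); first by rewrite lt_min d0.
move=> z w; rewrite !lt_min => /andP[zd zd'] /andP[wd wd'].
by rewrite -!fg//; exact: H.
Qed.

Lemma strict_diff_cst z z0 : strict_diff (fun=> z) z0 0.
Proof.
by move=> e e0; exists 1 => // x y _ _; rewrite subrr mul0r subr0 modulus0; apply: mulr_ge0 => //; exact: ltW.
Qed.

Lemma strict_diff_id z0 : strict_diff id z0 1.
Proof.
by move=> e e0; exists 1 => // x y _ _; rewrite mul1r subrr modulus0; apply: mulr_ge0 => //; exact: ltW.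
Qed.

Lemma strict_diffD f g z0 L L' : strict_diff f z0 L -> strict_diff g z0 L' ->
  strict_diff (fun z => f z + g z) z0 (L + L').
Proof.
move=> fL gL e e0; have e20 : 0 < e / 2 by lra.
have [d d0 H] := fL _ e20; have [d' d'0 H'] := gL _ e20.
exists (Num.min d d'); first by rewrite lt_min d0.
move=> z w; rewrite !lt_min => /andP[zd zd'] /andP[wd wd'].
rewrite (_ : _ - _ = (f z - f w - L * (z - w)) + (g z - g w - L' * (z - w))); last by ring.
rewrite (le_trans (modulusD _ _))//.
by have := H _ _ zd wd; have := H' _ _ zd' wd'; lra.
Qed.

Lemma strict_diffM f g z0 L L' : strict_diff f z0 L -> strict_diff g z0 L' ->
  strict_diff (fun z => f z * g z) z0 (f z0 * L' + g z0 * L).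
Proof.
move=> fL gL e e0.
pose A := modulus (f z0) + 1; pose B := modulus (g z0) + 1.
pose D := 1 + modulus L + modulus L'.
have [A0 B0 D0] : [/\ 0 < A, 0 < B & 0 < D].
  have := modulus_ge0 (f z0); have := modulus_ge0 (g z0); have := modulus_ge0 L.
  by have := modulus_ge0 L'; rewrite /A /B /D; split; lra.
have eA : 0 < e / (4 * A) by rewrite divr_gt0// mulr_gt0.
have eB : 0 < e / (4 * B) by rewrite divr_gt0// mulr_gt0.
have eD : 0 < Num.min 1 (e / (4 * D)) by rewrite lt_min ltr01 divr_gt0// mulr_gt0.
have [d1 d10 H1] := fL _ eB; have [d2 d20 H2] := gL _ eA.
have [d3 d30 H3] := strict_diff_cont fL eD; have [d4 d40 H4] := strict_diff_cont gL eD.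
exists (Num.min (Num.min d1 d2) (Num.min d3 d4)); first by rewrite !lt_min d10 d20 d30.
move=> z w; rewrite !lt_min => /andP[/andP[z1 z2] /andP[z3 z4]] /andP[/andP[w1 w2] /andP[w3 w4]].
rewrite (_ : _ - _ = f z * (g z - g w - L' * (z - w)) + g w * (f z - f w - L * (z - w)) +
   ((f z - f z0) * L' * (z - w) + (g w - g z0) * L * (z - w))); last by ring.
have := H1 _ _ z1 w1; have := H2 _ _ z2 w2.
have := H3 _ z3; have := H4 _ w4; rewrite !lt_min => /andP[gw1 gwD] /andP[fz1 fzD] h2 h1.
have fA : modulus (f z) <= A.
  by rewrite -(subrK (f z0) (f z)) (le_trans (modulusD _ _))// /A; lra.
have gB : modulus (g w) <= B.
  by rewrite -(subrK (g z0) (g w)) (le_trans (modulusD _ _))// /B; lra.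
rewrite (le_trans (modulusD _ _))//.
have [m0 m1] := (modulus_ge0 (z - w), modulus_ge0 (z - w)).
have T1 : modulus (f z * (g z - g w - L' * (z - w))) <= e / 4 * modulus (z - w).
  rewrite modulusM (le_trans (ler_pM _ _ fA h2))//.
  by rewrite le_eqVlt; apply/orP; left; apply/eqP; field; apply: lt0r_neq0.
have T2 : modulus (g w * (f z - f w - L * (z - w))) <= e / 4 * modulus (z - w).
  rewrite modulusM (le_trans (ler_pM _ _ gB h1))//.
  by rewrite le_eqVlt; apply/orP; left; apply/eqP; field; apply: lt0r_neq0.
have T3 : modulus ((f z - f z0) * L' * (z - w)) <= e / 4 * modulus (z - w).
  rewrite !modulusM ler_wpM2r//.
  apply: (@le_trans _ _ (e / (4 * D) * D)); last first.
    by rewrite le_eqVlt; apply/orP; left; apply/eqP; field; apply: lt0r_neq0.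
  by apply: ler_pM => //; [exact: ltW|rewrite /D; have := modulus_ge0 L; lra].
have T4 : modulus ((g w - g z0) * L * (z - w)) <= e / 4 * modulus (z - w).
  rewrite !modulusM ler_wpM2r//.
  apply: (@le_trans _ _ (e / (4 * D) * D)); last first.
    by rewrite le_eqVlt; apply/orP; left; apply/eqP; field; apply: lt0r_neq0.
  by apply: ler_pM => //; [exact: ltW|rewrite /D; have := modulus_ge0 L'; lra].
have := modulusD (f z * (g z - g w - L' * (z - w))) (g w * (f z - f w - L * (z - w))).
have := modulusD ((f z - f z0) * L' * (z - w)) ((g w - g z0) * L * (z - w)).
lra.
Qed.

Lemma cvgsum_geometric z : modulus z < 1 -> cvgsum (fun k => z ^+ k) (1 - z)^-1.
Proof.
move=> z1 e e0; have z1' : 1 - z != 0.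
  by rewrite subr_eq0; apply: contraTneq z1 => <-; rewrite modulus1 ltxx.
have h : 0 <= modulus z < 1 by rewrite z1 modulus_ge0.
have [N NP] := geo_small (modulus (1 - z))^-1 h e0.
exists N => n /NP; apply: le_lt_trans.
have -> : \sum_(k < n) z ^+ k - (1 - z)^-1 = - (z ^+ n / (1 - z)).
  apply: (mulIf z1'); rewrite mulrBl mulNr mulfVK// mulVf//.
  by rewrite -[1 - z]opprB mulrN mulrC -subrX1; ring.
by rewrite modulusN modulusM modulusV modulusX mulrC.
Qed.

(** The inverse is a geometric series near z0, so the general statement on power
series applies. *)
Lemma strict_diff_inv z0 w : z0 != w -> exists L, strict_diff (fun z => (z - w)^-1) z0 L.
Proof.
move=> zw; have zw0 : z0 - w != 0 by rewrite subr_eq0.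
pose b k := (z0 - w)^-1 * (- (z0 - w)^-1) ^+ k.
exists (b 1%N); apply: local_series_strict_diff.
exists (modulus (z0 - w)) => [|z zd]; first by rewrite modulus_gt0.
have m1 : modulus (- (z0 - w)^-1 * (z - z0)) < 1.
  by rewrite modulusM modulusN modulusV mulrC ltr_pdivrMr ?mul1r// modulus_gt0.
have := cvgsumZ (z0 - w)^-1 (cvgsum_geometric m1).
have -> : (z0 - w)^-1 * (1 - - (z0 - w)^-1 * (z - z0))^-1 = (z - w)^-1.
  rewrite -invfM mulrBr mulr1 mulNr mulrN opprK mulrA mulfV// mul1r.
  by congr (_^-1); ring.
by apply: eq_cvgsum => k; rewrite /b exprMn mulrA.
Qed.

Definition diffble f z0 := exists L, strict_diff f z0 L.

Lemma diffbleX f z0 n : diffble f z0 -> diffble (fun z => f z ^+ n) z0.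
Proof.
move=> [L fL]; elim: n => [|n [L' IH]]; first by eexists; exact: strict_diff_cst.
eexists; apply: strict_diff_eq (strict_diffM fL IH).
by exists 1 => // z _; rewrite exprS.
Qed.

Lemma diffbleM f g z0 : diffble f z0 -> diffble g z0 -> diffble (fun z => f z * g z) z0.
Proof. by move=> [L fL] [L' gL]; eexists; exact: strict_diffM fL gL. Qed.

Lemma diffbleB f g z0 : diffble f z0 -> diffble g z0 -> diffble (fun z => f z - g z) z0.
Proof.
move=> df [L gL]; have [L' mL] := diffbleM (ex_intro _ _ (strict_diff_cst (-1) z0)) (ex_intro _ _ gL).
case: df => L'' fL; eexists; apply: strict_diff_eq (strict_diffD fL mL).
by exists 1 => // z _; rewrite mulN1r.
Qed.

Lemma diffble_sum n (F : nat -> C -> C) z0 : (forall i, diffble (F i) z0) ->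
  diffble (fun z => \sum_(i < n) F i z) z0.
Proof.
move=> H; elim: n => [|n [L IH]].
  by eexists; apply: strict_diff_eq (strict_diff_cst 0 z0); exists 1 => // z _; rewrite big_ord0.
have [L' H'] := H n; eexists; apply: strict_diff_eq (strict_diffD IH H').
by exists 1 => // z _; rewrite big_ord_recr.
Qed.

(** The n-th remainder of the expansion at w, divided by (z - w)^n; the removable
singularity is filled with the coefficient b n. *)
Definition rquot b w n f z : C :=
  if z == w then b n else (f z - \sum_(i < n) b i * (z - w) ^+ i) / (z - w) ^+ n.

Lemma rquot_local_series b w n f : local_series b w f ->
  local_series (fun k => b (n + k)%N) w (rquot b w n f).
Proof.
move=> bf; case: (bf) => d d0 H; exists d => // z zd; rewrite /rquot.
case: eqVneq => [->|zw].
  rewrite subrr; have := @cvgsum_fin R 1 (fun k => b (n + k)%N * 0 ^+ k).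
  rewrite big_ord1 addn0 expr0 mulr1; apply => -[|k]// _.
  by rewrite expr0n mulr0.
have zw0 : z - w != 0 by rewrite subr_eq0.
have := cvgsumZ ((z - w) ^+ n)^-1 ((cvgsum_shift n _ _).1 (H z zd)).
rewrite mulrC; apply: eq_cvgsum => k.
by rewrite exprD mulrCA mulKf// expf_neq0.
Qed.

Lemma rquot_diffble b w n f z : local_series b w f -> diffble f z -> diffble (rquot b w n f) z.
Proof.
move=> bf fz; have [->|zw] := eqVneq z w.
  by eexists; apply: local_series_strict_diff (rquot_local_series n bf).
have [L1 H1] : diffble (fun z => (f z - \sum_(i < n) b i * (z - w) ^+ i) * ((z - w)^-1) ^+ n) z.
  apply: diffbleM; last by apply: diffbleX; exact: strict_diff_inv.
  apply: diffbleB => //; apply: (@diffble_sum n (fun i z => b i * (z - w) ^+ i)) => i.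
  apply: diffbleM; first by eexists; exact: strict_diff_cst.
  apply: diffbleX; apply: diffbleB; first by eexists; exact: strict_diff_id.
  by eexists; exact: strict_diff_cst.
exists L1; apply: strict_diff_eq H1.
exists (modulus (z - w)) => [|x xz]; first by rewrite modulus_gt0 subr_eq0.
rewrite /rquot; case: eqVneq xz => [->|xw _]; first by rewrite modulusBC ltxx.
by rewrite exprVn.
Qed.

End mean_value.

(** * The mean value property *)

Section discrete_means.
Local Open Scope complex_scope.
Context {R : realType}.
Local Notation C := (Cplx R).
Implicit Types (x y r s t e : R) (z w l : C) (a b : nat -> C) (f g : C -> C).

(** A step of length s along the radius and a step of length s along the circle give
the increments L w s and i L w s up to o(s): multiplying the second by i makes
them cancel. *)
Lemma cauchy_riemann_defect f z0 e : diffble f z0 -> 0 < e ->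
  exists2 d, 0 < d & forall w s, modulus (w - z0) < d -> 0 < s < d ->
  modulus (f (w * (1 + s)%:C) - f w + 'i * (f (w * circle_pt 1 s) - f w)) <= e * s.
Proof.
move=> [L fL] e0; pose A := modulus z0 + 1; pose B := modulus L + 1.
have A0 : 0 < A by rewrite /A; have := modulus_ge0 z0; lra.
have B0 : 0 < B by rewrite /B; have := modulus_ge0 L; lra.
(* A bounds |w| and B bounds |L|; a step along the circle has length at most 3 s |w|,
   so the two linearizations cost e s / 8 and 3 e s / 8, and the arc against its
   tangent e s / 2 *)
pose e1 := e / (8 * A); pose h := Num.min 1 (e / (4 * (A * B))).
have e10 : 0 < e1 by rewrite divr_gt0// mulr_gt0.
have h0 : 0 < h by rewrite lt_min ltr01 divr_gt0// !mulr_gt0.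
have [d d0 H] := fL _ e10; have [d' d'0 H'] := circle_small h0.
pose dd := Num.min (Num.min 1 (d / (1 + 3 * A))) d'.
have Q0 : 0 < 1 + 3 * A by lra.
exists dd; first by rewrite !lt_min d'0 divr_gt0//= ltr01.
move=> w s; rewrite !lt_min => /andP[/andP[w1 wd] wd'] /andP[s0 /andP[/andP[s1 sd] sd']].
have [c1 c2] := H' s ltac:(by rewrite s0 sd').
have wA : modulus w <= A.
  by rewrite -(subrK z0 w) (le_trans (modulusD _ _))// /A; lra.
have i1 : modulus ('i : C) = 1 by rewrite modulusE/= expr0n expr1n add0r sqrtr1.
have hs : h * s <= s by rewrite -[leRHS]mul1r ler_wpM2r ?(ltW s0)// /h ge_min lexx.
have Ew : modulus (circle_pt 1 s - 1 : C) <= 3 * s.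
  rewrite (le_trans (modulus_le_ReIm _))//= !mul1r subr0.
  have : `|sin s| <= `|sin s - s| + s.
    by rewrite -{1}(subrK s (sin s)) (le_trans (ler_normD _ _))// (gtr0_norm s0).
  by lra.
have Es : modulus (s%:C + 'i * (circle_pt 1 s - 1) : C) <= 2 * (h * s).
  have -> : s%:C + 'i * (circle_pt 1 s - 1) = ((s - sin s) +i* (cos s - 1)) :> C.
    by apply/eqP; rewrite eq_complex/=; apply/andP; split; apply/eqP; ring.
  by rewrite (le_trans (modulus_le_ReIm _))//= distrC; lra.
have x1 : w * (1 + s)%:C - w = w * s%:C by rewrite rmorphD/=; ring.
have x2 : w * circle_pt 1 s - w = w * (circle_pt 1 s - 1) by ring.
have wd2 : modulus (w - z0) < d.
  rewrite (lt_le_trans wd)// ler_pdivrMr//; nra.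
have sdd : s * (3 * A) < d - modulus (w - z0).
  by move: sd wd; rewrite !ltr_pdivlMr//; nra.
have b1 : modulus (w * (1 + s)%:C - z0) < d.
  rewrite (_ : _ - _ = w * s%:C + (w - z0)); last by rewrite -x1; ring.
  rewrite (le_lt_trans (modulusD _ _))// modulusM modulus_real (gtr0_norm s0); nra.
have b2 : modulus (w * circle_pt 1 s - z0) < d.
  rewrite (_ : _ - _ = w * (circle_pt 1 s - 1) + (w - z0)); last by ring.
  have := modulus_ge0 (circle_pt 1 s - 1 : C); have := modulus_ge0 w => m1 m2.
  rewrite (le_lt_trans (modulusD _ _))// modulusM; nra.
have h1 := H _ _ b1 wd2; have h2 := H _ _ b2 wd2.
rewrite x1 in h1; rewrite x2 in h2.
rewrite (_ : _ + _ = (f (w * (1 + s)%:C) - f w - L * (w * s%:C)) +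
  ('i * (f (w * circle_pt 1 s) - f w - L * (w * (circle_pt 1 s - 1))) +
   L * w * (s%:C + 'i * (circle_pt 1 s - 1)))); last by ring.
rewrite (le_trans (modulusD _ _))//.
have T1 : modulus (f (w * (1 + s)%:C) - f w - L * (w * s%:C)) <= e / 8 * s.
  rewrite (le_trans h1)// modulusM modulus_real (gtr0_norm s0) mulrA ler_wpM2r ?(ltW s0)//.
  by rewrite /e1 mulrAC ler_pdivrMr ?mulr_gt0//; nra.
have T2 : modulus ('i * (f (w * circle_pt 1 s) - f w - L * (w * (circle_pt 1 s - 1)))) <= e / 8 * (3 * s).
  rewrite modulusM i1 mul1r (le_trans h2)// modulusM.
  apply: (@le_trans _ _ (e1 * (A * (3 * s)))).
    by rewrite ler_wpM2l ?(ltW e10)// ler_pM.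
  by rewrite mulrA ler_wpM2r ?mulr_ge0 ?(ltW s0)// /e1 mulrAC ler_pdivrMr ?mulr_gt0//; nra.
have T3 : modulus (L * w * (s%:C + 'i * (circle_pt 1 s - 1))) <= e / 2 * s.
  rewrite !modulusM; apply: (@le_trans _ _ (B * A * (2 * (h * s)))).
    apply: ler_pM => //; first by rewrite mulr_ge0.
    by apply: ler_pM => //; rewrite /B; lra.
  have hq : h * (4 * (A * B)) <= e.
    by rewrite -ler_pdivlMr ?mulr_gt0 ?mulr_gt0// /h ge_min lexx orbT.
  nra.
have := modulusD ('i * (f (w * circle_pt 1 s) - f w - L * (w * (circle_pt 1 s - 1)))) (L * w * (s%:C + 'i * (circle_pt 1 s - 1))).
have := mulr_gt0 e0 s0; lra.
Qed.

(** The average over the vertices of a regular polygon with m sides. *)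
Definition cmean (m : nat) r f : C :=
  m%:R^-1 * \sum_(j < m) f (circle_pt r (j%:R * (2 * pi / m%:R))).

(** Summed over the vertices, the increments along the circle telescope to zero, so
only the Cauchy-Riemann defect contributes to the change of the mean. *)
Lemma cmean_step m r f e : (0 < m)%N ->
  (forall t, 0 <= t <= 2 * pi -> modulus (f (circle_pt r t * (1 + 2 * pi / m%:R)%:C) - f (circle_pt r t) +
     'i * (f (circle_pt r t * circle_pt 1 (2 * pi / m%:R)) - f (circle_pt r t))) <= e) ->
  modulus (cmean m (r * (1 + 2 * pi / m%:R)) f - cmean m r f) <= e.
Proof.
move=> m0 H; set s := 2 * pi / m%:R in H *.
have m0R : 0 < m%:R :> R by rewrite ltr0n.
pose z (j : nat) : C := circle_pt r (j%:R * s).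
have tel : \sum_(j < m) (f (z j * circle_pt 1 s) - f (z j)) = 0.
  rewrite (eq_bigr (fun j : 'I_m => f (z j.+1) - f (z j))).
    rewrite -(big_mkord xpredT (fun j => f (z j.+1) - f (z j))) telescope_sumr//.
    rewrite /z mul0r (_ : m%:R * s = 0 + 2 * pi) ?circle_pt_2pi ?subrr//.
    by rewrite /s add0r mulrC divfK ?gt_eqF.
  by move=> j _; rewrite /z circle_ptM mulr1 -natr1 mulrDl mul1r.
rewrite /cmean -mulrBr -sumrB.
rewrite [X in _ * X](_ : _ = \sum_(j < m) (f (z j * (1 + s)%:C) - f (z j) +
     'i * (f (z j * circle_pt 1 s) - f (z j)))); last first.
  rewrite [RHS]big_split/= -mulr_sumr tel mulr0 addr0; apply: eq_bigr => j _.
  by rewrite /z -circle_pt0 circle_ptM addr0.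
rewrite modulusM modulusV modulus_nat mulrC ler_pdivrMr//.
rewrite (le_trans (modulus_sum _ _ _))// mulr_natr -[m in leRHS]card_ord -sumr_const ler_sum// => j _.
apply: H; rewrite mulr_ge0 ?divr_ge0 ?mulr_ge0 ?pi_ge0//= /s mulrA ler_pdivrMr//.
by rewrite mulrC ler_wpM2l ?mulr_ge0 ?pi_ge0// ler_nat ltnW.
Qed.

Definition tendsto (u : nat -> C) l := forall e, 0 < e ->
  exists N, forall n, (N <= n)%N -> modulus (u n - l) <= e.

Lemma nat_large x : exists N, forall n, (N <= n)%N -> x <= n%:R :> R.
Proof.
exists (Num.truncn `|x|).+1 => n Nn; rewrite (le_trans (ler_norm _))//.
by rewrite ltW// (lt_le_trans (truncnS_gt _))// ler_nat.
Qed.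

(** The radius is divided by 1 + s, with s = 2 pi / m, until it is small; about
(r / r1) / s steps are needed and each one changes the mean by o(s).  On the last
circle f is close to f 0 by continuity. *)
Lemma mean_value f r : 0 < r -> (forall z, modulus z <= r -> diffble f z) ->
  tendsto (fun m => cmean m r f) (f 0).
Proof.
move=> r0 fd e e0; have e20 : 0 < e / 2 by lra.
have [L fL] := fd 0 ltac:(by rewrite modulus0 ltW).
have [d1 d10 H1] := strict_diff_cont fL e20.
pose r1 := Num.min r (d1 / 2).
have r10 : 0 < r1 by rewrite lt_min r0 divr_gt0.
(* Q bounds the number of steps times s *)
pose Q := r / r1 + 1.
have Q0 : 0 < Q by rewrite addr_gt0// divr_gt0.
have eQ : 0 < e / (2 * Q) by rewrite divr_gt0// mulr_gt0.
have [||d d0 H] := @annulus_uniform R (r1 / 2) r (fun s w =>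
  modulus (f (w * (1 + s)%:C) - f w + 'i * (f (w * circle_pt 1 s) - f w)) <= e / (2 * Q) * s).
- move=> z /andP[_ zr]; exact: cauchy_riemann_defect (fd z zr) eQ.
- by rewrite divr_ge0// ltW.
have [N HN] := nat_large (2 * pi / Num.min 1 d + 1).
exists N => m /HN Nm.
have md : 0 < Num.min 1 d by rewrite lt_min ltr01.
have p0 := pi_gt0 R.
have mR : 0 < m%:R :> R.
  by rewrite (lt_le_trans _ Nm)// ltr_wpDl// divr_ge0 ?mulr_ge0 ?pi_ge0// ltW.
pose s : R := 2 * pi / m%:R.
have s0 : 0 < s by rewrite divr_gt0// mulr_gt0.
have [s1 sd] : s < 1 /\ s < d.
  have : s < Num.min 1 d; last by rewrite lt_min => /andP[].
  have h : 2 * pi / Num.min 1 d < m%:R by move: Nm; set X := _ / _; lra.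
  by move: h; rewrite /s !ltr_pdivrMr// [X in _ -> _ < X]mulrC.
have m0 : (0 < m)%N by rewrite -(ltr_nat R).
have s1' : 0 < 1 + s by lra.
have step k : r1 / 2 <= r / (1 + s) ^+ k ->
   modulus (cmean m r f - cmean m (r / (1 + s) ^+ k) f) <= k%:R * (e / (2 * Q) * s).
  elim: k => [|k IH] rk; first by rewrite expr0 divr1 subrr modulus0 mul0r.
  have rk' : r1 / 2 <= r / (1 + s) ^+ k.
    rewrite (le_trans rk)// ler_wpM2l ?(ltW r0)// lef_pV2 ?posrE ?exprn_gt0//.
    by rewrite exprS ler_peMl ?exprn_ge0 ?ltW//; lra.
  have rkr : r / (1 + s) ^+ k.+1 <= r.
    by rewrite ler_pdivrMr ?exprn_gt0// ler_peMr ?(ltW r0)// exprn_ege1//; lra.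
  have := @cmean_step m (r / (1 + s) ^+ k.+1) f (e / (2 * Q) * s) m0.
  rewrite -/s => /(_ _); rewrite [X in cmean m X f - _](_ : _ = r / (1 + s) ^+ k); last first.
    by rewrite exprS; field; rewrite ?expf_neq0 ?gt_eqF.
  move=> H2; have {}H2 := H2 _.
  rewrite -(subrK (cmean m (r / (1 + s) ^+ k) f) (cmean m r f)) -addrA.
  rewrite (le_trans (modulusD _ _))// -natr1 mulrDl mul1r lerD ?IH// H2// => t tt.
  by apply: H => //; rewrite ?s0 ?sd// rk rkr.
have [k kP kmin] : exists2 k, r / (1 + s) ^+ k <= r1 & forall j, r / (1 + s) ^+ j <= r1 -> (k <= j)%N.
  have ex : exists k, r / (1 + s) ^+ k <= r1.
    have [K HK] := nat_large (r / r1 / s); exists K.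
    have := HK K (leqnn _); rewrite ler_pdivrMr// => hK.
    rewrite ler_pdivrMr ?exprn_gt0// mulrC -ler_pdivrMr// (le_trans hK)//.
    elim: K {HK hK} => [|K IH]; first by rewrite mul0r exprn_ge0 ?ltW.
    rewrite -natr1 mulrDl mul1r exprS mulrDl mul1r lerD// ler_peMr ?(ltW s0)//.
    by rewrite exprn_ege1//; lra.
  by case: (ex_minnP ex) => k kP kmin; exists k.
have rk : r1 / 2 <= r / (1 + s) ^+ k /\ k%:R * s <= Q.
  case: k kP kmin => [|k] kP kmin.
    rewrite expr0 divr1 mul0r; split; last exact: ltW.
    have : r1 <= r by rewrite /r1 ge_min lexx.
    by lra.
  have rk : r1 < r / (1 + s) ^+ k.
    by rewrite ltNge; apply/negP => /kmin; rewrite ltnn.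
  have pk : 0 < (1 + s) ^+ k by rewrite exprn_gt0.
  split.
    move: rk; rewrite ltr_pdivlMr// exprS ler_pdivlMr ?mulr_gt0//.
    have := mulr_gt0 r10 pk; set p := _ ^+ k; nra.
  move: rk; rewrite ltr_pdivlMr// mulrC -ltr_pdivlMr// => rk.
  (* the first radius below r1 is reached after k steps with k s <= r / r1 *)
  have bern : 1 + k%:R * s <= (1 + s) ^+ k.
    elim: k {kP kmin rk pk} => [|k IH]; first by rewrite mul0r addr0 expr0.
    rewrite exprS -natr1; have := mulr_ge0 (ler0n R k) (ltW s0); nra.
  by rewrite -natr1 /Q; nra.
case: rk => rk kQ.
rewrite -(subrK (cmean m (r / (1 + s) ^+ k) f) (cmean m r f)) -addrA.
rewrite (le_trans (modulusD _ _))// (splitr e) lerD//.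
  rewrite (le_trans (step k rk))// mulrCA mulrA -mulrA [_ * s]mulrC.
  apply: (@le_trans _ _ (e / (2 * Q) * Q)).
    by rewrite ler_wpM2l ?(ltW eQ)// mulrC.
  by rewrite le_eqVlt; apply/orP; left; apply/eqP; field; rewrite gt_eqF.
have mC : (m%:R : C) != 0 by rewrite pnatr_eq0 -lt0n.
rewrite [f 0](_ : _ = m%:R^-1 * \sum_(j < m) f 0); last first.
  by rewrite sumr_const card_ord -[f 0 *+ m]mulr_natl mulrA mulVf// mul1r.
rewrite /cmean -mulrBr -sumrB modulusM modulusV modulus_nat mulrC ler_pdivrMr//.
rewrite (le_trans (modulus_sum _ _ _))// mulr_natr -[m in leRHS]card_ord -sumr_const ler_sum// => j _.
apply: ltW; apply: H1; rewrite subr0 modulus_circle ger0_norm ?divr_ge0 ?(ltW r0) ?exprn_ge0 ?(ltW s1')//.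
have : r1 <= d1 / 2 by rewrite /r1 ge_min lexx orbT.
lra.
Qed.

End discrete_means.

(** * Analytic functions are sums of power series *)

Section taylor_expansion.
Local Open Scope complex_scope.
Context {R : realType}.
Local Notation C := (Cplx R).
Implicit Types (x y r s t e : R) (z w l : C) (a b : nat -> C) (f g : C -> C).

Lemma tendstoD (u v : nat -> C) l l' : tendsto u l -> tendsto v l' ->
  tendsto (fun n => u n + v n) (l + l').
Proof.
move=> ul vl e e0; have e20 : 0 < e / 2 by lra.
have [N HN] := ul _ e20; have [N' HN'] := vl _ e20.
exists (maxn N N') => n; rewrite geq_max => /andP[/HN H1 /HN' H2].
rewrite opprD addrACA (le_trans (modulusD _ _))//; lra.
Qed.

Lemma tendstoZ c (u : nat -> C) l : tendsto u l -> tendsto (fun n => c * u n) (c * l).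
Proof.
move=> ul e e0; have c0 : 0 < modulus c + 1 by have := modulus_ge0 c; lra.
have [N HN] := ul (e / (modulus c + 1)) (divr_gt0 e0 c0).
exists N => n /HN; rewrite -mulrBr modulusM ler_pdivlMr// => H.
by have := modulus_ge0 c; have := modulus_ge0 (u n - l); nra.
Qed.

Lemma tendsto_cst (c : C) : tendsto (fun=> c) c.
Proof. by move=> e e0; exists 0%N => n _; rewrite subrr modulus0 ltW. Qed.

Lemma tendsto_sum n (F : nat -> nat -> C) (L : nat -> C) :
  (forall i, (i < n)%N -> tendsto (F i) (L i)) ->
  tendsto (fun m => \sum_(i < n) F i m) (\sum_(i < n) L i).
Proof.
elim: n => [|n IH] H.
  by rewrite big_ord0; under eq_fun do rewrite big_ord0; exact: tendsto_cst.
rewrite big_ord_recr; under eq_fun do rewrite big_ord_recr.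
by apply: tendstoD; [apply: IH => i ilt; apply: H; rewrite ltnW|exact: H].
Qed.

Lemma tendsto_le (u : nat -> C) l B : tendsto u l ->
  (forall m, (0 < m)%N -> modulus (u m) <= B) -> modulus l <= B.
Proof.
move=> ul uB; apply/ler_addgt0Pl => e e0; have [N HN] := ul e e0.
have := HN N.+1 (leqnSn _); have := uB N.+1 isT.
have := modulusB_ge l (u N.+1); rewrite modulusBC; lra.
Qed.

Lemma eq_tendsto (u v : nat -> C) l : u =1 v -> tendsto u l -> tendsto v l.
Proof. by move=> /funext ->. Qed.

Lemma cmeanD m r f g : cmean m r (fun z => f z + g z) = cmean m r f + cmean m r g.
Proof. by rewrite /cmean big_split mulrDr. Qed.

Lemma cmeanZ m r c f : cmean m r (fun z => c * f z) = c * cmean m r f.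
Proof. by rewrite /cmean -mulr_sumr mulrCA. Qed.

Lemma cmean_sum m r n (F : nat -> C -> C) :
  cmean m r (fun z => \sum_(i < n) F i z) = \sum_(i < n) cmean m r (F i).
Proof. by rewrite /cmean exchange_big/= mulr_sumr. Qed.

Lemma cmean_sumZ m r n a (F : nat -> C -> C) :
  cmean m r (fun z => \sum_(i < n) a i * F i z) = \sum_(i < n) a i * cmean m r (F i).
Proof.
rewrite (cmean_sum m r n (fun i z => a i * F i z)); apply: eq_bigr => i _.
exact: cmeanZ.
Qed.

Lemma eq_cmean m r f g : (forall t, f (circle_pt r t) = g (circle_pt r t)) ->
  cmean m r f = cmean m r g.
Proof. by move=> H; rewrite /cmean; congr (_ * _); apply: eq_bigr => i _. Qed.

Lemma cmean_conj m r f : cmean m r (fun z => cj (f z)) = cj (cmean m r f).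
Proof. by rewrite /cmean cjM cj_sum cjV cj_nat. Qed.

Lemma tendsto_conj (u : nat -> C) l : tendsto u l -> tendsto (fun n => cj (u n)) (cj l).
Proof.
move=> ul e e0; have [N HN] := ul e e0; exists N => n /HN.
by rewrite -cjB modulus_conj.
Qed.

Lemma diffble_pow z n : diffble (fun z => z ^+ n) z.
Proof. by apply: diffbleX; eexists; exact: strict_diff_id. Qed.

(** On a circle centred at the origin, 1 / z^k is a multiple of the conjugate of z^k. *)
Lemma cmean_invX r k : 0 < r -> (0 < k)%N ->
  tendsto (fun m => cmean m r (fun z => (z ^+ k)^-1)) 0.
Proof.
move=> r0 k0; have rC : (r ^+ k ^+ 2)%:C != 0 :> C.
  by rewrite -modulus_eq0 modulus_real normr_eq0 !expf_neq0 ?gt_eqF.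
have := mean_value r0 (fun z _ => diffble_pow z k).
rewrite expr0n (gtn_eqF k0)/= => /tendsto_conj/(tendstoZ (((r ^+ k ^+ 2)%:C)^-1)).
rewrite (cj_nat 0) mulr0; apply: eq_tendsto => m.
rewrite -cmean_conj -cmeanZ; apply: eq_cmean => t.
have zk : circle_pt r t ^+ k != 0 :> C by rewrite expf_neq0// circle_pt_eq0// gt_eqF.
apply: (mulfI zk); rewrite mulfV// mulrCA mulJ modulusX modulus_circle (gtr0_norm r0).
by rewrite mulVf.
Qed.

(** Subtracting the first k terms leaves z^k times a differentiable function, and
the negative powers have mean zero. *)
Lemma coef_mean a r f k : 0 < r -> local_series a 0 f -> (forall z, modulus z <= r -> diffble f z) ->
  tendsto (fun m => cmean m r (fun z => f z / z ^+ k)) (a k).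
Proof.
move=> r0 af fd.
have := mean_value r0 (fun z zr => rquot_diffble k af (fd z zr)).
rewrite /rquot eqxx -/(rquot a 0 k f) => H1.
have H2 : tendsto (fun m => \sum_(i < k) a i * cmean m r (fun z => (z ^+ (k - i))^-1)) 0.
  have := @tendsto_sum k (fun i m => a i * cmean m r (fun z => (z ^+ (k - i))^-1)) (fun i => a i * 0).
  rewrite [\sum_(i < k) a i * 0]big1 => [|i _]; last exact: mulr0.
  by apply => i ik; apply: tendstoZ; apply: cmean_invX => //; rewrite subn_gt0.
have := tendstoD H1 H2; rewrite addr0; apply: eq_tendsto => m.
rewrite -(cmean_sumZ m r k a (fun i z => (z ^+ (k - i))^-1)) -cmeanD; apply: eq_cmean => t.
have z0 : circle_pt r t != 0 :> C by rewrite circle_pt_eq0// gt_eqF.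
rewrite /rquot (negbTE z0) subr0 mulrBl -addrA [X in _ + X](_ : _ = 0) ?addr0//.
rewrite mulr_suml addrC -sumrB big1// => i _.
apply/eqP; rewrite subr_eq0; apply/eqP.
move: (ltnW (ltn_ord i)); move: (nat_of_ord i) => j jk.
rewrite -[in RHS](subnK jk) exprD invfM mulrACA -mulrA.
by rewrite mulfV ?mulr1// expf_neq0.
Qed.

Lemma bounded_on_circle r f : 0 < r -> (forall z, modulus z = r -> diffble f z) ->
  exists2 B, 0 < B & forall t, 0 <= t <= 2 * pi -> modulus (f (circle_pt r t)) <= B.
Proof.
move=> r0 fd.
have [||d d0 H] := @annulus_uniform R r r (fun s w => s * modulus (f w) <= 1).
- move=> z /andP[z1 z2]; have [L fL] := fd z (ltac:(by apply/eqP; rewrite eq_le z1 z2)).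
  have [d d0 H] := strict_diff_cont fL ltr01.
  have M0 : 0 < modulus (f z) + 1 by have := modulus_ge0 (f z); lra.
  exists (Num.min d (modulus (f z) + 1)^-1); first by rewrite lt_min d0 invr_gt0.
  move=> w s; rewrite !lt_min => /andP[wd _] /andP[s0 /andP[_ sM]].
  have fw : modulus (f w) <= modulus (f z) + 1.
    by rewrite -(subrK (f z) (f w)) (le_trans (modulusD _ _))//; have := H _ wd; lra.
  apply: (@le_trans _ _ ((modulus (f z) + 1)^-1 * (modulus (f z) + 1))).
    by apply: ler_pM => //; exact: ltW.
  by rewrite mulVf// gt_eqF.
- exact: ltW.
exists ((d / 2)^-1) => [|t tt]; first by rewrite invr_gt0 divr_gt0.
rewrite -[leRHS]mul1r ler_pdivlMr ?divr_gt0// mulrC; apply: H => //; last by rewrite lexx.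
by apply/andP; split; lra.
Qed.

Lemma cmean_le m r f B : (forall t, 0 <= t <= 2 * pi -> modulus (f (circle_pt r t)) <= B) ->
  (0 < m)%N -> modulus (cmean m r f) <= B.
Proof.
move=> H m0; rewrite modulusM modulusV modulus_nat mulrC ler_pdivrMr ?ltr0n//.
rewrite (le_trans (modulus_sum _ _ _))// mulr_natr -[m in leRHS]card_ord -sumr_const.
rewrite ler_sum// => j _; apply: H.
have p0 := pi_ge0 R; have mR : 0 < m%:R :> R by rewrite ltr0n.
rewrite mulr_ge0 ?divr_ge0 ?mulr_ge0//= mulrA ler_pdivrMr//.
by rewrite mulrC ler_wpM2l ?mulr_ge0// ler_nat ltnW.
Qed.

(** Cauchy's formula in disguise: the mean of z (f z - f w) / (z - w) vanishes since
this function is differentiable and vanishes at 0.  Expanding 1 / (z - w) as a finite geometric sum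
produces the Taylor polynomial, with a remainder carrying the factor (w / z)^(n+1). *)
Lemma taylor_remainder a b r f w n : 0 < r -> modulus w < r ->
  local_series a 0 f -> local_series b w f -> (forall z, modulus z <= r -> diffble f z) ->
  forall B, (forall t, 0 <= t <= 2 * pi -> modulus (f (circle_pt r t)) <= B) ->
  modulus (f w - \sum_(k < n.+1) a k * w ^+ k) <=
    (B + modulus (f w)) * (r / (r - modulus w)) * (modulus w / r) ^+ n.+1.
Proof.
move=> r0 wr af bf fd B fB.
(* h has mean f w minus the Taylor polynomial, and equals
   (f z - f w) (w / z)^(n+1) z / (z - w) on the circle *)
pose h z : C := f w * \sum_(k < n.+1) w ^+ k * (z ^+ k)^-1 -
  \sum_(k < n.+1) w ^+ k * (f z / z ^+ k) + z * rquot b w 1 f z.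
have hlim : tendsto (fun m => cmean m r h) (f w - \sum_(k < n.+1) a k * w ^+ k).
  have H1 : tendsto (fun m => cmean m r (fun z => z * rquot b w 1 f z)) 0.
    have := @mean_value R (fun z => z * rquot b w 1 f z) r r0; rewrite mul0r; apply => z zr.
    apply: diffbleM; first by eexists; exact: strict_diff_id.
    by apply: rquot_diffble => //; exact: fd.
  have H2 : tendsto (fun m => \sum_(k < n.+1) w ^+ k * cmean m r (fun z => (z ^+ k)^-1)) 1.
    rewrite (_ : 1 = \sum_(k < n.+1) (if k == 0 :> nat then 1 else 0)); last first.
      by rewrite big_ord_recl/= big1 ?addr0.
    apply: (@tendsto_sum n.+1 (fun k m => w ^+ k * cmean m r (fun z => (z ^+ k)^-1))
       (fun k => if k == 0%N then 1 else 0)) => -[|k] kn /=.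
      move=> e e0; exists 1%N => m m0; rewrite expr0 mul1r /cmean.
      rewrite (eq_bigr (fun=> 1)) => [|j _]; last by rewrite expr0 invr1.
      rewrite sumr_const card_ord mulVf ?subrr ?modulus0 ?(ltW e0)//.
      by rewrite pnatr_eq0 -lt0n.
    by rewrite -[X in tendsto _ X](mulr0 (w ^+ k.+1)); apply: tendstoZ; exact: cmean_invX.
  have H3 : tendsto (fun m => \sum_(k < n.+1) w ^+ k * cmean m r (fun z => f z / z ^+ k))
     (\sum_(k < n.+1) w ^+ k * a k).
    apply: (@tendsto_sum n.+1 (fun k m => w ^+ k * cmean m r (fun z => f z / z ^+ k))
       (fun k => w ^+ k * a k)) => k _.
    by apply: tendstoZ; exact: coef_mean.
  have := tendstoD (tendstoD (tendstoZ (f w) H2) (tendstoZ (-1) H3)) H1.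
  rewrite mulr1 mulN1r addr0; under [X in f w - X]eq_bigr do rewrite mulrC.
  apply: eq_tendsto => m.
  rewrite -(cmean_sumZ m r n.+1 (fun k => w ^+ k) (fun k z => (z ^+ k)^-1)) -cmeanZ.
  rewrite -(cmean_sumZ m r n.+1 (fun k => w ^+ k) (fun k z => f z / z ^+ k)) -cmeanZ -!cmeanD.
  by apply: eq_cmean => t; rewrite mulN1r.
apply: tendsto_le hlim _ => m m0; apply: cmean_le m0 => t tt.
set z := circle_pt r t.
have z0 : z != 0 by rewrite circle_pt_eq0// gt_eqF.
have mz : modulus z = r by rewrite modulus_circle gtr0_norm.
have zw : z - w != 0 by rewrite subr_eq0; apply: contraTneq wr => <-; rewrite mz ltxx.
have -> : h z = (f z - f w) * ((w / z) ^+ n.+1 * (z / (z - w))).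
  have geo : \sum_(k < n.+1) w ^+ k * (z ^+ k)^-1 = (1 - (w / z) ^+ n.+1) * (z / (z - w)).
    rewrite (eq_bigr (fun k : 'I_n.+1 => (w / z) ^+ k)) => [|k _]; last by rewrite expr_div_n.
    have : (w / z - 1) * \sum_(k < n.+1) (w / z) ^+ k = (w / z) ^+ n.+1 - 1 by rewrite -subrX1.
    set S := \sum_(k < _) _; set q := _ ^+ _ => E.
    have -> : 1 - q = (z - w) / z * S by rewrite -[1 - q]opprB -E; field.
    by field; rewrite zw z0.
  rewrite /h /rquot -subr_eq0 (negbTE zw) big_ord1 expr0 mulr1 expr1 -(local_series_at bf).
  have -> : \sum_(k < n.+1) w ^+ k * (f z / z ^+ k) = f z * \sum_(k < n.+1) w ^+ k * (z ^+ k)^-1.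
    by rewrite mulr_sumr; apply: eq_bigr => k _; rewrite mulrCA.
  by rewrite geo; set q := _ ^+ _; field.
rewrite !modulusM modulusX !modulusM !modulusV mz mulrA mulrAC [leRHS]mulrAC.
rewrite -!mulrA; apply: ler_pM => //.
- by rewrite !mulr_ge0 ?exprn_ge0 ?mulr_ge0 ?invr_ge0// ltW.
- rewrite (le_trans (modulusD _ _))// modulusN lerD//; exact: fB.
rewrite [leLHS]mulrA [leLHS]mulrC; apply: ler_wpM2l; first by rewrite exprn_ge0// divr_ge0// ltW.
rewrite ler_wpM2l ?(ltW r0)// lef_pV2 ?posrE ?modulus_gt0 ?subr_gt0//.
by rewrite -mz modulusB_ge.
Qed.

Theorem analytic_has_series f : analytic_disc f -> exists a, has_series a f.
Proof.
move=> fa.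
have loc z : modulus z < 1 -> exists b, local_series b z f.
  by move=> /unit_discE /fa /analytic_atP.
have fd z : modulus z < 1 -> diffble f z.
  by move=> /loc[b bz]; eexists; exact: local_series_strict_diff bz.
have [a a0] := loc 0 ltac:(by rewrite modulus0).
exists a => w w1; have [b bw] := loc w w1.
pose r := (modulus w + 1) / 2.
have [r0 wr r1] : [/\ 0 < r, modulus w < r & r < 1].
  by have := modulus_ge0 w; rewrite /r; split; lra.
have fdr z : modulus z <= r -> diffble f z by move=> /le_lt_trans/(_ r1); exact: fd.
have [B B0 fB] := bounded_on_circle r0 (fun z zr => fdr z (ltac:(by rewrite zr))).
move=> e e0; set K := (B + modulus (f w)) * (r / (r - modulus w)).
have q1 : 0 <= modulus w / r < 1 by rewrite divr_ge0 ?(ltW r0)//= ltr_pdivrMr// mul1r.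
have [N HN] := geo_small K q1 e0.
exists N.+1 => -[|n]// Nn; rewrite modulusBC.
apply: le_lt_trans (HN n.+1 (ltnW Nn)).
by have := taylor_remainder n r0 wr a0 bw fdr fB.
Qed.

End taylor_expansion.

(** * Taylor shifts, upper density and open sets of functions *)

Section shift_and_density.
Local Open Scope complex_scope.
Context {R : realType}.
Local Notation C := (Cplx R).
Implicit Types (x y r s t e : R) (z w l : C) (a b : nat -> C) (f g : C -> C).

Definition power_sum a z : C := limn (series (fun k => a k * z ^+ k : C)).

Lemma cvgsum_lim a l : cvgsum a l -> limn (series a) = l.
Proof. by move=> /cvgsumP al; apply: cvg_lim. Qed.

Lemma has_series_power_sum a :
  (forall r, 0 < r < 1 -> exists M, forall k, modulus (a k) * r ^+ k <= M) ->
  has_series a (power_sum a).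
Proof.
move=> H z z1; pose r := (modulus z + 1) / 2.
have [r0 zr r1] : [/\ 0 < r, modulus z < r & r < 1].
  by have := modulus_ge0 z; rewrite /r; split; lra.
have [M HM] := H r ltac:(by rewrite r0 r1).
have q1 : 0 <= modulus z / r < 1 by rewrite divr_ge0 ?(ltW r0)//= ltr_pdivrMr// mul1r.
have [|l hl] := @cvgsum_geo R (fun k => a k * z ^+ k) M _ q1.
  by move=> k; rewrite modulusM modulusX; apply: geo_term.
by rewrite /power_sum (cvgsum_lim hl).
Qed.

Lemma shift_weightE alpha n : shift_weight alpha n.+1 = (n.+2%:R / n.+1%:R) `^ alpha :> R.
Proof.
rewrite /shift_weight; congr (_ `^ _).
by rewrite -[n.+2%:R]natr1 mulrDl mulfV ?pnatr_eq0// mul1r.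
Qed.

Lemma powR_absr_le x y alpha : 1 <= x <= y -> x `^ alpha <= y `^ `|alpha|.
Proof.
move=> /andP[x1 xy]; apply: (@le_trans _ _ (x `^ `|alpha|)).
  by apply: ler_powR => //; exact: ler_norm.
by apply: ge0_ler_powR; rewrite ?nnegrE //; lra.
Qed.

Lemma shift_weight_le alpha n : shift_weight alpha n.+1 <= 2 `^ `|alpha| :> R.
Proof.
rewrite /shift_weight powR_absr_le// lerDl invr_ge0 ler0n/=.
by rewrite -[leRHS]/(1 + 1 : R) lerD2l invf_le1 ?ler1n ?ltr0n.
Qed.

Lemma taylor_shift_series alpha a f : has_series a f ->
  has_series (fun k => a k.+1 * (shift_weight alpha k.+1)%:C) (taylor_shift alpha f).
Proof.
move=> af; rewrite (_ : taylor_shift alpha f =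
    power_sum (fun k => a k.+1 * (shift_weight alpha k.+1)%:C)); last first.
  by apply/funext => z; rewrite /taylor_shift (has_series_taylor af).
apply: has_series_power_sum => r r01; have [|M M0 HM] := has_series_bound af (r := r).
  by case/andP: r01 => /ltW -> ->.
case/andP: r01 => r0 r1.
exists (M / r * 2 `^ `|alpha|) => k; rewrite modulusM modulus_real ger0_norm ?powR_ge0//.
rewrite mulrAC; apply: ler_pM; rewrite ?powR_ge0 ?mulr_ge0 ?exprn_ge0 ?(ltW r0)//; last first.
  exact: shift_weight_le.
by rewrite ler_pdivlMr// -mulrA -exprSr.
Qed.

Definition shift_coef alpha n a k : C :=
  a (n + k)%N * ((((n + k).+1%:R / k.+1%:R) `^ alpha)%:C : C).

Lemma iter_shift_series alpha n a f : has_series a f ->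
  has_series (shift_coef alpha n a) (iter n (taylor_shift alpha) f).
Proof.
move=> af; elim: n => [|n IH].
  move=> z /af; apply: eq_cvgsum => k.
  by rewrite /shift_coef add0n mulfV ?pnatr_eq0// powR1 mulr1.
rewrite iterS; have := taylor_shift_series alpha IH.
congr (has_series _ _); apply/funext => k.
rewrite /shift_coef shift_weightE addSnnS -mulrA -rmorphM/=; congr (_ * _%:C).
rewrite -powRM ?divr_ge0//; congr (_ `^ _).
by rewrite mulrA mulfVK// pnatr_eq0.
Qed.

Lemma iter_shift_at0 alpha n a f : has_series a f ->
  iter n (taylor_shift alpha) f 0 = a n * ((n.+1%:R `^ alpha)%:C).
Proof.
move=> af; have := iter_shift_series alpha n af (z := 0).
rewrite modulus0 ltr01 => /(_ isT)/cvgsum_at0 ->.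
by rewrite /shift_coef addn0 divr1.
Qed.

(** Positive upper density in the form in which it is used: a fixed proportion along
arbitrarily large n. *)
Lemma upper_density_gt0 (A : set nat) : (0 < upper_density R A)%E ->
  exists2 d : R, 0 < d & forall N, exists2 n, (N <= n)%N & d * n%:R <= (count (mem A) (iota 1 n))%:R.
Proof.
rewrite /upper_density /limn_esup /limf_esup => H.
have [d d0 dA] : exists2 d : R, 0 < d & (d%:E < ereal_inf [set ereal_sup ((fun n =>
    ((count (mem A) (iota 1 n))%:R / n%:R : R)%:E) @` V) | V in \oo])%E.
  move: H; case: (ereal_inf _) => [x| |]//.
    by rewrite lte_fin => x0; exists (x / 2); rewrite ?divr_gt0// lte_fin; lra.
  by move=> _; exists 1 => //; rewrite ltry.
exists d => // N.
have /(lt_le_trans dA) : (ereal_inf [set ereal_sup ((fun n =>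
    ((count (mem A) (iota 1 n))%:R / n%:R : R)%:E) @` V) | V in \oo] <=
  ereal_sup ((fun n => ((count (mem A) (iota 1 n))%:R / n%:R : R)%:E) @` [set n | (N.+1 <= n)%N]))%E.
  by apply: ereal_inf_lbound; exists [set n | (N.+1 <= n)%N] => //; exists N.+1.
move=> /ereal_sup_gt[_ [n /= Nn <-]]; rewrite lte_fin => dn.
exists n; first exact: ltnW.
by rewrite -ler_pdivlMr ?ltW// ltr0n (leq_trans _ Nn).
Qed.

Lemma gt0_upper_density (A : set nat) (d : R) : 0 < d ->
  (forall N, exists2 n, (N <= n)%N & d * n%:R <= (count (mem A) (iota 1 n))%:R) ->
  (0 < upper_density R A)%E.
Proof.
move=> d0 H; apply: (@lt_le_trans _ _ d%:E); first by rewrite lte_fin.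
rewrite /upper_density /limn_esup /limf_esup; apply: le_ereal_inf_tmp => _ [V [N _ NV] <-].
have [n Nn Hn] := H N.+1.
apply: (@le_trans _ _ ((count (mem A) (iota 1 n))%:R / n%:R : R)%:E).
  by rewrite lee_fin ler_pdivlMr// ltr0n (leq_trans _ Nn).
by apply: ereal_sup_ubound; exists n => //; apply: NV => /=; exact: ltnW.
Qed.

Lemma open_eval0 : open ([set g | 1 < modulus (g 0)] : set (disc_fun R)).
Proof.
rewrite openE => g /= g1.
have K0 : @compact_in_disc R [set 0].
  split; first exact: compact_set1.
  by move=> z /= ->; apply/unit_discE; rewrite modulus0.
have /fam_cvgP /(_ _ K0) : {family @compact_in_disc R, nbhs (g : disc_fun R) --> (g : C -> C)}.
  by move=> A.
pose e := modulus (g 0) - 1; have e0 : 0 < e by rewrite subr_gt0.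
move=> /(_ [set h | 1 < modulus (h 0)]); apply.
apply/uniform_nbhs; exists [set xy | ball xy.1 (e%:C) xy.2]; split.
  by rewrite -entourage_ballE; exists (e%:C) => //=; rewrite ltcR.
move=> h /= /(_ 0 erefl); rewrite -ball_normE/= normE ltcR => gh.
by have := modulusB_ge (g 0) (h 0); rewrite /e in gh; lra.
Qed.

Lemma compact_in_disc_radius (K : set C) : compact_in_disc K ->
  exists2 r, 0 < r < 1 & forall z, K z -> modulus z <= r.
Proof.
move=> [cK Kd].
have nc := (compact_near_coveringP _).1 cK.
have FF : Filter (at_left (1:R)) by exact: _.
have cov z : K z -> \forall z' \near z & r \near at_left (1:R), (modulus z' < r).
  move=> /Kd /unit_discE z1.
  pose d := (1 - modulus z) / 2; have d0 : 0 < d by rewrite /d; lra.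
  exists ([set w | modulus (w - z) < d], [set r | modulus z + d < r]).
    split=> /=; first by apply/nbhsCP; exists d.
    by apply: nbhs_left_gt; rewrite /d; lra.
  move=> [w r] /= [wd rd]; apply: le_lt_trans rd.
  by rewrite -{1}(subrK z w) (le_trans (modulusD _ _))// addrC lerD2l ltW.
have := nc R (at_left (1:R)) (fun r z => modulus z < r) FF cov.
move=> H.
have /filter_ex [r [[r0 r1] rK]] : \forall r \near at_left (1:R), (0 < r /\ r < 1) /\ K `<=` (fun z => modulus z < r).
  near=> r; split; last by near: r.
  by split; near: r; [apply: nbhs_left_gt|exact: nbhs_left_lt].
exists r; first by rewrite r0.
by move=> z /rK /ltW.
Unshelve. all: by end_near. Qed.

(** A basis of neighbourhoods: uniform closeness on one closed disc of radius r < 1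
is enough, since every compact subset of the disc lies in such a disc. *)
Lemma disc_fun_open (U : set (disc_fun R)) (g : C -> C) : open U -> U g ->
  exists r e, [/\ 0 < r < 1, 0 < e & forall h : C -> C,
    (forall z, modulus z <= r -> modulus (h z - g z) < e) -> U h].
Proof.
move=> oU Ug.
pose W (re : R * R) : set (C -> C) := [set h | forall z, modulus z <= re.1 -> modulus (h z - g z) < re.2].
pose D : set (R * R) := [set re | 0 < re.1 < 1 /\ 0 < re.2].
have FF : Filter (filter_from D W).
  apply: filter_from_filter; first by exists (2^-1, 1); split=> //=; lra.
  move=> [r e] [r' e'] [/= /andP[r0 r1] e0] [/= /andP[r'0 r'1] e'0].
  exists (Num.max r r', Num.min e e').
    by split=> /=; rewrite ?lt_min ?e0 ?e'0// lt_max r0/= gt_max r1 r'1.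
  move=> h /= Hh; split=> z /= zr; have := Hh z; rewrite le_max zr ?orbT => /(_ isT);
    by rewrite lt_min => /andP[].
have : {family @compact_in_disc R, filter_from D W --> g}.
  apply/fam_cvgP => K cK; move=> V /uniform_nbhs[E [entE EV]].
  have [r r01 rK] := compact_in_disc_radius cK.
  have : exists2 e : R, 0 < e & forall x y : C, modulus (y - x) < e -> E (x, y).
    move: entE; rewrite -entourage_ballE => -[e /= e0 eE].
    exists (complex.Re e).
      by move: e0; rewrite ltcE/= => /andP[].
    move=> x y xy; apply: eE; rewrite /= -ball_normE/= distrC normE.
    move: e0; rewrite [e]complexE ltcE/= => /andP[/eqP + e0].
    by rewrite !(mul0r,mulr0,addr0,subr0,add0r,mul1r) => ->; rewrite mulr0 addr0 ltcR.
  move=> [e e0 eE]; exists (r, e) => // h hW; apply: EV => z Kz; apply: eE.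
  by apply: hW; exact: rK.
move=> /(_ U) []; first by apply: open_nbhs_nbhs.
by move=> [r e] [/= r01 e0] HW; exists r, e; split.
Qed.

End shift_and_density.

(** * Averages over the circle and orthogonality *)

Section averages.
Local Open Scope complex_scope.
Context {R : realType}.
Local Notation C := (Cplx R).
Implicit Types (x y r s t : R) (z w l : C) (a b : nat -> C) (f g : C -> C) (u v : R -> R).

Local Notation mu := (@lebesgue_measure R).
Local Notation T2 := (`[0, (2 * pi : R)]%classic : set R).

(** Measurable and bounded on a period: enough for all integrals below to exist and to
be stable under sums, products and powers. *)
Definition tame u := measurable_fun setT u /\
  exists M, forall t, 0 <= t <= 2 * pi -> `|u t| <= M.

Definition avg u : R := (2 * pi)^-1 * \int[mu]_(t in T2) u t.

Lemma pi2_gt0 : 0 < 2 * pi :> R.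
Proof. by rewrite mulr_gt0// pi_gt0. Qed.

Lemma mu_T2 : mu T2 = (2 * pi)%:E.
Proof. by rewrite lebesgue_measure_itv/= lte_fin pi2_gt0 sube0. Qed.

Lemma tame_integrable u : tame u -> mu.-integrable T2 (EFin \o u).
Proof.
move=> [mu_ [M uM]]; apply: measurable_bounded_integrable => //.
- by have := mu_T2; rewrite /= => ->; rewrite ltry.
- exact: measurable_funS mu_.
- exists M; split; rewrite ?num_real// => M' MM' t /=; rewrite in_itv/= => tt.
  by rewrite (le_trans (uM t tt))// ltW.
Qed.

Lemma tame_cont u : continuous u -> (exists M, forall t, 0 <= t <= 2 * pi -> `|u t| <= M) -> tame u.
Proof. by move=> cu ?; split => //; exact: continuous_measurable_fun. Qed.

Lemma tame_cst x : tame (fun=> x).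
Proof. by split; [exact: measurable_cst|exists `|x|]. Qed.

Lemma tameD u v : tame u -> tame v -> tame (fun t => u t + v t).
Proof.
move=> [mu_ [M uM]] [mv [M' vM]]; split; first exact: measurable_funD.
exists (M + M') => t tt; rewrite (le_trans (ler_normD _ _))// lerD//; [exact: uM|exact: vM].
Qed.

Lemma tameM u v : tame u -> tame v -> tame (fun t => u t * v t).
Proof.
move=> [mu_ [M uM]] [mv [M' vM]]; split; first exact: measurable_funM.
exists (M * M') => t tt; rewrite normrM ler_pM//; [exact: uM|exact: vM].
Qed.

Lemma tameZ x u : tame u -> tame (fun t => x * u t).
Proof. by move=> tu; apply: tameM tu; exact: tame_cst. Qed.

Lemma tameX u n : tame u -> tame (fun t => u t ^+ n).
Proof.
move=> tu; elim: n => [|n IH].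
  by rewrite (_ : (fun _ => _) = fun=> 1) //; exact: tame_cst.
rewrite (_ : (fun _ => _) = fun t => u t * u t ^+ n); last first.
  by apply/funext => t; rewrite exprS.
exact: tameM.
Qed.

Lemma tame_powR u p : 0 <= p -> (forall t, 0 <= u t) -> tame u -> tame (fun t => u t `^ p).
Proof.
move=> p0 u0 [mu_ [M uM]]; split.
  exact: (measurableT_comp (measurable_powR p) mu_).
exists (M `^ p) => t tt; rewrite ger0_norm ?powR_ge0// ge0_ler_powR ?nnegrE//.
  by rewrite (le_trans _ (uM t tt)).
by have := uM t tt; rewrite ger0_norm.
Qed.

Lemma tame_sum n (F : nat -> R -> R) : (forall i, (i < n)%N -> tame (F i)) ->
  tame (fun t => \sum_(i < n) F i t).
Proof.
elim: n => [|n IH] H.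
  by under eq_fun do rewrite big_ord0; exact: tame_cst.
under eq_fun do rewrite big_ord_recr.
by apply: tameD; [apply: IH => i ilt; apply: H; rewrite ltnW|exact: H].
Qed.

Lemma avgD u v : tame u -> tame v -> avg (fun t => u t + v t) = avg u + avg v.
Proof.
move=> tu tv; rewrite /avg -mulrDr; congr (_ * _).
apply: RintegralD; [exact: measurable_itv|exact: tame_integrable|exact: tame_integrable].
Qed.

Lemma avgZ x u : tame u -> avg (fun t => x * u t) = x * avg u.
Proof.
move=> tu; rewrite /avg [in RHS]mulrCA; congr (_ * _).
apply: RintegralZl; [exact: measurable_itv|exact: tame_integrable].
Qed.

Lemma avg_cst x : avg (fun=> x) = x.
Proof.
rewrite /avg Rintegral_cst; last exact: measurable_itv.
by have := mu_T2; rewrite /= => ->; rewrite /= mulrC mulfK// gt_eqF// pi2_gt0.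
Qed.

Lemma avg_le u v : tame u -> tame v -> (forall t, 0 <= t <= 2 * pi -> u t <= v t) ->
  avg u <= avg v.
Proof.
move=> tu tv uv; rewrite /avg ler_wpM2l ?invr_ge0 ?(ltW pi2_gt0)//.
apply: le_Rintegral; [exact: measurable_itv|exact: tame_integrable|exact: tame_integrable|].
by move=> t /=; rewrite in_itv/=; exact: uv.
Qed.

Lemma avg_ge0 u : (forall t, 0 <= u t) -> 0 <= avg u.
Proof.
by move=> u0; rewrite mulr_ge0 ?invr_ge0 ?(ltW pi2_gt0)// Rintegral_ge0.
Qed.

Lemma avg_sum n (F : nat -> R -> R) : (forall i, (i < n)%N -> tame (F i)) ->
  avg (fun t => \sum_(i < n) F i t) = \sum_(i < n) avg (F i).
Proof.
elim: n => [|n IH] H.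
  by rewrite big_ord0; under eq_fun do rewrite big_ord0; exact: avg_cst.
rewrite big_ord_recr/= -IH; last by move=> i ilt; apply: H; rewrite ltnW.
under [in LHS]eq_fun do rewrite big_ord_recr.
by rewrite avgD//; [apply: tame_sum => i ilt; apply: H; rewrite ltnW|exact: H].
Qed.

Lemma cvg_real_eps u t0 : (forall e, 0 < e -> exists2 d, 0 < d &
    forall t, `|t - t0| < d -> `|u t - u t0| < e) -> {for t0, continuous u}.
Proof.
move=> H; apply/cvgrPdist_lt => e /H[d d0 dP]; apply/nbhs_ballP; exists d => // t.
by rewrite /ball/= distrC => /dP; rewrite distrC.
Qed.

(** The real part of c e^(i k t), as a real function with an explicit primitive. *)
Definition wave (c : C) (k : R) t : R :=
  complex.Re c * cos (k * t) - complex.Im c * sin (k * t).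

Lemma waveE c k t : wave c k t = complex.Re (c * circle_pt 1 (k * t)).
Proof. by case: c => a b; rewrite /wave/= !mul1r. Qed.

Lemma is_derive_scale k t : is_derive t 1 (fun s : R => k * s) k.
Proof.
by have := @is_deriveZ R R^o R^o id k t 1 1 (is_derive_id _ _); rewrite /GRing.scale/= mulr1.
Qed.

Lemma is_derive_cosk k t : is_derive t 1 (fun s : R => cos (k * s)) (- (k * sin (k * t))).
Proof.
have := @is_derive1_comp R (@cos R) (fun s => k * s) t _ _ (is_derive_cos (k * t)) (is_derive_scale k t).
by rewrite mulNr mulrC.
Qed.

Lemma is_derive_sink k t : is_derive t 1 (fun s : R => sin (k * s)) (k * cos (k * t)).
Proof.
have := @is_derive1_comp R (@sin R) (fun s => k * s) t _ _ (is_derive_sin (k * t)) (is_derive_scale k t).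
by rewrite mulrC.
Qed.

Lemma is_derive_wave c k t : is_derive t 1 (wave c k) (k * wave (c * 'i) k t).
Proof.
have h1 := @is_deriveZ R R^o R^o _ (complex.Re c) t 1 _ (is_derive_cosk k t).
have h2 := @is_deriveZ R R^o R^o _ (complex.Im c) t 1 _ (is_derive_sink k t).
have := is_deriveB h1 h2; rewrite /GRing.scale/=.
rewrite (_ : _ - _ = k * wave (c * 'i) k t)//.
by rewrite /wave; case: c {h1 h2} => a b /=; ring.
Qed.

Lemma continuous_wave c k : continuous (wave c k).
Proof.
move=> t; apply: differentiable_continuous; apply/derivable1_diffP.
by have [] := is_derive_wave c k t.
Qed.

Lemma tame_wave c k : tame (wave c k).
Proof.
apply: tame_cont; first exact: continuous_wave.
exists (modulus c) => t _; rewrite waveE (le_trans (Re_le_modulus _))//.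
by rewrite modulusM modulus_circle normr1 mulr1.
Qed.

Lemma avg_wave c k : circle_pt 1 (k * (2 * pi)) = 1 :> C ->
  avg (wave c k) = if k == 0 then complex.Re c else 0.
Proof.
move=> k1; case: eqVneq => [->|k0].
  rewrite (_ : wave c 0 = fun=> complex.Re c) ?avg_cst//.
  by apply/funext => t; rewrite /wave mul0r cos0 sin0 mulr1 mulr0 subr0.
pose F := fun t => k^-1 * wave (- (c * 'i)) k t.
have Fd t : is_derive t 1 F (wave c k t).
  have := @is_deriveZ R R^o R^o _ k^-1 t 1 _ (is_derive_wave (- (c * 'i)) k t).
  rewrite /GRing.scale/= mulrA mulVf// mul1r.
  by rewrite (_ : - (c * 'i) * 'i = c)//; case: c {F} => a b; apply/eqP; rewrite eq_complex/=;
    apply/andP; split; apply/eqP; ring.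
rewrite /avg /Rintegral (@continuous_FTC2 R _ F); last first.
- move=> t _; rewrite derive1E; exact: derive_val.
- have Fc : continuous F.
    move=> t; apply: differentiable_continuous; apply/derivable1_diffP.
    by have [] := Fd t.
  split; first by move=> t _; have [] := Fd t.
  + exact: cvg_at_right_filter (Fc _).
  + exact: cvg_at_left_filter (Fc _).
- by apply: continuous_subspaceT; exact: continuous_wave.
- exact: pi2_gt0.
rewrite /= (_ : F (2 * pi) = F 0) ?subrr ?mulr0//.
by rewrite /F !waveE mulr0 k1 circle_pt0.
Qed.

Definition trig n (e : nat -> nat) (c : nat -> C) t : C :=
  \sum_(i < n) c i * circle_pt 1 ((e i)%:R * t).

Lemma circle_nat_2pi n : circle_pt 1 (n%:R * (2 * pi)) = 1 :> C.
Proof.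
have := circle_ptX 1 (2 * pi : R) n; rewrite expr1n => <-.
by rewrite -[2 * pi]add0r circle_pt_2pi circle_pt0 expr1n.
Qed.

(** The real part of a product of two trigonometric sums is a sum of waves, whose
frequencies vanish only on the diagonal when the exponents are distinct. *)
Lemma trig_mulE n e c d t :
  complex.Re (trig n e c t * cj (trig n e d t)) =
  \sum_(i < n) \sum_(j < n) wave (c i * cj (d j)) ((e i)%:R - (e j)%:R) t.
Proof.
rewrite /trig mulr_suml (raddf_sum (@complex.Re R)); apply: eq_bigr => i _.
rewrite cj_sum mulr_sumr (raddf_sum (@complex.Re R)).
apply: eq_bigr => j _; rewrite waveE.
by rewrite cjM conj_circle mulrACA circle_ptM mulr1 mulrBl.
Qed.

Lemma tame_trig_mul n e c d : tame (fun t => complex.Re (trig n e c t * cj (trig n e d t))).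
Proof.
under eq_fun do rewrite trig_mulE.
apply: (@tame_sum n (fun i t => \sum_(j < n) wave (c i * cj (d j)) ((e i)%:R - (e j)%:R) t)).
move=> i _; apply: (@tame_sum n (fun j t => wave (c i * cj (d j)) ((e i)%:R - (e j)%:R) t)).
by move=> j _; exact: tame_wave.
Qed.

Lemma avg_trig_mul n e c d : {in gtn n &, injective e} ->
  avg (fun t => complex.Re (trig n e c t * cj (trig n e d t))) =
  \sum_(i < n) complex.Re (c i * cj (d i)).
Proof.
move=> inj; under [in LHS]eq_fun do rewrite trig_mulE.
rewrite (@avg_sum n (fun i t => \sum_(j < n) wave (c i * cj (d j)) ((e i)%:R - (e j)%:R) t)); last first.
  move=> i _; apply: (@tame_sum n (fun j t => wave (c i * cj (d j)) ((e i)%:R - (e j)%:R) t)).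
  by move=> j _; exact: tame_wave.
apply: eq_bigr => i _.
rewrite (@avg_sum n (fun j t => wave (c i * cj (d j)) ((e i)%:R - (e j)%:R) t)); last first.
  by move=> j _; exact: tame_wave.
rewrite (bigD1 i)//= avg_wave; last by rewrite subrr mul0r circle_pt0.
rewrite subrr eqxx big1 ?addr0// => j ji; rewrite avg_wave.
  rewrite subr_eq0 eqr_nat; case: eqP => // /inj eij.
  by move: ji; rewrite -(inj_eq val_inj)/= eij ?eqxx// unfold_in/=.
have := @circle_ptM R 1 1 ((e i)%:R * (2 * pi)) (- ((e j)%:R * (2 * pi))).
by rewrite mulr1 mulrBl => <-; rewrite -conj_circle !circle_nat_2pi (cj_nat 1) mulr1.
Qed.

Lemma modulus_sqr_Re z : modulus z ^+ 2 = complex.Re (z * cj z).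
Proof. by rewrite mulJ. Qed.

Lemma tame_trig n e c : tame (fun t => modulus (trig n e c t)).
Proof.
have [m2 _] := tame_trig_mul n e c c; split.
  rewrite (_ : (fun _ => _) = fun t => (complex.Re (trig n e c t * cj (trig n e c t))) `^ (2^-1)).
    exact: (measurableT_comp (measurable_powR (2^-1)) m2).
  apply/funext => t; rewrite -modulus_sqr_Re powR12_sqrt ?sqr_ge0//.
  by rewrite sqrtr_sqr ger0_norm.
exists (\sum_(i < n) modulus (c i)) => t _; rewrite ger0_norm// (le_trans (modulus_sum _ _ _))//.
by apply: ler_sum => i _; rewrite modulusM modulus_circle normr1 mulr1.
Qed.

Lemma parseval n e c : {in gtn n &, injective e} ->
  avg (fun t => modulus (trig n e c t) ^+ 2) = \sum_(i < n) modulus (c i) ^+ 2.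
Proof.
move=> inj; under [in LHS]eq_fun do rewrite modulus_sqr_Re.
by rewrite avg_trig_mul//; apply: eq_bigr => i _; rewrite modulus_sqr_Re.
Qed.

Lemma cont_circle_modulus f r : (forall z, modulus z = `|r| -> diffble f z) ->
  continuous (fun t => modulus (f (circle_pt r t))).
Proof.
move=> fd t0; apply: cvg_real_eps => e e0.
have [L fL] := fd (circle_pt r t0) (modulus_circle _ _).
have [d d0 H] := strict_diff_cont fL e0.
have := continuous_circle r t0 d0 => -[[A B] /= [rA tB] AB].
have [d' d'0 Hd'] : exists2 d', 0 < d' & forall t, `|t - t0| < d' -> B t.
  move/nbhs_ballP: tB => [d' /= d'0 dB]; exists d' => // t td; apply: dB.
  by rewrite /ball/= distrC.
exists d' => // t /Hd' Bt.
have := H _ (AB (r, t) (conj (nbhs_singleton rA) Bt)) => /= h.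
rewrite (le_lt_trans _ h)// ler_norml.
have := modulusB_ge (f (circle_pt r t)) (f (circle_pt r t0)).
have := modulusB_ge (f (circle_pt r t0)) (f (circle_pt r t)).
by rewrite modulusBC => h1 h2; apply/andP; split; lra.
Qed.

Lemma tame_circle f r : 0 < r -> (forall z, modulus z = r -> diffble f z) ->
  tame (fun t => modulus (f (circle_pt r t))).
Proof.
move=> r0 fd; apply: tame_cont.
  by apply: cont_circle_modulus => z; rewrite gtr0_norm//; exact: fd.
have [B B0 HB] := bounded_on_circle r0 fd; exists B => t tt.
by rewrite ger0_norm//; exact: HB.
Qed.

Lemma integral_mean_fin f r p : 0 < p -> tame (fun t => modulus (f (circle_pt r t))) ->
  integral_mean p%:E f r = ((avg (fun t => modulus (f (circle_pt r t)) `^ p)) `^ p^-1)%:E.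
Proof.
move=> p0 tf; rewrite /integral_mean -poweR_EFin /avg EFinM; congr (_ `^ _)%E; congr (_ * _)%E.
rewrite /Rintegral fineK//; apply: integrable_fin_num; first exact: measurable_itv.
apply: (@tame_integrable (fun t => modulus (f (circle_pt r t)) `^ p)).
by apply: tame_powR => //; exact: ltW.
Qed.

End averages.

(** * Pairing with trigonometric polynomials *)

Section pairing.
Local Open Scope complex_scope.
Context {R : realType}.
Local Notation C := (Cplx R).
Implicit Types (x y r s t M B : R) (z w l : C) (a d : nat -> C) (f g : C -> C) (u v : R -> R).

Lemma powRDp x y (y' : R) : 0 < x -> x `^ (y + y') = x `^ y * x `^ y' :> R.
Proof. by move=> x0; rewrite powRD// (gt_eqF x0) implybT. Qed.

Lemma powR_div x y (p : R) : 0 <= x -> 0 < y -> (x / y) `^ p = x `^ p / y `^ p.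
Proof.
move=> x0 y0; rewrite powRM ?invr_ge0 ?(ltW y0)//.
by rewrite -[y^-1]powR_inv1 ?(ltW y0)// -powRrM mulN1r powRN.
Qed.

Lemma has_series_diffble a f z : has_series a f -> modulus z < 1 -> diffble f z.
Proof.
move=> af z1; have [b [_ bf]] := has_series_local_series af z1.
by eexists; exact: local_series_strict_diff bf.
Qed.

Lemma has_series_tame a f r : has_series a f -> 0 < r < 1 ->
  tame (fun t => modulus (f (circle_pt r t))).
Proof.
move=> af /andP[r0 r1]; apply: tame_circle => // z zr.
by apply: has_series_diffble af _; rewrite zr.
Qed.

Lemma trig_le n h d t : modulus (trig n h d t) <= \sum_(i < n) modulus (d i).
Proof.
rewrite (le_trans (modulus_sum _ _ _))// ler_sum// => i _.
by rewrite modulusM modulus_circle normr1 mulr1.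
Qed.

Lemma trig_pad n m d t :
  trig (n + m) id (fun i => if (i < n)%N then d i else 0) t = trig n id d t.
Proof.
rewrite /trig big_split_ord/= [X in _ + X]big1 ?addr0; last first.
  by move=> i _; rewrite ltnNge leq_addr mul0r.
by apply: eq_bigr => i _; rewrite ltn_ord.
Qed.

(** Replacing f by a partial sum on the circle costs a uniformly small error, and for
trigonometric polynomials the identity is orthogonality. *)
Lemma pairing a f r n d : has_series a f -> 0 < r < 1 ->
  \sum_(i < n) complex.Re (a i * cj (d i)) * r ^+ i <=
  avg (fun t => modulus (f (circle_pt r t)) * modulus (trig n id d t)).
Proof.
move=> af r01; case/andP: (r01) => r0 r1.
have tf := has_series_tame af r01; have tg := tame_trig n id d.
pose G t := modulus (trig n id d t).
pose A := avg G; have A0 : 0 <= A by apply: avg_ge0 => t; rewrite /G.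
apply/ler_addgt0Pl => e e0.
have e1 : 0 < e / (A + 1) by rewrite divr_gt0//; lra.
have [N HN] := has_series_tail af r01 e1.
pose m := (n + N)%N; pose d' i := if (i < n)%N then d i else 0.
pose c i := a i * (r ^+ i)%:C.
have cE i t : c i * circle_pt 1 (i%:R * t) = a i * circle_pt r t ^+ i.
  by rewrite /c circle_ptX (circle_pt_real (r ^+ i)) mulrA.
have tail t : modulus (trig m id c t) <= modulus (f (circle_pt r t)) + e / (A + 1).
  have := HN m (circle_pt r t) (leq_addl _ _); rewrite modulus_circle gtr0_norm// lexx.
  rewrite (_ : \sum_(k < m) _ = trig m id c t) => [/(_ isT) h|]; last first.
    by apply: eq_bigr => i _; rewrite cE.
  have := modulusB_ge (trig m id c t) (f (circle_pt r t)); rewrite modulusBC; lra.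
have -> : \sum_(i < n) complex.Re (a i * cj (d i)) * r ^+ i =
          \sum_(i < m) complex.Re (c i * cj (d' i)).
  rewrite big_split_ord/= [X in _ = _ + X]big1 ?addr0; last first.
    by move=> i _; rewrite /d' ltnNge leq_addr (cj_nat 0) mulr0.
  apply: eq_bigr => i _; rewrite /d' ltn_ord /c.
  by case: (a i) (cj (d i)) => x y [x' y'] /=; ring.
rewrite -(@avg_trig_mul R m id c d'); last by move=> ? ? _ _.
have -> : e + avg (fun t => modulus (f (circle_pt r t)) * modulus (trig n id d t)) =
   avg (fun t => e + modulus (f (circle_pt r t)) * modulus (trig n id d t)).
  by rewrite avgD ?avg_cst//; [exact: tame_cst|exact: tameM].
apply: (@le_trans _ _ (avg (fun t => (e / (A + 1)) * G t +
     modulus (f (circle_pt r t)) * G t))).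
  apply: avg_le.
  - exact: tame_trig_mul.
  - by apply: tameD; [exact: tameZ|exact: tameM].
  move=> t _; rewrite (le_trans (ler_norm _))// (le_trans (Re_le_modulus _))//.
  rewrite modulusM modulus_conj /d' trig_pad -/(G t) addrC -mulrDl.
  by rewrite addrC; apply: ler_wpM2r; [rewrite /G|rewrite addrC; exact: tail].
rewrite avgD; [|exact: tameZ|exact: tameM].
rewrite avgD; [|exact: tame_cst|exact: tameM].
rewrite lerD2r avgZ// avg_cst -/A mulrAC ler_pdivrMr ?mulrDr; nra.
Qed.

(** Monotonicity of means in the exponent, by Young's inequality
X^P <= X^p (P/p) + 1 - P/p applied to the normalized values X = x / M. *)
Lemma avg_powR_le p (P : R) f r M : 1 < P -> (P%:E <= p)%E -> 0 < M ->
  tame (fun t => modulus (f (circle_pt r t))) ->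
  (integral_mean p f r <= M%:E)%E ->
  avg (fun t => modulus (f (circle_pt r t)) `^ P) <= M `^ P.
Proof.
move=> P1 Pp M0 tf; have P0 : 0 < P by lra.
have tP : tame (fun t => modulus (f (circle_pt r t)) `^ P).
  by apply: tame_powR => //; exact: ltW.
case: p Pp => [p| |//] Pp.
  rewrite lee_fin in Pp; have p0 : 0 < p by lra.
  rewrite integral_mean_fin// lee_fin => H.
  have tp : tame (fun t => modulus (f (circle_pt r t)) `^ p).
    by apply: tame_powR => //; exact: ltW.
  have Hp : avg (fun t => modulus (f (circle_pt r t)) `^ p) <= M `^ p.
    have a0 : 0 <= avg (fun t => modulus (f (circle_pt r t)) `^ p).
      by apply: avg_ge0 => t; exact: powR_ge0.
    rewrite -[leLHS]powRr1// -(mulVf (lt0r_neq0 p0)) powRrM ge0_ler_powR ?nnegrE ?powR_ge0//; exact: ltW.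
  have [pP|pP] := eqVneq p P; first by rewrite -pP.
  have Plt : P < p by rewrite lt_neqAle Pp eq_sym pP.
  have [k k1 Pk] : exists2 k, 1 < k & P * k = p.
    exists (p / P); first by rewrite ltr_pdivlMr// mul1r.
    by rewrite mulrCA mulfV ?mulr1// gt_eqF.
  pose k' := k / (k - 1).
  have k'0 : 0 < k' by rewrite divr_gt0//; lra.
  have kk : k^-1 + k'^-1 = 1.
    by rewrite /k' invf_div mulrBl mul1r mulfV ?(gt_eqF (lt_trans ltr01 k1))// addrC subrK.
  have yng x : 0 <= x -> x `^ P <= M `^ P * (k^-1 * (M `^ p)^-1 * x `^ p + k'^-1).
    move=> x0; pose X := x / M; have X0 : 0 <= X by rewrite divr_ge0// ltW.
    have -> : x `^ P = M `^ P * X `^ P.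
      by rewrite -powRM ?(ltW M0)// /X mulrCA mulfV ?mulr1// gt_eqF.
    rewrite ler_wpM2l ?powR_ge0//.
    have := @conjugate_powR R (X `^ P) 1 k k' (powR_ge0 _ _) ler01 ltac:(lra) k'0 kk.
    rewrite mulr1 powR1 -powRrM Pk mul1r => /le_trans; apply; rewrite lerD2r /X.
    by rewrite powR_div// le_eqVlt; apply/orP; left; apply/eqP; ring.
  apply: (@le_trans _ _ (avg (fun t => M `^ P * (k^-1 * (M `^ p)^-1 *
       modulus (f (circle_pt r t)) `^ p + k'^-1)))).
    apply: avg_le => //; last by move=> t _; exact: yng.
    by apply: tameZ; apply: tameD; [exact: tameZ|exact: tame_cst].
  rewrite avgZ; last by apply: tameD; [exact: tameZ|exact: tame_cst].
  rewrite -[leRHS]mulr1 ler_wpM2l ?powR_ge0//.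
  rewrite avgD; [|exact: tameZ|exact: tame_cst]; rewrite avgZ// avg_cst -kk lerD2r.
  have k0 : 0 <= k by apply: ltW; exact: lt_trans k1.
  rewrite -mulrA ler_piMr ?invr_ge0//.
  by rewrite mulrC ler_pdivrMr ?mul1r// powR_gt0.
move=> H; have uM t : 0 <= t <= 2 * pi -> modulus (f (circle_pt r t)) <= M.
  move=> tt; rewrite -lee_fin (le_trans _ H)//; apply: ereal_sup_ubound.
  by exists t => //=; rewrite in_itv.
rewrite -[leRHS]avg_cst; apply: avg_le => //; first exact: tame_cst.
by move=> t /uM h; rewrite ge0_ler_powR ?nnegrE ?(ltW M0)// ltW.
Qed.

(** Hoelder's inequality by integrating Young's pointwise inequality for the
normalized factors. *)
Lemma holder_mean (P Q : R) p f r M v B : 1 < P -> 2 <= Q -> P^-1 + Q^-1 = 1 ->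
  (P%:E <= p)%E -> 0 < M -> 0 < B ->
  tame (fun t => modulus (f (circle_pt r t))) -> tame v -> (forall t, 0 <= v t) ->
  (integral_mean p f r <= M%:E)%E -> avg (fun t => v t `^ Q) <= B ->
  avg (fun t => modulus (f (circle_pt r t)) * v t) <= M * B `^ Q^-1.
Proof.
move=> P1 Q2 PQ Pp M0 B0 tf tv v0 /(avg_powR_le P1 Pp M0 tf) fM vB.
have P0 : 0 < P := lt_trans ltr01 P1.
have Q0 : 0 < Q by apply: lt_le_trans Q2.
pose b := B `^ Q^-1; have b0 : 0 < b by rewrite powR_gt0.
have bQ : b `^ Q = B by rewrite -powRrM mulVf ?powRr1 ?(ltW B0)// gt_eqF.
have MP0 : 0 < M `^ P by rewrite powR_gt0.
pose u t := modulus (f (circle_pt r t)).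
have yng t : u t * v t <= M * b * (P^-1 * (M `^ P)^-1 * u t `^ P + Q^-1 * B^-1 * v t `^ Q).
  have := @conjugate_powR R (u t / M) (v t / b) P Q _ _ P0 Q0 PQ.
  have uM0 : 0 <= u t / M by apply: divr_ge0; [rewrite /u|exact: ltW].
  have vb0 : 0 <= v t / b by apply: divr_ge0; [exact: v0|exact: ltW].
  move=> /(_ uM0 vb0); have {}uM0 : 0 <= u t by rewrite /u.
  rewrite !powR_div// bQ => H.
  have -> : u t * v t = M * b * (u t / M * (v t / b)) by field; rewrite !gt_eqF.
  rewrite ler_wpM2l ?mulr_ge0 ?(ltW M0) ?(ltW b0)// (le_trans H)//.
  by rewrite le_eqVlt; apply/orP; left; apply/eqP; ring.
have tu : tame (fun t => u t `^ P).
  by apply: tame_powR; [exact: ltW|move=> s; rewrite /u|exact: tf].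
have tvQ : tame (fun t => v t `^ Q) by apply: tame_powR => //; exact: ltW.
apply: (@le_trans _ _ (avg (fun t => M * b * (P^-1 * (M `^ P)^-1 * u t `^ P + Q^-1 * B^-1 * v t `^ Q)))).
  apply: avg_le => //; first exact: tameM.
    by apply: tameZ; apply: tameD; exact: tameZ.
  by move=> s _; exact: yng.
rewrite avgZ; last by apply: tameD; exact: tameZ.
rewrite -[leRHS]mulr1 -/b ler_wpM2l ?mulr_ge0 ?(ltW M0) ?(ltW b0)//.
rewrite avgD; [|exact: tameZ|exact: tameZ]; rewrite !avgZ// -PQ.
apply: lerD; rewrite -mulrA ler_piMr ?invr_ge0 ?(ltW P0) ?(ltW Q0)//.
  by rewrite mulrC ler_pdivrMr// mul1r.
by rewrite mulrC ler_pdivrMr// mul1r.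
Qed.

(** Interpolation between the sup norm, at most k, and the L^2 norm, at most
k^(1/2): x^Q <= k^(Q-2) x^2 pointwise. *)
Lemma avg_trig_powR (Q : R) n d (S : pred nat) (k : R) : 2 <= Q ->
  (forall i, (i < n)%N -> modulus (d i) <= (S i)%:R) ->
  (\sum_(i < n) (S i)%:R <= k) -> 0 < k ->
  avg (fun t => modulus (trig n id d t) `^ Q) <= k `^ (Q - 1).
Proof.
move=> Q2 dS Sk k0.
have Q20 : 0 <= Q - 2 by lra.
have tg := tame_trig n id d.
have gk t : modulus (trig n id d t) <= k.
  by rewrite (le_trans (trig_le _ _ _ _))// (le_trans _ Sk)// ler_sum// => i _; exact: dS.
apply: (@le_trans _ _ (avg (fun t => k `^ (Q - 2) * modulus (trig n id d t) ^+ 2))).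
  apply: avg_le; first by apply: tame_powR => //; lra.
    by apply: tameZ; exact: tameX.
  move=> t _; set x := modulus _; have x0 : 0 <= x by rewrite /x.
  have [->|xn0] := eqVneq x 0.
    by rewrite powR0 ?mulr_ge0 ?powR_ge0 ?sqr_ge0// gt_eqF//; lra.
  have xp : 0 < x by rewrite lt_neqAle eq_sym xn0.
  rewrite (_ : Q = Q - 2 + 2%:R) 1?[in X in X <= _](powRDp _ _ xp) ?powR_mulrn//; last by ring.
  rewrite (_ : Q - 2 + 2 - 2 = Q - 2); last by ring.
  by rewrite ler_wpM2r ?sqr_ge0// ge0_ler_powR ?nnegrE ?(ltW k0)//; exact: gk.
rewrite avgZ; last exact: tameX.
rewrite parseval; last by move=> ? ? _ _.
rewrite (_ : Q - 1 = Q - 2 + 1); last by ring.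
rewrite [leRHS]powRDp// powRr1 ?(ltW k0)// ler_wpM2l ?powR_ge0// (le_trans _ Sk)// ler_sum// => i _.
have := dS i (ltn_ord i); case: (S i) => /= h.
  by rewrite expr_le1.
have -> : modulus (d i) = 0 by apply/eqP; rewrite eq_le h modulus_ge0.
by rewrite expr0n.
Qed.

End pairing.

(** * Lower bounds for integral means *)

Section lower_bounds.
Local Open Scope complex_scope.
Context {R : realType}.
Local Notation C := (Cplx R).
Implicit Types (x y r s t M B : R) (z w l : C) (a d : nat -> C) (f g : C -> C) (u v : R -> R).

Lemma bernoulli_ge x n : 0 <= x <= 1 -> 1 - n%:R * x <= (1 - x) ^+ n.
Proof.
move=> /andP[x0 x1]; elim: n => [|n IH]; first by rewrite mul0r subr0 expr0.
rewrite exprS -natr1; have := mulr_ge0 (ler0n R n) x0; nra.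
Qed.

(** The condition |(T^i f) 0| > 1 in terms of the coefficients. *)
Definition large_coef alpha a i : bool := 1 < modulus (a i) * i.+1%:R `^ alpha.

Lemma hypercyclic_large_coefs alpha f : analytic_disc f -> U_frequently_hypercyclic alpha f ->
  exists a, has_series a f /\ exists2 d : R, 0 < d & forall N, exists2 n, (N <= n)%N &
    d * n%:R <= (count (large_coef alpha a) (iota 1 n))%:R.
Proof.
move=> /analytic_has_series[a af] hf; exists a; split=> //.
have U0 : exists2 g : C -> C, analytic_disc g & ([set g | 1 < modulus (g 0)] : set (disc_fun R)) g.
  exists (fun=> 2%:R) => /=; last by rewrite modulus_nat ltr1n.
  apply: (@has_series_analytic R (fun k => if k == 0%N then 2%:R else 0)) => z z1.
  have := @cvgsum_fin R 1 (fun k => (if k == 0%N then 2%:R else 0) * z ^+ k).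
  rewrite big_ord1 eqxx expr0 mulr1; apply => -[|k]// _.
  by rewrite mul0r.
have [d d0 H] := upper_density_gt0 (hf _ open_eval0 U0).
exists d => // N; have [n Nn Hn] := H N; exists n => //.
rewrite (le_trans Hn)// ler_nat; apply: sub_count => k /set_mem [_] /=.
rewrite (iter_shift_at0 alpha k af) modulusM modulus_real ger0_norm ?powR_ge0//.
Qed.

(** The phase of z, with value 0 at 0. *)
Definition phase z : C := z / (modulus z)%:C.

Lemma phase_le z : modulus (phase z) <= 1.
Proof.
rewrite modulusM modulusV modulus_real ger0_norm//.
have [->|z0] := eqVneq z 0; first by rewrite modulus0 mul0r.
by rewrite mulfV// modulus_eq0.
Qed.

Lemma Re_phase z : complex.Re (z * cj (phase z)) = modulus z.
Proof.
have [->|z0] := eqVneq z 0; first by rewrite mul0r modulus0.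
have m0 : modulus z != 0 by rewrite modulus_eq0.
rewrite /phase cjM cjV cj_real mulrA mulJ -[_^-1](fmorphV (real_complex R)) -rmorphM/=.
by rewrite expr2 mulfK.
Qed.

(** The Hausdorff-Young inequality tested on the indicator of a finite set: pair f with
the polynomial whose coefficients are the phases of a over S. *)
Lemma restricted_hausdorff_young (P Q : R) p a f r n (S : pred nat) (k M : R) :
  1 < P -> 2 <= Q -> P^-1 + Q^-1 = 1 -> (P%:E <= p)%E ->
  has_series a f -> 0 < r < 1 ->
  \sum_(i < n) (S i)%:R <= k -> 0 < k -> 0 < M -> (integral_mean p f r <= M%:E)%E ->
  \sum_(i < n) (S i)%:R * modulus (a i) * r ^+ i <= M * k `^ P^-1.
Proof.
move=> P1 Q2 PQ Pp af r01 Sk k0 M0 fM.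
pose d i := if S i then phase (a i) else 0.
have tf := has_series_tame af r01.
have dS i : (i < n)%N -> modulus (d i) <= (S i)%:R.
  by move=> _; rewrite /d; case: (S i) => /=; [exact: phase_le|rewrite modulus0].
have gQ := avg_trig_powR Q2 dS Sk k0.
have B0 : 0 < k `^ (Q - 1) by rewrite powR_gt0.
have := holder_mean P1 Q2 PQ Pp M0 B0 tf (tame_trig n id d) (fun t => modulus_ge0 _) fM gQ.
have Q0 : Q != 0 by rewrite gt_eqF// (lt_le_trans _ Q2).
rewrite -powRrM (_ : (Q - 1) * Q^-1 = P^-1); last first.
  by rewrite mulrBl mulfV// mul1r -PQ addrK.
apply: le_trans; apply: le_trans (pairing n d af r01).
rewrite le_eqVlt; apply/orP; left; apply/eqP; apply: eq_bigr => i _; rewrite /d.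
by case: (S i); rewrite ?Re_phase ?mul1r// (cj_nat 0) mulr0 !mul0r.
Qed.

Lemma count_iota_sum (b : pred nat) n :
  (count b (iota 1 n))%:R = \sum_(1 <= i < n.+1) (b i)%:R :> R.
Proof.
rewrite -sum1_count natr_sum big_mkcond/= /index_iota subSS subn0.
by apply: eq_bigr => i _; case: (b i).
Qed.

(** Discarding the indices below m costs at most m of them. *)
Lemma count_tail (b : pred nat) m n (x : R) : x <= (count b (iota 1 n))%:R ->
  x - m%:R <= \sum_(i < n.+1) ((m <= i)%N && b i)%:R.
Proof.
move=> xb; rewrite lerBlDr (le_trans xb)// count_iota_sum -(big_mkord xpredT (fun i => ((m <= i)%N && b i)%:R)).
rewrite big_nat_recl// -[X in X <= _]add0r.
have h : \sum_(1 <= i < n.+1) (b i)%:R <= \sum_(1 <= i < n.+1) ((m <= i)%N && b i)%:R + m%:R :> R.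
  apply: (@le_trans _ _ (\sum_(1 <= i < n.+1) (((m <= i)%N && b i)%:R + (i < m)%N%:R))).
    apply: ler_sum => i _; case: leqP => /= _; case: (b i) => /=; rewrite ?addr0 ?add0r ?ler01//.
  rewrite big_split/= lerD2l.
  elim: n {xb} => [|n IH]; first by rewrite big_nil.
  rewrite big_nat_recr//=; case: ltnP => nm /=; last by rewrite addr0.
  have : \sum_(1 <= i < n.+1) (i < m)%N%:R <= n%:R :> R.
    rewrite -[n in leRHS]subn0 -(subSS 0) -[leRHS]mulr1 mulr_natl -sumr_const_nat ler_sum// => i _.
    by case: ltnP => _ /=; rewrite ?ler01 ?lexx.
  move=> /(@lerD _ _ _ 1 1)/(_ (lexx _))/le_trans; apply.
  by rewrite natr1 ler_nat ltnW.
by rewrite add0r (le_trans h)// lerD2r big_add1/= lerDr ler0n.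
Qed.

Lemma powR_between_ge x y t (e : R) : 0 < x -> x <= t <= y ->
  Num.min (x `^ e) (y `^ e) <= t `^ e.
Proof.
move=> x0 /andP[xt ty]; have t0 : 0 < t by exact: lt_le_trans xt.
rewrite ge_min; have [e0|e0] := leP 0 e.
  by rewrite ge0_ler_powR ?nnegrE// ltW.
apply/orP; right; have ne0 : 0 <= - e by rewrite oppr_ge0 ltW.
rewrite -[e]opprK !(powRN _ (- e)) lef_pV2 ?posrE ?powR_gt0//; last exact: lt_le_trans ty.
by rewrite ge0_ler_powR ?nnegrE// ltW// (lt_le_trans t0).
Qed.

Lemma powR_small (g e : R) : 0 < g -> 0 < e ->
  exists N, forall n, (N <= n)%N -> n%:R `^ (- g) <= e.
Proof.
move=> g0 e0; have [N HN] := nat_large (e `^ (- g^-1)).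
exists N.+1 => n Nn; have n0 : 0 < n%:R :> R by rewrite ltr0n (leq_trans _ Nn).
have h := HN n (ltnW Nn).
have -> : e = (e `^ (- g^-1)) `^ (- g).
  by rewrite -powRrM mulrNN mulVf ?gt_eqF// powRr1// ltW.
rewrite !(powRN _ g) lef_pV2 ?posrE ?powR_gt0// ge0_ler_powR ?nnegrE ?powR_ge0 ?(ltW g0)//.
Qed.

(** From z^Q = (x + y) z^(Q-1) with z = x + y and Young's inequality for x z^(Q-1):
the increment is controlled by y z^(Q-1), hence by the cross term y x^(Q-1), which
is small on average when y is, and by y^Q. *)
Lemma powR_add_le (P Q x y : R) : 1 < P -> 2 <= Q -> P^-1 + Q^-1 = 1 -> 0 <= x -> 0 <= y ->
  (x + y) `^ Q <= x `^ Q + Q * 2 `^ (Q - 1) * (y * x `^ (Q - 1) + y `^ Q).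
Proof.
move=> P1 Q2 PQ x0 y0; pose z := x + y; have z0 : 0 <= z by rewrite addr_ge0.
have P0 : 0 < P := lt_trans ltr01 P1.
have Q0 : 0 < Q by apply: lt_le_trans Q2.
have Q10 : 0 <= Q - 1 by rewrite subr_ge0 (le_trans _ Q2)// ler1n.
have E1 : (Q - 1) * P = Q.
  have : (P^-1 + Q^-1) * (P * Q) = P * Q by rewrite PQ mul1r.
  rewrite mulrDl mulrA mulVf ?gt_eqF// mul1r [P * Q]mulrC mulrA mulVf ?gt_eqF// mul1r => E.
  by rewrite mulrBl mul1r -E addrK.
have yng := conjugate_powR x0 (powR_ge0 z (Q - 1)) Q0 P0 (etrans (addrC _ _) PQ).
rewrite -powRrM E1 in yng.
have zQ : z `^ Q = (x + y) * z `^ (Q - 1) by rewrite mulr_powRB1.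
have key : z `^ Q <= x `^ Q + Q * y * z `^ (Q - 1).
  have QP : Q / P = Q - 1 by rewrite -[in Q / P]E1 mulfK// gt_eqF.
  have : Q * (x * z `^ (Q - 1)) <= x `^ Q + (Q - 1) * z `^ Q.
    rewrite (le_trans (ler_wpM2l (ltW Q0) yng))// -[in leRHS]QP le_eqVlt; apply/orP; left; apply/eqP.
    by field; rewrite !gt_eqF.
  move: zQ; set A := z `^ Q; set B := z `^ _; set D := x `^ _ => -> h.
  have -> : (x + y) * B = Q * (x * B) + Q * y * B - (Q - 1) * ((x + y) * B) by ring.
  lra.
rewrite (le_trans key)// lerD2l -!mulrA ler_wpM2l ?(ltW Q0)//.
have B : z `^ (Q - 1) <= 2 `^ (Q - 1) * (x `^ (Q - 1) + y `^ (Q - 1)).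
  have [xy|/ltW yx] := leP x y.
    apply: (@le_trans _ _ ((2 * y) `^ (Q - 1))).
      by rewrite ge0_ler_powR ?nnegrE ?mulr_ge0// /z mulrDl mul1r lerD2r.
    by rewrite powRM// ler_wpM2l ?powR_ge0// lerDr powR_ge0.
  apply: (@le_trans _ _ ((2 * x) `^ (Q - 1))).
    by rewrite ge0_ler_powR ?nnegrE ?mulr_ge0// /z mulrDl mul1r lerD2l.
  by rewrite powRM// ler_wpM2l ?powR_ge0// lerDl powR_ge0.
rewrite (le_trans (ler_wpM2l y0 B))// -[y `^ Q]mulr_powRB1//.
by rewrite le_eqVlt; apply/orP; left; apply/eqP; ring.
Qed.

Section exponents.
Context (P Q alpha : R) (p : \bar R) (a : nat -> C) (f : C -> C).
Context (P1 : 1 < P) (Q2 : 2 <= Q) (PQ : P^-1 + Q^-1 = 1) (Pp : (P%:E <= p)%E).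
Context (af : has_series a f).
Context (delta : R) (d0 : 0 < delta).
Context (dense : forall N, exists2 n, (N <= n)%N & delta * n%:R <= (count (large_coef alpha a) (iota 1 n))%:R).

(** Take S to be the indices in [delta N / 2, N] with a large coefficient: there
|a_i| is at least c N^(-alpha) whatever the sign of alpha, r^i >= 1/2 for
r = 1 - 1/(2N), and S still has at least delta N / 2 elements. *)
Lemma subcritical_growth : exists2 c : R, 0 < c & forall N, exists2 r : R,
  1 - N.+1%:R^-1 <= r < 1 /\ 0 < r & forall M, 0 < M -> (integral_mean p f r <= M%:E)%E ->
    c <= (1 - r) `^ (Q^-1 - alpha) * M.
Proof.
pose c1 := Num.min ((delta / 2) `^ (- alpha)) (2 `^ (- alpha)).
have c10 : 0 < c1 by rewrite lt_min !powR_gt0// divr_gt0.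
exists (c1 / 2 * (delta / 2) `^ Q^-1 * 2 `^ (- (Q^-1 - alpha))).
  by rewrite !mulr_gt0 ?powR_gt0 ?divr_gt0.
move=> N0; have [N N0N HN] := dense N0.+1.
have N1 : (0 < N)%N by exact: leq_ltn_trans N0N.
have NR : 0 < N%:R :> R by rewrite ltr0n.
have NR1 : 1 <= N%:R :> R by rewrite ler1n.
pose r : R := 1 - (2 * N%:R)^-1.
have N2 : 0 < (2 * N%:R)^-1 :> R by rewrite invr_gt0 mulr_gt0.
have N2h : (2 * N%:R)^-1 <= 2^-1 :> R.
  by rewrite lef_pV2 ?posrE ?mulr_gt0// ler_peMr.
have r01 : 0 < r < 1 by rewrite /r; lra.
exists r.
  split; last by case/andP: r01.
  case/andP: r01 => _ ->; rewrite andbT /r lerD2l lerN2 lef_pV2 ?posrE ?mulr_gt0 ?ltr0n//.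
  by rewrite -natrM ler_nat (leq_trans N0N)// leq_pmull.
move=> M M0 fM.
(* below m the weight i^(-alpha) may be small; dropping these indices keeps
   half of the large coefficients *)
pose m := Num.truncn (delta * N%:R / 2).
have dN0 : 0 <= delta * N%:R / 2 by rewrite divr_ge0// mulr_ge0// ltW.
have mle : m%:R <= delta * N%:R / 2 by have /andP[] := truncn_itv dN0.
have mlt : delta * N%:R / 2 < m.+1%:R by exact: truncnS_gt.
pose S i := (m <= i)%N && large_coef alpha a i.
pose k : R := \sum_(i < N.+1) (S i)%:R.
have kge : delta * N%:R / 2 <= k by have := count_tail m HN; rewrite -/S -/k; lra.
have k0 : 0 < k by apply: lt_le_trans kge; rewrite divr_gt0// mulr_gt0.
have := restricted_hausdorff_young P1 Q2 PQ Pp af r01 (lexx k) k0 M0 fM => H.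
have low : k * (c1 * N%:R `^ (- alpha) / 2) <= M * k `^ P^-1.
  apply: le_trans H; rewrite /k mulr_suml ler_sum// => i _.
  rewrite -!mulrA /S; case: (boolP (m <= i)%N) => mi /=; last by rewrite !mul0r.
  case: (boolP (large_coef alpha a i)) => [|_] /=; last by rewrite !mul0r.
  rewrite !mul1r /large_coef => big; rewrite mulrA.
  have i0 : 0 < i.+1%:R :> R by rewrite ltr0n.
  apply: ler_pM; rewrite ?mulr_ge0 ?powR_ge0 ?(ltW c10)//.
    apply: (@le_trans _ _ (i.+1%:R `^ (- alpha))); last first.
      rewrite powRN -[_^-1]mul1r ler_pdivrMr ?powR_gt0//; exact: ltW.
    have -> : i.+1%:R = (i.+1%:R / N%:R) * N%:R :> R by rewrite divfK// gt_eqF.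
    rewrite powRM ?divr_ge0 ?(ltW i0) ?(ltW NR)// ler_wpM2r ?powR_ge0//.
    apply: powR_between_ge; first by rewrite divr_gt0.
    rewrite ler_pdivlMr// ler_pdivrMr//; apply/andP; split.
      rewrite mulrAC (le_trans (ltW mlt))// ler_nat//.
    have := ltn_ord i; rewrite ltnS => iN; rewrite -natrM ler_nat mul2n -addnn.
    by rewrite (leq_ltn_trans iN)// -[X in (X < _)%N]addn0 ltn_add2l.
  apply: le_trans (bernoulli_ge i _); last by rewrite (ltW N2)/= (le_trans N2h)// invf_le1 ?ler1n.
  have : i%:R * (2 * N%:R)^-1 <= 2^-1 :> R.
    by rewrite ler_pdivrMr ?mulr_gt0// mulrA mulVf// mul1r ler_nat -ltnS.
  lra.
have [P0 Q0] : P != 0 /\ Q != 0.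
  by split; rewrite gt_eqF//; [exact: lt_trans P1|exact: lt_le_trans Q2].
have kQ : k = k `^ P^-1 * k `^ Q^-1 by rewrite -powRDp// PQ powRr1// ltW.
have low2 : k `^ Q^-1 * (c1 * N%:R `^ (- alpha) / 2) <= M.
  rewrite -(@ler_pM2l _ (k `^ P^-1)) ?powR_gt0// mulrA -kQ; rewrite [leRHS]mulrC; exact: low.
have -> : 1 - r = (2 * N%:R)^-1 by rewrite /r opprB addrC subrK.
have -> : (2 * N%:R)^-1 `^ (Q^-1 - alpha) = 2 `^ (- (Q^-1 - alpha)) * N%:R `^ (- (Q^-1 - alpha)).
  by rewrite -powRM// -[(2 * N%:R)^-1]powR_inv1 ?mulr_ge0// -powRrM mulN1r.
rewrite mulrC -[leRHS]mulrA ler_wpM2l ?powR_ge0//.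
apply: le_trans (ler_wpM2l (powR_ge0 _ _) low2).
have EN : N%:R `^ alpha * N%:R `^ (- alpha) = 1 :> R by rewrite powRN mulfV ?gt_eqF ?powR_gt0.
rewrite opprB powRDp//.
rewrite [leRHS](_ : _ = c1 / 2 * (k `^ Q^-1 * N%:R `^ (- Q^-1)) * (N%:R `^ alpha * N%:R `^ (- alpha))); last by ring.
rewrite EN mulr1 ler_wpM2l ?divr_ge0 ?(ltW c10)// powRN.
rewrite -powR_div ?(ltW k0)// ge0_ler_powR ?nnegrE ?divr_ge0 ?invr_ge0 ?(ltW d0) ?(ltW k0) ?(ltW NR)//.
  by rewrite (le_trans _ Q2).
by rewrite ler_pdivlMr// mulrAC.
Qed.

(** Already one nonzero coefficient bounds all the means from below, uniformly on
[1/2, 1). *)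
Lemma supercritical_bound : exists2 c : R, 0 < c & forall r, 2^-1 <= r < 1 ->
  forall M, 0 < M -> (integral_mean p f r <= M%:E)%E -> c <= M.
Proof.
have [N N1 HN] := dense 1.
have : (0 < count (large_coef alpha a) (iota 1 N))%N.
  by rewrite -(ltr0n R) (lt_le_trans _ HN)// mulr_gt0// ltr0n.
rewrite -has_count => /hasP[i _ big].
have ai : 0 < modulus (a i).
  by rewrite lt_neqAle modulus_ge0 andbT eq_sym; apply: contraTneq big;
    rewrite /large_coef => ->; rewrite mul0r ltr10.
exists (modulus (a i) * 2^-1 ^+ i); first by rewrite mulr_gt0// exprn_gt0.
move=> r /andP[r2 r1] M M0 fM.
have r01 : 0 < r < 1 by rewrite r1 andbT (lt_le_trans _ r2).
have S1 : \sum_(j < i.+1) (pred1 i j)%:R <= 1 :> R.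
  rewrite (bigD1 ord_max)//= eqxx big1 ?addr0// => j; rewrite -val_eqE/= => /negbTE.
  by move=> ->.
have := restricted_hausdorff_young P1 Q2 PQ Pp af r01 S1 ltr01 M0 fM.
rewrite powR1 mulr1; apply: le_trans.
rewrite (bigD1 ord_max)//= eqxx mul1r big1 ?addr0; last first.
  by move=> j; rewrite -val_eqE/= => /negbTE ->; rewrite !mul0r.
have r0 : 0 <= r by case/andP: r01 => /ltW.
by rewrite ler_wpM2l// lerXn2r// nnegrE// invr_ge0.
Qed.

(** Add to the polynomial with coefficients d a new one, supported in [n, N] and with
phases of a weighted by N^(-1/P).  The pairing grows by a constant because
N^(-1/P) N^(-alpha) N = 1.  The L^Q norm of the new piece is bounded, and if Q > 2
its L^1 mean is of order N^(1/2-1/P), which tends to 0: for N large the cross term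
of [powR_add_le] is at most one.  If Q = 2 then this decay is lost, but the two
pieces are orthogonal. *)
Lemma critical_step n d : alpha = Q^-1 -> exists n' d',
  [/\ forall i, 0 <= complex.Re (a i * cj (d i)) -> 0 <= complex.Re (a i * cj (d' i)),
      \sum_(i < n) complex.Re (a i * cj (d i)) + delta / 2 * 2 `^ (- alpha) <=
        \sum_(i < n') complex.Re (a i * cj (d' i)) &
      avg (fun t => modulus (trig n' id d' t) `^ Q) <=
        avg (fun t => modulus (trig n id d t) `^ Q) + (2 + Q * 2 `^ (Q - 1) * 2 `^ (Q - 1))].
Proof.
move=> aQ; have P0 : 0 < P := lt_trans ltr01 P1.
have Q0 : 0 < Q by apply: lt_le_trans Q2.
have Q1 : 1 <= Q by rewrite (le_trans _ Q2)// ler1n.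
have al0 : 0 <= alpha by rewrite aQ invr_ge0 ltW.
have Pal : P^-1 + alpha = 1 by rewrite aQ.
pose CQ := Q * 2 `^ (Q - 1).
have CQ0 : 0 <= CQ by rewrite mulr_ge0 ?powR_ge0// ltW.
pose Bd := \sum_(i < n) modulus (d i).
have Bd0 : 0 <= Bd by rewrite sumr_ge0// => i _; rewrite modulus_ge0.
pose g := P^-1 - 2^-1.
have [N1 HN1] : exists N1, forall N, (N1 <= N)%N -> 2 < Q ->
    CQ * Bd `^ (Q - 1) * (3 / 2 * N%:R `^ (- g)) <= 1.
  have [Q2'|Q2'] := leP Q 2; first by exists 0%N.
  have g0 : 0 < g.
    have : Q^-1 < 2^-1 by rewrite ltf_pV2 ?posrE.
    by have := PQ; rewrite /g; lra.
  have L0 : 0 < (CQ * Bd `^ (Q - 1) + 1) * 2.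
    by rewrite mulr_gt0// ltr_wpDl// mulr_ge0// powR_ge0.
  have L0' : 0 < ((CQ * Bd `^ (Q - 1) + 1) * 2)^-1 by rewrite invr_gt0.
  have [N1 HN1] := powR_small g0 L0'.
  exists N1 => N /HN1 h _; have X0 : 0 <= CQ * Bd `^ (Q - 1) by rewrite mulr_ge0// powR_ge0.
  move: h; rewrite -[X in _ <= X]mul1r ler_pdivlMr//; have := powR_ge0 N%:R (- g).
  move: X0; set X := CQ * _; set Y := _ `^ (- g) => X0 Y0; nra.
have [N2 HN2] := nat_large (2 * n%:R / delta).
have [N Nbig HN] := dense (N1 + N2).+1.
have {}HN1 := HN1 N (leq_trans (leq_addr _ _) (ltnW Nbig)).
have {}HN2 := HN2 N (leq_trans (leq_addl _ _) (ltnW Nbig)).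
have Np : (0 < N)%N by exact: leq_ltn_trans Nbig.
have NR : 0 < N%:R :> R by rewrite ltr0n.
have nN : n%:R <= delta * N%:R / 2.
  by move: HN2; rewrite ler_pdivrMr//; lra.
pose S i := (n <= i)%N && large_coef alpha a i.
pose k : R := \sum_(i < N.+1) (S i)%:R.
have kge : delta * N%:R / 2 <= k by have := count_tail n HN; rewrite -/S -/k; lra.
have kle : k <= 2 * N%:R.
  apply: (@le_trans _ _ (\sum_(i < N.+1) 1)).
    by apply: ler_sum => i _; case: (S i) => /=; rewrite ?ler01.
  by rewrite sumr_const card_ord -natrM ler_nat mul2n -addnn -addn1 leq_add2l.
have N20 : 0 < 2 * N%:R :> R by rewrite mulr_gt0.
(* e is the new piece; dp and ep extend the two coefficient sequences by zero *)
pose w := N%:R `^ (- P^-1); have w0 : 0 < w by rewrite powR_gt0.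
pose e1 i := if S i then phase (a i) else 0.
pose e i : C := w%:C * e1 i.
pose dp i := if (i < n)%N then d i else 0.
pose ep i : C := if (i < N.+1)%N then e i else 0.
have e1S i : modulus (e1 i) <= (S i)%:R.
  by rewrite /e1; case: (S i) => /=; [exact: phase_le|rewrite modulus0].
have me i : modulus (e i) = w * modulus (e1 i) by rewrite modulusM modulus_real gtr0_norm.
have Ree i : complex.Re (a i * cj (e i)) = w * ((S i)%:R * modulus (a i)).
  rewrite /e cjM cj_real mulrCA (_ : complex.Re (w%:C * _) = w * complex.Re (a i * cj (e1 i))); last first.
    by case: (a i * _) => x y /=; ring.
  by rewrite /e1; case: (S i); rewrite ?Re_phase ?mul1r// (cj_nat 0) mulr0 mul0r.
have Ree0 i : 0 <= complex.Re (a i * cj (e i)).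
  by rewrite Ree mulr_ge0 ?(ltW w0)// mulr_ge0.
have ReD i : complex.Re (a i * cj (dp i + ep i)) =
    complex.Re (a i * cj (dp i)) + complex.Re (a i * cj (ep i)).
  rewrite (_ : cj (dp i + ep i) = cj (dp i) + cj (ep i)); last exact: (raddfD (@conjc R)).
  by rewrite mulrDr; case: (a i * cj (dp i)) => ? ?; case: (a i * cj (ep i)).
exists (n + N.+1)%N, (fun i => dp i + ep i); split.
- move=> i di; rewrite ReD addr_ge0//.
    by rewrite /dp; case: ifP => // _; rewrite (cj_nat 0) mulr0.
  by rewrite /ep; case: ifP => // _; rewrite (cj_nat 0) mulr0.
- under [leRHS]eq_bigr do rewrite ReD; rewrite big_split/=.
  have -> : \sum_(i < n + N.+1) complex.Re (a i * cj (dp i)) =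
            \sum_(i < n) complex.Re (a i * cj (d i)).
    rewrite big_split_ord/= [X in _ + X]big1 ?addr0 => [|i _]; last first.
      by rewrite /dp ltnNge leq_addr (cj_nat 0) mulr0.
    by apply: eq_bigr => i _; rewrite /dp ltn_ord.
  have -> : \sum_(i < n + N.+1) complex.Re (a i * cj (ep i)) =
            \sum_(i < N.+1) complex.Re (a i * cj (e i)).
    rewrite addnC big_split_ord/= [X in _ + X]big1 ?addr0 => [|i _]; last first.
      by rewrite /ep ltnNge leq_addr (cj_nat 0) mulr0.
    by apply: eq_bigr => i _; rewrite /ep ltn_ord.
  rewrite lerD2l; apply: (@le_trans _ _ (k * (w * (2 * N%:R) `^ (- alpha)))).
    have wN : w * N%:R `^ (- alpha) = N%:R^-1 by rewrite /w -powRDp// -opprD Pal powR_inv1.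
    have -> : k * (w * (2 * N%:R) `^ (- alpha)) = k / N%:R * 2 `^ (- alpha).
      by rewrite powRM// -wN; ring.
    by rewrite ler_wpM2r ?powR_ge0// ler_pdivlMr// mulrAC.
  rewrite /k mulr_suml ler_sum// => i _; rewrite Ree mulrCA ler_wpM2l ?(ltW w0)//.
  rewrite /S; case: (n <= i)%N => /=; last by rewrite !mul0r.
  case: (boolP (large_coef alpha a i)) => [|_] /=; last by rewrite !mul0r.
  rewrite !mul1r /large_coef => big; rewrite powRN -[_^-1]mul1r ler_pdivrMr ?powR_gt0//.
  rewrite (le_trans (ltW big))// ler_wpM2l// ge0_ler_powR ?nnegrE ?ler0n ?(ltW N20)//.
  rewrite -natrM ler_nat mul2n -addnn; have := ltn_ord i; rewrite ltnS => iN.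
  by rewrite (leq_ltn_trans iN)// -[X in (X < _)%N]addn0 ltn_add2l.
have trigE t : trig (n + N.+1) id (fun i => dp i + ep i) t = trig n id d t + trig N.+1 id e t.
  rewrite -(trig_pad n N.+1 d t) -(trig_pad N.+1 n e t) (addnC N.+1) /trig -big_split/=.
  by apply: eq_bigr => i _; rewrite mulrDl.
pose G t := modulus (trig n id d t); pose y t := modulus (trig N.+1 id e t).
have G0 t : 0 <= G t by rewrite /G.
have y0 t : 0 <= y t by rewrite /y.
have tG : tame G by exact: tame_trig.
have ty : tame y by exact: tame_trig.
have tGQ : tame (fun t => G t `^ Q) by apply: tame_powR => //; exact: ltW.
have tyQ : tame (fun t => y t `^ Q) by apply: tame_powR => //; exact: ltW.
have yE t : y t = w * modulus (trig N.+1 id e1 t).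
  rewrite /y /trig (eq_bigr (fun i : 'I_N.+1 => w%:C * (e1 i * circle_pt 1 (i%:R * t)))).
    by rewrite -mulr_sumr modulusM modulus_real gtr0_norm.
  by move=> i _; rewrite /e mulrA.
have QP : Q - 1 = Q / P.
  have : (P^-1 + Q^-1) * Q = Q by rewrite PQ mul1r.
  by rewrite mulrDl mulVf ?gt_eqF// => E; rewrite -[X in X - 1]E addrK mulrC.
have yQ : avg (fun t => y t `^ Q) <= 2 `^ (Q - 1).
  have -> : (fun t => y t `^ Q) = (fun t => w `^ Q * modulus (trig N.+1 id e1 t) `^ Q).
    by apply/funext => t; rewrite yE powRM ?(ltW w0).
  rewrite avgZ; last by apply: tame_powR => [|t|]; [exact: ltW|exact: modulus_ge0|exact: tame_trig].
  have := @avg_trig_powR R Q N.+1 e1 S (2 * N%:R) Q2 (fun i _ => e1S i) kle N20 => h.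
  rewrite (le_trans (ler_wpM2l (powR_ge0 w Q) h))// powRM// mulrCA /w -powRrM -powRDp//.
  by rewrite mulNr [P^-1 * Q]mulrC -QP addNr powRr0 mulr1.
(* the case Q = 2, by orthogonality *)
have [Q2'|Q2'] := leP Q 2.
  have QE : Q = 2%:R by apply/eqP; rewrite eq_le Q2' Q2.
  have sqE (u : R -> C) : (fun t => modulus (u t) `^ Q) = (fun t => modulus (u t) ^+ 2).
    by apply/funext => t; rewrite QE powR_mulrn.
  rewrite sqE parseval; last by move=> ? ? _ _.
  have -> : avg (fun t => modulus (trig n id d t) `^ Q) = \sum_(i < n + N.+1) modulus (dp i) ^+ 2.
    rewrite sqE -(@parseval R (n + N.+1) id); last by move=> ? ? _ _.
    by congr avg; apply/funext => t; rewrite trig_pad.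
  have yQ' : \sum_(i < n + N.+1) modulus (ep i) ^+ 2 <= 2 `^ (Q - 1).
    move: yQ; rewrite sqE -(@parseval R (n + N.+1) id); last by move=> ? ? _ _.
    apply: le_trans; rewrite le_eqVlt; apply/orP; left; apply/eqP; congr avg; apply/funext => t.
    by rewrite (addnC n) trig_pad.
  have split i : modulus (dp i + ep i) ^+ 2 = modulus (dp i) ^+ 2 + modulus (ep i) ^+ 2.
    rewrite /dp /ep /e /e1 /S; case: (ltnP i n) => ni /=.
      by rewrite !mulr0 (if_same (i < N.+1)%N) modulus0 expr0n !addr0.
    by rewrite modulus0 expr0n !add0r.
  under eq_bigr do rewrite split; rewrite big_split/= lerD2l (le_trans yQ')//.
  rewrite QE (_ : 2%:R - 1 = 1); last by ring.
  rewrite powRr1//; have : 0 <= 2%:R * 2 * 2 :> R by rewrite !mulr_ge0.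
  lra.
have avgy : avg y <= 3 / 2 * N%:R `^ (- g).
  pose h := N%:R `^ (- g); have h0 : 0 < h by rewrite powR_gt0.
  have wk : w ^+ 2 * k <= 2 * h ^+ 2.
    have -> : 2 * h ^+ 2 = w ^+ 2 * (2 * N%:R).
      have -> : h = w * Num.sqrt N%:R by rewrite /h /g opprB addrC powRDp// powR12_sqrt.
      by rewrite exprMn sqr_sqrtr//; ring.
    by rewrite ler_wpM2l ?sqr_ge0.
  have y2 : avg (fun t => y t ^+ 2) <= w ^+ 2 * k.
    rewrite /y parseval; last by move=> ? ? _ _.
    rewrite /k mulr_sumr ler_sum// => i _; rewrite me exprMn ler_wpM2l ?sqr_ge0//.
    have := e1S i; case: (S i) => /= hh; first by rewrite expr_le1.
    have -> : modulus (e1 i) = 0 by apply/eqP; rewrite eq_le hh modulus_ge0.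
    by rewrite expr0n.
  apply: (@le_trans _ _ (avg (fun t => (2 * h)^-1 * y t ^+ 2 + h / 2))).
    apply: avg_le => //; first by apply: tameD; [apply: tameZ; exact: tameX|exact: tame_cst].
    move=> t _; rewrite -(@ler_pM2l _ (2 * h)) ?mulr_gt0// mulrDr mulrA mulfV ?gt_eqF ?mulr_gt0//.
    have := sqr_ge0 (y t - h); nra.
  rewrite avgD; [|by apply: tameZ; exact: tameX|exact: tame_cst].
  rewrite avg_cst (@avgZ _ _ (fun t => y t ^+ 2)); last exact: tameX.
  have : (2 * h)^-1 * avg (fun t => y t ^+ 2) <= h.
    rewrite mulrC ler_pdivrMr ?mulr_gt0//; nra.
  rewrite -/h; lra.
have pw t : modulus (trig (n + N.+1) id (fun i => dp i + ep i) t) `^ Q <=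
    G t `^ Q + CQ * (Bd `^ (Q - 1) * y t + y t `^ Q).
  rewrite trigE; apply: (@le_trans _ _ ((G t + y t) `^ Q)).
    by apply: ge0_ler_powR; rewrite ?nnegrE ?(ltW Q0)// ?addr_ge0//; exact: modulusD.
  apply: le_trans (powR_add_le P1 Q2 PQ (G0 t) (y0 t)) _.
  rewrite lerD2l -/CQ ler_wpM2l// lerD2r mulrC ler_wpM2r// ge0_ler_powR ?nnegrE//.
  - by rewrite subr_ge0.
  - exact: trig_le.
apply: (@le_trans _ _ (avg (fun t => G t `^ Q + CQ * (Bd `^ (Q - 1) * y t + y t `^ Q)))).
  apply: avg_le => //.
    by apply: tame_powR => [|t|]; [exact: ltW|exact: modulus_ge0|exact: tame_trig].
  by apply: tameD => //; apply: tameZ; apply: tameD => //; exact: tameZ.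
have tz : tame (fun t => Bd `^ (Q - 1) * y t) by exact: tameZ.
rewrite avgD//; last by apply: tameZ; apply: tameD.
rewrite avgZ; last exact: tameD.
rewrite avgD// avgZ// lerD2l mulrDr -/CQ.
have := HN1 Q2'; have := ler_wpM2l (mulr_ge0 CQ0 (powR_ge0 Bd (Q - 1))) avgy.
have := ler_wpM2l CQ0 yQ; rewrite mulrA; lra.
Qed.

Lemma critical_sums J : alpha = Q^-1 -> exists n d,
  [/\ forall i, 0 <= complex.Re (a i * cj (d i)),
      J%:R * (delta / 2 * 2 `^ (- alpha)) <= \sum_(i < n) complex.Re (a i * cj (d i)) &
      avg (fun t => modulus (trig n id d t) `^ Q) <=
        J%:R * (2 + Q * 2 `^ (Q - 1) * 2 `^ (Q - 1))].
Proof.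
move=> aQ; elim: J => [|J [n [d [H1 H2 H3]]]].
  exists 0%N, (fun=> 0); split=> [i||]; first by rewrite (cj_nat 0) mulr0.
    by rewrite mul0r big_ord0.
  rewrite mul0r (_ : (fun _ => _) = fun=> 0) ?avg_cst//; apply/funext => t.
  by rewrite /trig big_ord0 modulus0 powR0// gt_eqF// (lt_le_trans _ Q2).
have [n' [d' [H1' H2' H3']]] := critical_step n d aQ.
exists n', d'; split=> [i||]; first exact: H1'.
  by rewrite -natr1 mulrDl mul1r (le_trans _ H2')// lerD2r.
by rewrite -natr1 mulrDl mul1r (le_trans H3')// lerD2r.
Qed.

(** The pairing is at least c J and the L^Q norm at most (K J)^(1/Q), so the mean of f
is at least c J^(1/P) at radii close to one. *)
Lemma critical_unbounded K N : alpha = Q^-1 -> 0 < K -> exists2 r : R,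
  1 - N.+1%:R^-1 <= r < 1 /\ 0 < r & forall M, 0 < M -> (integral_mean p f r <= M%:E)%E ->
    K <= M.
Proof.
move=> aQ K0; have P0 : 0 < P := lt_trans ltr01 P1.
have Q0 : 0 < Q by apply: lt_le_trans Q2.
pose c0 := delta / 2 * 2 `^ (- alpha); have c00 : 0 < c0 by rewrite mulr_gt0 ?divr_gt0 ?powR_gt0.
pose K0' := 2 + Q * 2 `^ (Q - 1) * 2 `^ (Q - 1).
have K0p : 0 < K0' by rewrite ltr_wpDr ?mulr_ge0 ?powR_ge0 ?(ltW Q0).
pose c1 := c0 / 2 / K0' `^ Q^-1; have c10 : 0 < c1 by rewrite !divr_gt0 ?powR_gt0.
have [J0 HJ] := @powR_small P^-1 (c1 / K) ltac:(by rewrite invr_gt0) ltac:(by rewrite divr_gt0).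
pose J := J0.+1; have {}HJ := HJ J (leqnSn _).
have JR : 0 < J%:R :> R by rewrite ltr0n.
have [n [d [H1 H2 H3]]] := critical_sums J aQ.
pose D : R := (2 * (N + n).+1%:R)^-1.
have D0 : 0 < D by rewrite invr_gt0 mulr_gt0// ltr0n.
have Dh : D <= 2^-1 by rewrite lef_pV2 ?posrE ?mulr_gt0 ?ltr0n// ler_peMr// ler1n.
have r01 : 0 < 1 - D < 1 by lra.
exists (1 - D).
  split; last by case/andP: r01.
  case/andP: r01 => _ ->; rewrite andbT lerD2l lerN2 lef_pV2 ?posrE ?mulr_gt0 ?ltr0n//.
  by rewrite -natrM ler_nat (@leq_trans (N + n).+1) ?ltnS ?leq_addr// leq_pmull.
move=> M M0 fM; have tf := has_series_tame af r01.
have B0 : 0 < J%:R * K0' by rewrite mulr_gt0.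
have := holder_mean P1 Q2 PQ Pp M0 B0 tf (tame_trig n id d) (fun t => modulus_ge0 _) fM H3.
have := pairing n d af r01 => /le_trans h /h {h} h.
have low : J%:R * c0 / 2 <= M * (J%:R * K0') `^ Q^-1.
  apply: le_trans h; apply: (@le_trans _ _ (\sum_(i < n) complex.Re (a i * cj (d i)) * 2^-1)).
    by rewrite -mulr_suml ler_wpM2r.
  apply: ler_sum => i _; apply: ler_wpM2l => //.
  apply: le_trans (bernoulli_ge i _); last by rewrite (ltW D0)/=; lra.
  have : i%:R * D <= 2^-1.
    rewrite ler_pdivrMr ?mulr_gt0 ?ltr0n// mulrA mulVf// mul1r ler_nat.
    by rewrite (leq_trans (ltnW (ltn_ord i)))// (leq_trans (leq_addl N n)).
  lra.
have JJ : J%:R = J%:R `^ P^-1 * J%:R `^ Q^-1 :> R by rewrite -powRDp// PQ powRr1// ltW.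
have KQ0 : 0 < K0' `^ Q^-1 by rewrite powR_gt0.
have JQ0 : 0 < J%:R `^ Q^-1 :> R by rewrite powR_gt0.
have JP0 : 0 < J%:R `^ P^-1 :> R by rewrite powR_gt0.
have low2 : J%:R `^ P^-1 * c1 <= M.
  have -> : J%:R `^ P^-1 * c1 = (J%:R `^ P^-1 * (c0 / 2)) / K0' `^ Q^-1 by rewrite /c1; ring.
  rewrite ler_pdivrMr// -(@ler_pM2r _ (J%:R `^ Q^-1))//.
  have -> : J%:R `^ P^-1 * (c0 / 2) * J%:R `^ Q^-1 = J%:R * c0 / 2 by rewrite [in RHS]JJ; ring.
  by rewrite (le_trans low)// powRM ?(ltW K0p) ?(ltW JR)// [_ `^ _ * _ `^ _]mulrC mulrA.
apply: le_trans low2; move: HJ; rewrite powRN -[X in X <= _]mul1r ler_pdivrMr// mulrAC ler_pdivlMr//.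
by rewrite mul1r mulrC.
Qed.

End exponents.
End lower_bounds.

(** * Growth of hypercyclic functions *)

Section mean_growth.
Local Open Scope complex_scope.
Context {R : realType}.
Local Notation C := (Cplx R).

(** The exponent P is min(p, 2).  The last alternative distinguishes the two
constructions of flat polynomials. *)
Lemma conjugate_exponents (p : \bar R) (q : R) : (1 < p)%E -> (p^-1 + q%:E^-1 = 1)%E ->
  exists P : R, [/\ 1 < P, P <= 2, P^-1 + (Num.max 2 q)^-1 = 1, (P%:E <= p)%E &
    Num.max 2 q = 2 \/ p = P%:E].
Proof.
have half : 2^-1 + 2^-1 = 1 :> R by rewrite [RHS]splitr !div1r.
have [->|q0] := eqVneq q 0.
  move=> p1; rewrite inve0 addey//; case: p p1 => [p| |]//= p1.
  by rewrite inver; case: ifP.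
case: p => [p| |]//= p1; last first.
  rewrite invey add0e inver (negbTE q0) => -[q1].
  have -> : q = 1 by rewrite -[q]invrK q1 invr1.
  exists 2; have -> : Num.max 2 1 = 2 :> R by apply/max_idPl; rewrite ler1n.
  by split=> //; rewrite ?ltr1n ?leey//; left.
rewrite lte_fin in p1; have p0 : 0 < p by exact: lt_trans p1.
rewrite !inver (negbTE q0) gt_eqF// -EFinD => -[pq].
have pi0 : 0 < p^-1 by rewrite invr_gt0.
have pi1 : p^-1 < 1 by rewrite invf_lt1.
have qi0 : 0 < q^-1 by lra.
have q00 : 0 < q by rewrite -invr_gt0.
have [q2|q2] := leP q 2.
  exists 2.
  split=> //; rewrite ?ltr1n ?lee_fin//; last by left.
  rewrite -lef_pV2 ?posrE//; have : 2^-1 <= q^-1 by rewrite lef_pV2 ?posrE.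
  lra.
exists p.
split=> //; last by right.
rewrite -lef_pV2 ?posrE//; have : q^-1 <= 2^-1 by rewrite lef_pV2 ?posrE// ltW.
lra.
Qed.

(** Integral means take extended values; lower bounds for them are proved by testing
against all finite upper bounds. *)
Lemma ereal_ge_of_bounds (x : \bar R) (c : R) : 0 < c ->
  (forall M : R, 0 < M -> (x <= M%:E)%E -> c <= M) -> (c%:E <= x)%E.
Proof.
move=> c0 H; rewrite leNgt; apply/negP => xc.
have [M [M0 Mc xM]] : exists M : R, [/\ 0 < M, M < c & (x <= M%:E)%E].
  case: x xc {H} => [x| |]//= xc; last first.
    by exists (c / 2); clear xc; split; [lra|lra|exact: leNye].
  rewrite lte_fin in xc; exists ((Num.max x 0 + c) / 2).
  have m0 : 0 <= Num.max x 0 by rewrite le_max lexx orbT.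
  have mx : x <= Num.max x 0 by rewrite le_max lexx.
  have mc : Num.max x 0 < c by rewrite gt_max xc.
  by split; rewrite ?lee_fin; lra.
by have := H M M0 xM; rewrite leNgt Mc.
Qed.

Lemma limf_esup_left_ge (h : R -> \bar R) (c : \bar R) :
  (forall N, exists2 r : R, 1 - N.+1%:R^-1 <= r < 1 & (c <= h r)%E) ->
  (c <= limf_esup h (1 : R)^'-)%E.
Proof.
move=> H; rewrite limf_esupE; apply: le_ereal_inf_tmp => _ [V + <-].
rewrite /at_left /within/= => /nbhs_ballP[e /= e0 eV].
have [N HN] := nat_large (e^-1 + 1).
have [r /andP[r1 r2] cr] := H N.
have Ne : N.+1%:R^-1 < e.
  have h0 : e^-1 < N.+1%:R by have := HN N.+1 (leqnSn _); lra.
  by rewrite -[e]invrK ltf_pV2 ?posrE ?invr_gt0 ?ltr0n.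
apply: le_trans cr _; apply: ereal_sup_ubound; exists r => //; apply: eV => //.
rewrite /ball/= ger0_norm ?subr_ge0 ?(ltW r2)// (le_lt_trans _ Ne)//.
by rewrite lerBlDr addrC -lerBlDr.
Qed.

Lemma hypercyclic_mean_growth (alpha : R) (p : \bar R) (q : R)
    (hp : (1 < p)%E) (hpq : (p^-1 + q%:E^-1 = 1)%E) (f : C -> C) :
  analytic_disc f -> U_frequently_hypercyclic alpha f ->
     [/\ alpha < (Num.max 2 q)^-1 ->
           (0 < limf_esup (fun r : R =>
                  ((1 - r) `^ ((Num.max 2 q)^-1 - alpha))%:E
                    * integral_mean p f r) (1 : R)^'-)%E,
         alpha = (Num.max 2 q)^-1 ->
           limf_esup (integral_mean p f) (1 : R)^'- = +oo%E &
         (Num.max 2 q)^-1 < alpha ->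
           (0 < limf_esup (integral_mean p f) (1 : R)^'-)%E].
Proof.
move=> fa fh; have [P [P1 P2 PQ Pp _]] := conjugate_exponents hp hpq.
have [a [af [d d0 dense]]] := hypercyclic_large_coefs fa fh.
set Q := Num.max 2 q in PQ *.
have Q2 : 2 <= Q by rewrite le_max lexx.
split.
- move=> _; have [c c0 H] := subcritical_growth P1 Q2 PQ Pp af d0 dense.
  apply: (@lt_le_trans _ _ c%:E); first by rewrite lte_fin.
  apply: limf_esup_left_ge => N; have [r [rN r0] rM] := H N.
  exists r => //; have w0 : 0 < (1 - r) `^ (Q^-1 - alpha).
    by rewrite powR_gt0// subr_gt0; case/andP: rN.
  have -> : c%:E = (((1 - r) `^ (Q^-1 - alpha))%:E * (c / (1 - r) `^ (Q^-1 - alpha))%:E)%E.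
    by rewrite -EFinM mulrCA mulfV ?mulr1// gt_eqF.
  apply: lee_wpmul2l; first by rewrite lee_fin ltW.
  apply: ereal_ge_of_bounds; first by rewrite divr_gt0.
  by move=> M M0 fM; rewrite ler_pdivrMr// mulrC; exact: rM.
- move=> aQ; apply/eqP; rewrite eq_le leey/=.
  suff H K : 0 < K -> (K%:E <= limf_esup (integral_mean p f) (1 : R)^'-)%E.
    move: H; case: (limf_esup _ _) => [x| |]// H; last by have := H 1 ltr01.
    have := H (`|x| + 1) ltac:(by rewrite ltr_wpDl); rewrite lee_fin.
    by move=> h1; exfalso; move: h1 (ler_norm x); clear; lra.
  move=> K0; apply: limf_esup_left_ge => N.
  have [r [rN r0] rM] := critical_unbounded P1 Q2 PQ Pp af d0 dense N aQ K0.
  by exists r => //; exact: ereal_ge_of_bounds.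
- move=> _; have [c c0 H] := supercritical_bound P1 Q2 PQ Pp af d0 dense.
  apply: (@lt_le_trans _ _ c%:E); first by rewrite lte_fin.
  apply: limf_esup_left_ge => N; exists (1 - N.+2%:R^-1).
    rewrite lerD2l lerN2 lef_pV2 ?posrE ?ltr0n// ler_nat leqnSn/=.
    by rewrite ltrBlDr ltrDl invr_gt0.
  apply: ereal_ge_of_bounds => // M M0; apply: H => //.
  rewrite ltrBlDr ltrDl invr_gt0 ltr0n andbT.
  have : N.+2%:R^-1 <= 2^-1 :> R by rewrite lef_pV2 ?posrE ?ltr0n// ler_nat.
  by move: (N.+2%:R^-1) => x; clear; lra.
Qed.

End mean_growth.

(** * Upper bounds for integral means *)

Section bounded_means.
Local Open Scope complex_scope.
Context {R : realType}.
Local Notation C := (Cplx R).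
Implicit Types (x y r s t M B : R) (z w l : C) (a d : nat -> C) (f g : C -> C) (u v : R -> R).

(** The relation M_p(f, r) <= M without the outer root, which spares the manipulation of
extended reals.  It is additive in M ([mean_leD]), as Minkowski's inequality asserts. *)
Definition mean_le (p : \bar R) f r M : Prop := match p with
  | p0%:E => avg (fun t => modulus (f (circle_pt r t)) `^ p0) <= M `^ p0
  | +oo%E => forall t, 0 <= t <= 2 * pi -> modulus (f (circle_pt r t)) <= M
  | -oo%E => False end.

Definition circ_tame f r := tame (fun t => modulus (f (circle_pt r t))).

Lemma integral_mean_le p f r M : (1 < p)%E -> 0 <= M -> circ_tame f r ->
  mean_le p f r M -> (integral_mean p f r <= M%:E)%E.
Proof.
case: p => [p| |]// p1 M0 tf fM; last first.
  by apply: ge_ereal_sup => _ [t /= + <-]; rewrite in_itv/= lee_fin; exact: fM.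
rewrite lte_fin in p1; have p0 : 0 < p by exact: lt_trans p1.
rewrite integral_mean_fin// lee_fin -[leRHS]powRr1// -(mulfV (lt0r_neq0 p0)) powRrM.
by rewrite ge0_ler_powR ?nnegrE ?powR_ge0 ?invr_ge0 ?(ltW p0)//; apply: avg_ge0 => t; exact: powR_ge0.
Qed.

Lemma mean_le_sup p f r M : (1 < p)%E -> 0 <= M -> circ_tame f r ->
  (forall t, modulus (f (circle_pt r t)) <= M) -> mean_le p f r M.
Proof.
case: p => [p| |]// p1 M0 tf fM; last by move=> t _.
rewrite lte_fin in p1; have p0 : 0 <= p by apply: ltW; exact: lt_trans p1.
rewrite /mean_le -[leRHS]avg_cst; apply: avg_le; [|exact: tame_cst|].
  by apply: tame_powR => // t; rewrite modulus_ge0.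
by move=> t _; rewrite ge0_ler_powR ?nnegrE.
Qed.

Lemma mean_le_scale p f g r (k M : R) : (1 < p)%E -> 0 <= k -> 0 <= M -> circ_tame f r -> circ_tame g r ->
  (forall t, modulus (f (circle_pt r t)) <= k * modulus (g (circle_pt r t))) ->
  mean_le p g r M -> mean_le p f r (k * M).
Proof.
case: p => [p| |]// p1 k0 M0 tf tg fg; last first.
  by move=> gM t /gM h; rewrite (le_trans (fg t))// ler_wpM2l.
rewrite lte_fin in p1; have p0 : 0 <= p by apply: ltW; exact: lt_trans p1.
rewrite /mean_le => gM; rewrite powRM//.
have tfp : tame (fun t => modulus (f (circle_pt r t)) `^ p).
  by apply: tame_powR => // t; rewrite modulus_ge0.
have tgp : tame (fun t => modulus (g (circle_pt r t)) `^ p).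
  by apply: tame_powR => // t; rewrite modulus_ge0.
apply: le_trans (ler_wpM2l (powR_ge0 k p) gM); rewrite -avgZ//.
apply: avg_le => //; first exact: tameZ.
by move=> t _; rewrite -powRM// ge0_ler_powR ?nnegrE// mulr_ge0.
Qed.

Lemma mean_le_mono p f r (M M' : R) : (1 < p)%E -> 0 <= M -> M <= M' ->
  mean_le p f r M -> mean_le p f r M'.
Proof.
case: p => [p| |]// p1 M0 MM; last by move=> fM t /fM /le_trans; apply.
rewrite lte_fin in p1; have p0 : 0 <= p by apply: ltW; exact: lt_trans p1.
rewrite /mean_le => /le_trans; apply; rewrite ge0_ler_powR ?nnegrE//; exact: le_trans MM.
Qed.

(** Bernoulli's inequality: the power function lies above its tangent at 1. *)
Lemma powR_bernoulli (p u : R) : 1 < p -> 0 <= u -> p * u <= u `^ p + (p - 1).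
Proof.
move=> p1 u0; have p0 : 0 < p by exact: lt_trans p1.
have pm : 0 < p - 1 by rewrite subr_gt0.
have q0 : 0 < p / (p - 1) by rewrite divr_gt0.
have pq : p^-1 + (p / (p - 1))^-1 = 1.
  by rewrite invf_div mulrBl mul1r mulfV ?gt_eqF// addrC subrK.
have := conjugate_powR u0 ler01 p0 q0 pq.
rewrite mulr1 powR1 mul1r => h; have := ler_wpM2l (ltW p0) h.
rewrite mulrDr mulrCA mulfV ?gt_eqF// mulr1 invf_div mulrCA mulfV ?gt_eqF// mulr1.
exact.
Qed.

(** Convexity of the power function at the weights k and k': with Z the convex
combination of X = x / k and Y = y / k', add the tangent inequalities of
[powR_bernoulli] for X / Z and Y / Z. *)
Lemma powR_convex (p x y k k' : R) : 1 < p -> 0 <= x -> 0 <= y -> 0 < k -> 0 < k' ->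
  (x + y) `^ p <= (k + k') `^ p * (k / (k + k') * (x / k) `^ p + k' / (k + k') * (y / k') `^ p).
Proof.
move=> p1 x0 y0 k0 k'0; have kk : 0 < k + k' by rewrite addr_gt0.
have p0 : 0 < p by exact: lt_trans p1.
have [xy|xy] := eqVneq (x + y) 0.
  by rewrite xy powR0 ?gt_eqF// mulr_ge0 ?powR_ge0// addr_ge0// mulr_ge0 ?powR_ge0// divr_ge0// ?(ltW k0) ?(ltW k'0) ?(ltW kk).
have xy0 : 0 < x + y by rewrite lt_neqAle eq_sym xy addr_ge0.
pose Z := (x + y) / (k + k'); have Z0 : 0 < Z by rewrite divr_gt0.
pose X := x / k; pose Y := y / k'.
have [X0 Y0] : 0 <= X /\ 0 <= Y by rewrite !divr_ge0// ltW.
have -> : (x + y) `^ p = (k + k') `^ p * Z `^ p.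
  by rewrite -powRM ?(ltW kk) ?(ltW Z0)// /Z mulrCA mulfV ?mulr1// gt_eqF.
rewrite ler_wpM2l ?powR_ge0//.
have h1 := powR_bernoulli p1 (divr_ge0 X0 (ltW Z0)).
have h2 := powR_bernoulli p1 (divr_ge0 Y0 (ltW Z0)).
rewrite powR_div// in h1; rewrite powR_div// in h2.
pose th := k / (k + k'); pose th' := k' / (k + k').
have [th0 th'0] : 0 <= th /\ 0 <= th' by rewrite !divr_ge0// ltW.
have th1 : th + th' = 1 by rewrite -mulrDl mulfV// gt_eqF.
have ZE : th * X + th' * Y = Z by rewrite /th /th' /X /Y /Z; field; rewrite !gt_eqF.
have Zp : 0 < Z `^ p by rewrite powR_gt0.
rewrite -/X -/Y -/th -/th' -[leLHS]mul1r -ler_pdivlMr//.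
have H := lerD (ler_wpM2l th0 h1) (ler_wpM2l th'0 h2).
have E1 : th * (p * (X / Z)) + th' * (p * (Y / Z)) = p.
  transitivity (p * ((th * X + th' * Y) / Z)); first by ring.
  by rewrite ZE mulfV ?mulr1// gt_eqF.
rewrite E1 in H.
have E2 : th * (X `^ p / Z `^ p + (p - 1)) + th' * (Y `^ p / Z `^ p + (p - 1)) =
  (th * X `^ p + th' * Y `^ p) / Z `^ p + (th + th') * (p - 1) by ring.
rewrite E2 th1 mul1r in H.
by move: H; set S := _ / _; move=> H; lra.
Qed.

(** Minkowski's inequality with known bounds on the two norms; they serve as the weights
in [powR_convex]. *)
Lemma mean_leD p f g r (k k' : R) : (1 < p)%E -> 0 < k -> 0 < k' -> circ_tame f r -> circ_tame g r ->
  circ_tame (fun z => f z + g z) r ->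
  mean_le p f r k -> mean_le p g r k' -> mean_le p (fun z => f z + g z) r (k + k').
Proof.
case: p => [p| |]// p1 k0 k'0 tf tg tfg; last first.
  by move=> fM gM t tt; rewrite (le_trans (modulusD _ _))// lerD//; [exact: fM|exact: gM].
rewrite lte_fin in p1; have p0 : 0 < p by exact: lt_trans p1.
rewrite /mean_le => fM gM.
have kk : 0 < k + k' by rewrite addr_gt0.
have tfp : tame (fun t => modulus (f (circle_pt r t)) `^ p).
  by apply: tame_powR => [|t|//]; [exact: ltW|exact: modulus_ge0].
have tgp : tame (fun t => modulus (g (circle_pt r t)) `^ p).
  by apply: tame_powR => [|t|//]; [exact: ltW|exact: modulus_ge0].
pose A := k / (k + k') / k `^ p; pose A' := k' / (k + k') / k' `^ p.
apply: (@le_trans _ _ (avg (fun t => (k + k') `^ p * (A * modulus (f (circle_pt r t)) `^ p +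
   A' * modulus (g (circle_pt r t)) `^ p)))).
  apply: avg_le.
  - by apply: tame_powR => [|t|//]; [exact: ltW|exact: modulus_ge0].
  - by apply: tameZ; apply: tameD; exact: tameZ.
  move=> t _; apply: (@le_trans _ _ ((modulus (f (circle_pt r t)) + modulus (g (circle_pt r t))) `^ p)).
    by rewrite ge0_ler_powR ?nnegrE ?(ltW p0) ?addr_ge0// modulusD.
  rewrite (le_trans (powR_convex p1 _ _ k0 k'0))// !powR_div//.
  by rewrite le_eqVlt; apply/orP; left; apply/eqP; rewrite /A /A'; ring.
rewrite avgZ; last by apply: tameD; exact: tameZ.
rewrite -[leRHS]mulr1 ler_wpM2l ?powR_ge0// avgD; [|exact: tameZ|exact: tameZ].
rewrite !avgZ//; have -> : 1 = k / (k + k') + k' / (k + k') :> R.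
  by rewrite -mulrDl mulfV// gt_eqF.
apply: lerD; rewrite /A /A' mulrAC ler_pdivrMr ?powR_gt0// ler_wpM2l// divr_ge0// ltW//.
Qed.

(** Exponential decay beats every power; the bound is stated for the function whose
reciprocal telescopes in [lacunary_pos]. *)
Lemma exp_domination (b : R) : 0 < b -> exists2 D : R, 0 < D &
  forall y, 0 <= y -> (1 + y `^ b) ^+ 2 <= D * expR y.
Proof.
move=> b0; have [n Hn] := nat_large b; have {}Hn := Hn n (leqnn _).
(* 1 + y <= m e^(y/m), raised to the power 2 n < m *)
pose m := (2 * n).+1; have m0 : 0 < m%:R :> R by rewrite ltr0n.
exists (4 * m%:R ^+ (2 * n)) => [|y y0]; first by rewrite mulr_gt0// exprn_gt0.
have y1 : 1 <= 1 + y by rewrite lerDl.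
have h1 : 1 + y `^ b <= 2 * (1 + y) ^+ n.
  have h2 : y `^ b <= (1 + y) ^+ n.
    apply: (@le_trans _ _ ((1 + y) `^ b)).
      by rewrite ge0_ler_powR ?nnegrE ?(ltW b0)// ?lerDr ?ler01// (le_trans ler01 y1).
    by rewrite -powR_mulrn ?(le_trans ler01 y1)// ler_powR.
  have := exprn_ege1 n y1; lra.
have h3 : (1 + y `^ b) ^+ 2 <= 4 * (1 + y) ^+ (2 * n).
  have -> : 4 * (1 + y) ^+ (2 * n) = (2 * (1 + y) ^+ n) ^+ 2.
    by rewrite exprMn [(2 * n)%N]mulnC exprM; congr (_ * _); ring.
  by rewrite lerXn2r// nnegrE ?addr_ge0 ?powR_ge0// mulr_ge0// exprn_ge0// addr_ge0.
rewrite (le_trans h3)// -mulrA ler_wpM2l//.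
have h4 : 1 + y <= m%:R * expR (y / m%:R).
  have := expR_ge1Dx (y / m%:R) => /(ler_wpM2l (ltW m0)).
  rewrite mulrDr mulr1 mulrCA mulfV ?gt_eqF// mulr1; apply: le_trans.
  by rewrite lerD2r ler1n.
have h5 : (1 + y) ^+ (2 * n) <= m%:R ^+ (2 * n) * expR (y / m%:R) ^+ (2 * n).
  by rewrite -exprMn lerXn2r// nnegrE ?addr_ge0// mulr_ge0 ?expR_ge0// ltW.
rewrite (le_trans h5)// ler_wpM2l ?exprn_ge0//.
rewrite -expRM_natl ler_expR mulrCA ler_piMr// ler_pdivrMr// mul1r ler_nat//.
Qed.

(** With v_j = (N_j (1-r))^b, r^(N_j) <= e^(-N_j (1-r)) makes the j-th term at most
D v_j / (1 + v_j)^2, up to the factor (1-r)^b.  As v_j grows geometrically, this is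
at most a constant times the increment from v_j to v_(j+1) of v / (1 + v), a
function bounded by one, so the sum telescopes. *)
Lemma lacunary_pos (b : R) (N : nat -> nat) : 0 < b -> (0 < N 0)%N ->
  (forall j, (4 * N j <= N j.+1)%N) -> exists2 D : R, 0 < D & forall J (r : R), 0 < r < 1 ->
  \sum_(j < J) (N j)%:R `^ b * r ^+ (N j) <= D * (1 - r) `^ (- b).
Proof.
move=> b0 N0 HN; have [D D0 HD] := exp_domination b0.
have Np j : (0 < N j)%N.
  by elim: j => // j IH; rewrite (leq_trans _ (HN j))// muln_gt0.
pose th : R := 4 `^ b; have th1 : 1 < th.
  have e1 : 1 `^ b = 1 :> R by rewrite powR1.
  by rewrite -[ltLHS]e1 /th gt0_ltr_powR ?nnegrE// ltr1n.
pose D' := D * (2 * (1 + th) / (th - 1)).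
have D'0 : 0 < D' by rewrite mulr_gt0// divr_gt0 ?mulr_gt0//; lra.
exists D' => // J r /andP[r0 r1]; pose x := 1 - r.
have x0 : 0 < x by rewrite subr_gt0.
pose v j := ((N j)%:R * x) `^ b.
have Nx j : 0 < (N j)%:R * x by rewrite mulr_gt0// ltr0n.
have v0 j : 0 < v j by rewrite powR_gt0.
pose ph j := v j / (1 + v j).
have vth j : th * v j <= v j.+1.
  rewrite /th /v -powRM ?(ltW (Nx j))// ge0_ler_powR ?nnegrE ?(ltW b0) ?(ltW (Nx _))//.
    by rewrite mulr_ge0// ltW.
  by rewrite mulrA ler_wpM2r ?(ltW x0)// -natrM ler_nat.
have step j : v j * r ^+ N j <= D' * (ph j.+1 - ph j).
  have rN : r ^+ N j <= expR (- ((N j)%:R * x)).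
    rewrite -mulrN expRM_natl lerXn2r ?nnegrE ?(ltW r0) ?expR_ge0//.
    by have := expR_ge1Dx (- x); rewrite /x; lra.
  have A : v j * r ^+ N j <= D * (v j / (1 + v j) ^+ 2).
    rewrite mulrCA ler_wpM2l ?(ltW (v0 j))//.
    have p2 : 0 < (1 + v j) ^+ 2 by rewrite exprn_gt0// ltr_wpDr// ltW.
    rewrite (le_trans rN)// expRN ler_pdivlMr// mulrC ler_pdivrMr ?expR_gt0//.
    exact: HD (ltW (Nx j)).
  rewrite (le_trans A)// /D' -mulrA ler_wpM2l ?(ltW D0)//.
  have th0 : 0 < th - 1 by lra.
  have mono : th * v j / (1 + th * v j) <= ph j.+1.
    rewrite /ph ler_pdivrMr ?addr_gt0 ?mulr_gt0//; last by lra.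
    rewrite mulrAC ler_pdivlMr ?addr_gt0//; have := vth j; nra.
  have : v j / (1 + v j) ^+ 2 <= 2 * (1 + th) / (th - 1) * (th * v j / (1 + th * v j) - ph j).
    have vj := v0 j; rewrite /ph; move: (v j) vj => y y0.
    have ty : 0 < 1 + th * y by rewrite addr_gt0// mulr_gt0//; lra.
    have y1 : 0 < 1 + y by rewrite addr_gt0.
    have -> : 2 * (1 + th) / (th - 1) * (th * y / (1 + th * y) - y / (1 + y)) =
      2 * (1 + th) * y / ((1 + th * y) * (1 + y)).
      by field; rewrite !gt_eqF.
    rewrite ler_pdivrMr ?exprn_gt0// mulrAC ler_pdivlMr ?mulr_gt0//.
    rewrite -subr_ge0.
    have -> : 2 * (1 + th) * y * (1 + y) ^+ 2 - y * ((1 + th * y) * (1 + y)) =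
      (y * (1 + y)) * (1 + 2 * th + 2 * y + th * y) by ring.
    by rewrite mulr_ge0 ?mulr_ge0 ?(ltW y0) ?(ltW y1)//; nra.
  move=> /le_trans; apply; rewrite ler_wpM2l ?lerD2r// divr_ge0 ?mulr_ge0 ?(ltW th0)//; lra.
have xb : 0 < x `^ b by rewrite powR_gt0.
rewrite -/x powRN ler_pdivlMr// mulr_suml.
apply: (@le_trans _ _ (\sum_(j < J) D' * (ph j.+1 - ph j))).
  apply: ler_sum => j _; apply: le_trans (step j).
  by rewrite /v powRM ?(ltW x0)// mulrAC.
rewrite -mulr_sumr -(big_mkord xpredT (fun j => ph j.+1 - ph j)) telescope_sumr//.
rewrite ler_piMr ?(ltW D'0)// lerBlDr ler_wpDr ?divr_ge0 ?(ltW (v0 0%N)) ?addr_ge0 ?(ltW (v0 0%N))//.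
by rewrite ler_pdivrMr ?mul1r ?lerDr// addr_gt0.
Qed.

(** The terms are dominated by a geometric series of ratio 4^b < 1. *)
Lemma lacunary_neg (b : R) (N : nat -> nat) : b < 0 -> (0 < N 0)%N ->
  (forall j, (4 * N j <= N j.+1)%N) -> exists2 D : R, 0 < D & forall J (r : R), 0 < r < 1 ->
  \sum_(j < J) (N j)%:R `^ b * r ^+ (N j) <= D.
Proof.
move=> b0 N0 HN; pose q : R := 4 `^ b.
have q01 : 0 <= q < 1.
  rewrite powR_ge0/= /q -[b]opprK powRN invf_lt1 ?powR_gt0//.
  have e1 : 1 `^ (- b) = 1 :> R by rewrite powR1.
  by rewrite -[ltLHS]e1 gt0_ltr_powR ?nnegrE ?oppr_gt0// ltr1n.
have q1 : 0 < 1 - q by case/andP: q01 => _; rewrite subr_gt0.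
have Nj j : (4 ^ j <= N j)%N.
  by elim: j => // j IH; rewrite expnS (leq_trans _ (HN j))// leq_mul2l IH orbT.
exists (1 / (1 - q)) => [|J r /andP[r0 r1]]; first by rewrite divr_gt0.
apply: le_trans (sum_geo_le J ler01 q01); apply: ler_sum => j _.
rewrite mul1r -[leRHS]mulr1; apply: ler_pM; rewrite ?powR_ge0 ?exprn_ge0 ?(ltW r0)//.
  have p4 : 0 < 4 ^+ j :> R by rewrite exprn_gt0.
  have -> : q ^+ j = (4 ^+ j) `^ b.
    by rewrite /q -powR_mulrn ?powR_ge0// -powRrM mulrC powRrM powR_mulrn.
  rewrite -[b]opprK !(powRN _ (- b)) lef_pV2 ?posrE ?powR_gt0 ?ltr0n ?(leq_trans _ (Nj j)) ?expn_gt0//.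
  rewrite ge0_ler_powR ?nnegrE ?oppr_ge0 ?(ltW b0) ?(ltW p4)//.
  by rewrite -natrX ler_nat.
by rewrite exprn_ile1// ltW.
Qed.

End bounded_means.

(** * Flat polynomials *)

Section flat_polynomials.
Local Open Scope complex_scope.
Context {R : realType}.
Local Notation C := (Cplx R).
Implicit Types (x y r s t M B : R) (z w l : C) (a c e : nat -> C) (f g : C -> C).

(** A polynomial of degree below 3 m in z^d; the spacing leaves room for the
coefficients of a target polynomial between two consecutive powers. *)
Definition spaced m c d : C -> C := fun z => \sum_(i < 3 * m) c i * z ^+ (d * i).

Lemma spaced_trig m c d r t : spaced m c d (circle_pt r t) =
  trig (3 * m) (muln d) (fun i => c i * (r ^+ (d * i))%:C) t.
Proof.
rewrite /spaced /trig; apply: eq_bigr => i _.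
by rewrite circle_ptX circle_pt_real mulrA.
Qed.

Lemma spaced_tame m c d r : circ_tame (spaced m c d) r.
Proof.
rewrite /circ_tame; under eq_fun do rewrite spaced_trig.
exact: tame_trig.
Qed.

Lemma avg_spaced2 m c d r : (0 < d)%N -> 0 < r < 1 -> (forall i, modulus (c i) <= 1) ->
  avg (fun t => modulus (spaced m c d (circle_pt r t)) ^+ 2) <= \sum_(i < 3 * m) (c i != 0)%:R.
Proof.
move=> d0 /andP[r0 r1] c1; under eq_fun do rewrite spaced_trig.
rewrite parseval; last by move=> i j _ _ /eqP; rewrite eqn_pmul2l// => /eqP.
apply: ler_sum => i _; rewrite modulusM modulus_real.
have [->|_] := eqVneq (c i) 0; first by rewrite modulus0 mul0r expr0n.
rewrite expr_le1// ?mulr_ge0// mulr_ile1// ger0_norm ?exprn_ge0 ?(ltW r0)//.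
by rewrite exprn_ile1// ltW.
Qed.

Lemma parallelogram z w : modulus (z + w) ^+ 2 + modulus (z - w) ^+ 2 =
  2 * (modulus z ^+ 2 + modulus w ^+ 2).
Proof. by rewrite !modulus_sqr; case: z => a b; case: w => a' b' /=; ring. Qed.

Definition count_ones c n : nat := (\sum_(i < n) (c i == 1%R))%N.

Lemma count_ones_le c n : (count_ones c n <= n)%N.
Proof. by rewrite -[leqRHS]card_ord -sum1_card; apply: leq_sum => i _; exact: leq_b1. Qed.

Lemma count_ones_cat c n m : count_ones c (n + m) = (count_ones c n + count_ones (fun i => c (n + i)%N) m)%N.
Proof. exact: big_split_ord. Qed.

Lemma eq_count_ones c e n : (forall i, (i < n)%N -> c i = e i) -> count_ones c n = count_ones e n.
Proof. by move=> H; apply: eq_bigr => i _; rewrite H. Qed.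

(** The pair (c, e) of length n becomes (c e, c -e) of length 2n, and the parallelogram
identity doubles the sum of the squared moduli.  The last two clauses, on the numbers
of coefficients equal to 1, are an invariant of the recursion: the values at z = 1 are
(v, v) or (v, 0) with v >= 0, and these two cases alternate. *)
Lemma rudin_shapiro k : exists c e : nat -> C,
  [/\ forall i, modulus (c i) = 1 /\ modulus (e i) = 1,
      forall z, modulus z <= 1 ->
        modulus (\sum_(i < 2 ^ k) c i * z ^+ i) ^+ 2 +
        modulus (\sum_(i < 2 ^ k) e i * z ^+ i) ^+ 2 <= 2 * (2 ^ k)%:R,
      (forall i, c i = 1 \/ c i = -1) /\ (forall i, e i = 1 \/ e i = -1),
      (2 ^ k <= 2 * count_ones c (2 ^ k))%N &
      count_ones e (2 ^ k) = count_ones c (2 ^ k) \/ (2 * count_ones e (2 ^ k) = 2 ^ k)%N].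
Proof.
have N1 : -1 == 1 :> C = false.
  by apply/negbTE; rewrite -subr_eq0 -opprD oppr_eq0 (_ : 1 + 1 = 2%:R)// pnatr_eq0.
elim: k => [|k [c [e [m1 H [c1 e1] hc he]]]].
  exists (fun=> 1), (fun=> 1); split => //.
  - by move=> i; rewrite modulus1.
  - by move=> z _; rewrite !big_ord1 !expr0 mulr1 modulus1 expr1n; lra.
  - by split=> i; left.
  - by rewrite /count_ones big_ord1 eqxx.
  - by left.
pose n := (2 ^ k)%N; have nn : (2 ^ k.+1 = n + n)%N by rewrite expnS mul2n addnn.
pose c' i := if (i < n)%N then c i else e (i - n)%N.
pose e' i := if (i < n)%N then c i else - e (i - n)%N.
have cl (i : 'I_n) : c' i = c i by rewrite /c' ltn_ord.
have el (i : 'I_n) : e' i = c i by rewrite /e' ltn_ord.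
have cr i : c' (n + i)%N = e i by rewrite /c' ltnNge leq_addr/= addKn.
have er i : e' (n + i)%N = - e i by rewrite /e' ltnNge leq_addr/= addKn.
have eneg i : (- e i == 1 = ~~ (e i == 1) :> bool).
  by case: (e1 i) => ->; rewrite ?opprK ?eqxx ?N1.
have Sn : count_ones (fun i => - e i) n = (n - count_ones e n)%N.
  apply/eqP; rewrite -(eqn_add2r (count_ones e n)) subnK ?count_ones_le//.
  rewrite -big_split/= -[X in _ == X]card_ord -sum1_card; apply/eqP; apply: eq_bigr => i _.
  by rewrite eneg; case: (_ == _).
have oc : count_ones c' (n + n) = (count_ones c n + count_ones e n)%N.
  rewrite count_ones_cat; congr (_ + _)%N; apply: eq_count_ones => i ni; first by rewrite /c' ni.
  exact: cr.
have oe : count_ones e' (n + n) = (count_ones c n + (n - count_ones e n))%N.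
  rewrite count_ones_cat -Sn; congr (_ + _)%N; apply: eq_count_ones => i ni; first by rewrite /e' ni.
  exact: er.
have oel := count_ones_le e n.
exists c', e'; rewrite nn; split.
- by move=> i; rewrite /c' /e'; case: ifP => _; rewrite ?modulusN; split; case: (m1 i) (m1 (i - n)%N) => ? ? [? ?].
- move=> z z1; rewrite !big_split_ord/=.
  under eq_bigr do rewrite cl; under [X in modulus (_ + X) ^+ 2 + _]eq_bigr do rewrite cr exprD mulrCA.
  under [X in _ + modulus (X + _) ^+ 2]eq_bigr do rewrite el.
  under [X in _ + modulus (_ + X) ^+ 2]eq_bigr do rewrite er exprD mulrCA mulNr mulrN.
  rewrite sumrN -mulr_sumr parallelogram natrD -mulr2n -[X in _ <= _ * X]mulr_natl ler_wpM2l//.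
  apply: le_trans (H z z1); rewrite lerD2l modulusM modulusX exprMn.
  by rewrite ler_piMl ?sqr_ge0// exprn_ile1 ?exprn_ge0// exprn_ile1.
- split=> i; rewrite /c' /e'; case: ifP => _ //; case: (e1 (i - n)%N) => ->; rewrite ?opprK;
    by [left|right].
- by rewrite oc; move: hc he; rewrite -/n; clear; lia.
- by rewrite oc oe; move: hc he oel; rewrite -/n; clear; lia.
Qed.

(** Coefficients at most one in modulus, at least m/2 of them equal to one, and p-mean of
order m^s, for every m = 2^k.  For s < 1 this is much smaller than the sum of the
coefficients. *)
Definition flat (p : \bar R) s D := forall k, exists c : nat -> C,
  [/\ forall i, (3 * 2 ^ k <= i)%N -> c i = 0, forall i, modulus (c i) <= 1,
      (2 ^ k <= 2 * count_ones c (3 * 2 ^ k))%N &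
      forall d r, (0 < d)%N -> 0 < r < 1 ->
        mean_le p (spaced (2 ^ k) c d) r (D * (2 ^ k)%:R `^ s)].

(** For the Rudin-Shapiro polynomials even the sup norm is of order m^(1/2). *)
Lemma flat_sup p : (1 < p)%E -> flat p 2^-1 2.
Proof.
move=> p1 k; have [c [e [m1 H _ hc _]]] := rudin_shapiro k.
pose n := (2 ^ k)%N; have n3 : (3 * n = n + 2 * n)%N by lia.
pose c' i := if (i < n)%N then c i else 0.
have cl (i : 'I_n) : c' i = c i by rewrite /c' ltn_ord.
have cr i : c' (n + i)%N = 0 by rewrite /c' ltnNge leq_addr.
exists c'; split.
- by move=> i; rewrite -/n /c' => ni; rewrite ltnNge (leq_trans _ ni)//; lia.
- by move=> i; rewrite /c'; case: ifP => _; rewrite ?modulus0// (m1 i).1.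
- rewrite -/n n3 count_ones_cat (@eq_count_ones c' c) => [|i ni]; last by rewrite /c' ni.
  by rewrite (leq_trans hc)// leq_mul2l leq_addr.
move=> d r d0 /andP[r0 r1]; apply: mean_le_sup => //.
- exact: spaced_tame.
move=> t; set z := circle_pt r t.
have -> : spaced (2 ^ k) c' d z = \sum_(i < n) c i * (z ^+ d) ^+ i.
  rewrite /spaced -/n n3 big_split_ord/= [X in _ + X]big1 ?addr0; last first.
    by move=> i _; rewrite cr mul0r.
  by apply: eq_bigr => i _; rewrite cl exprM.
have z1 : modulus (z ^+ d) <= 1.
  by rewrite modulusX modulus_circle gtr0_norm// exprn_ile1// ltW.
have n0 : 0 <= n%:R :> R by [].
rewrite powR12_sqrt// -(@ler_pXn2r _ 2) ?nnegrE ?mulr_ge0 ?sqrtr_ge0//.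
rewrite exprMn sqr_sqrtr//; have := H _ z1; rewrite -/n.
have := sqr_ge0 (modulus (\sum_(i < n) e i * (z ^+ d) ^+ i)); move: n0 => /=; lra.
Qed.

(** The product of the geometric sums of lengths m and 2m, divided by m, has all its
coefficients between m and 2m equal to one.  It has bounded L^1 mean, by the
inequality between arithmetic and geometric means, and mean square at most 3m;
w^P <= m^(P-1) (w + w^2 / m) interpolates. *)
Lemma flat_product (P : R) : 1 < P -> P <= 2 -> flat P%:E (1 - P^-1) 5.
Proof.
move=> P1 P2 k; have : (0 < 2 ^ k)%N by rewrite expn_gt0.
move: (2 ^ k)%N => m m0.
have mR : 0 < m%:R :> R by rewrite ltr0n.
(* m times the i-th coefficient counts the ways to write i as j + l with j < m and
   l < 2 m *)
pose cn i := (\sum_(j < m) ((j <= i) && (i < j + 2 * m)))%N.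
have cnm i : (cn i <= m)%N.
  by rewrite -[leqRHS]card_ord -sum1_card; apply: leq_sum => j _; exact: leq_b1.
pose c i : C := (cn i)%:R / m%:R.
have c1 i : modulus (c i) <= 1.
  by rewrite modulusM modulusV !modulus_nat ler_pdivrMr// mul1r ler_nat.
have mid i : (i < m)%N -> c (m + i)%N = 1.
  move=> im; rewrite /c (_ : cn _ = m) ?mulfV ?pnatr_eq0 -?lt0n//.
  rewrite -[RHS]card_ord -sum1_card; apply: eq_bigr => j _.
  have jm := ltn_ord j; rewrite (leq_trans (ltnW jm) (leq_addr _ _))/=.
  by rewrite (leq_trans (n := m + m))%N ?ltn_add2l// mul2n addnn leq_addl.
have prodE z : \sum_(i < 3 * m) c i * z ^+ i =
    m%:R^-1 * (\sum_(j < m) z ^+ j) * \sum_(l < 2 * m) z ^+ l.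
  rewrite -mulrA mulr_suml mulr_sumr.
  transitivity (\sum_(i < 3 * m) \sum_(j < m) m%:R^-1 * (((j <= i) && (i < j + 2 * m))%N%:R * z ^+ i)).
    apply: eq_bigr => i _; rewrite /c /cn natr_sum !mulr_suml; apply: eq_bigr => j _.
    by rewrite mulrA [m%:R^-1 * _]mulrC.
  rewrite exchange_big; apply: eq_bigr => j _; rewrite -mulr_sumr; congr (_ * _).
  have jm := ltn_ord j.
  rewrite (_ : 3 * m = j + (2 * m + (m - j)))%N; last by lia.
  rewrite big_split_ord/= big1 ?add0r; last first.
    by move=> i _; rewrite leqNgt ltn_ord mul0r.
  rewrite big_split_ord/= [X in _ + X]big1 ?addr0; last first.
    by move=> i _; rewrite ltn_add2l ltnNge !leq_addr/= mul0r.
  rewrite mulr_sumr; apply: eq_bigr => i _.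
  by rewrite leq_addr ltn_add2l ltn_ord mul1r exprD.
exists c; split => //.
- move=> i mi; rewrite /c (_ : cn i = 0%N) ?mul0r//.
  rewrite /cn big1// => j _; have jm := ltn_ord j.
  by rewrite (_ : (i < j + 2 * m)%N = false) ?andbF//; apply/negbTE; rewrite -leqNgt; lia.
- rewrite (_ : 3 * m = m + (m + m))%N; last by lia.
  rewrite !count_ones_cat (_ : count_ones (fun i => c (m + i)%N) m = m).
    by rewrite !mulnDr addnCA (leq_trans (leq_pmull m (ltn0Sn 1)))// leq_addr.
  by rewrite -[RHS]card_ord -sum1_card; apply: eq_bigr => j _; rewrite mid ?eqxx.
move=> d r d0 r01; case/andP: (r01) => r0 r1.
have P0 : 0 < P by exact: lt_trans P1.
pose w t := modulus (spaced m c d (circle_pt r t)).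
have tw : tame w by exact: spaced_tame.
pose sp n t := trig n (muln d) (fun i => 1 * (r ^+ (d * i))%:C) t : C.
have spE n t : sp n t = \sum_(i < n) (circle_pt r t ^+ d) ^+ i.
  rewrite /sp /trig; apply: eq_bigr => i _.
  by rewrite mul1r -exprM circle_ptX [in RHS]circle_pt_real.
have tsp n : tame (fun t => modulus (sp n t)) by exact: tame_trig.
have sp2 n : avg (fun t => modulus (sp n t) ^+ 2) <= n%:R.
  rewrite parseval; last by move=> i j _ _ /eqP; rewrite eqn_pmul2l// => /eqP.
  rewrite -[n in n%:R]card_ord -sum1_card natr_sum; apply: ler_sum => i _.
  rewrite mul1r modulus_real expr_le1// ger0_norm ?exprn_ge0 ?(ltW r0)//.
  by rewrite exprn_ile1// ltW.
have w1 : avg w <= 3 / 2.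
  apply: (@le_trans _ _ (avg (fun t => (2 * m%:R)^-1 * (modulus (sp m t) ^+ 2 + modulus (sp (2 * m) t) ^+ 2)))).
    apply: avg_le => //; first by apply: tameZ; apply: tameD; exact: tameX.
    move=> t _; rewrite /w /spaced; under eq_bigr do rewrite exprM.
    rewrite prodE -!spE !modulusM modulusV modulus_nat.
    move: (modulus (sp m t)) (modulus (sp (2 * m)%N t)) => a b.
    have -> : (2 * m%:R)^-1 = m%:R^-1 / 2 :> R by rewrite invfM mulrC.
    rewrite -!mulrA ler_wpM2l ?invr_ge0//; have := sqr_ge0 (a - b); clear; nra.
  rewrite avgZ; last by apply: tameD; exact: tameX.
  rewrite avgD; [|exact: tameX|exact: tameX].
  rewrite ler_pdivrMl ?mulr_gt0// (le_trans (lerD (sp2 _) (sp2 _)))// natrM; lra.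
have w2 : avg (fun t => w t ^+ 2) <= 3 * m%:R.
  apply: le_trans (avg_spaced2 m d0 r01 c1) _.
  rewrite -natrM -[X in _ <= X%:R]card_ord -sum1_card natr_sum; apply: ler_sum => i _.
  by rewrite ler_nat leq_b1.
rewrite /mean_le -/(w _).
have pw t : w t `^ P <= m%:R `^ (P - 1) * (w t + m%:R^-1 * w t ^+ 2).
  have wt0 : 0 <= w t by exact: modulus_ge0.
  pose u := w t / m%:R; have u0 : 0 <= u by rewrite divr_ge0 ?(ltW mR).
  have -> : w t = m%:R * u by rewrite /u mulrCA mulfV ?mulr1// gt_eqF.
  have mP : m%:R `^ P = m%:R `^ (P - 1) * m%:R.
    by have := powRDp (P - 1) 1 mR; rewrite subrK powRr1 ?(ltW mR).
  rewrite powRM ?(ltW mR)// mP -mulrA ler_wpM2l ?powR_ge0//.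
  have -> : m%:R * u + m%:R^-1 * (m%:R * u) ^+ 2 = m%:R * (u + u ^+ 2) by field; rewrite gt_eqF.
  rewrite ler_wpM2l ?(ltW mR)//.
  have [u1|u1] := lerP u 1.
    have [->|un0] := eqVneq u 0; first by rewrite powR0 ?gt_eqF// expr0n addr0.
    rewrite (@le_trans _ _ u)// ?lerDl ?sqr_ge0// -[leRHS]powRr1//.
    by rewrite ger_powR ?(ltW P1)// u1 andbT lt_neqAle eq_sym un0.
  rewrite (@le_trans _ _ (u ^+ 2))// ?lerDr// -powR_mulrn// ler_powR// ltW//.
apply: (@le_trans _ _ (m%:R `^ (P - 1) * 5)).
  apply: (@le_trans _ _ (avg (fun t => m%:R `^ (P - 1) * (w t + m%:R^-1 * w t ^+ 2)))).
    apply: avg_le => //.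
    - by apply: tame_powR => //; exact: ltW.
    - by apply: tameZ; apply: tameD => //; apply: tameZ; exact: tameX.
    - by move=> t _; exact: pw.
  have t2 : tame (fun t => w t ^+ 2) by exact: tameX.
  rewrite avgZ; last by apply: tameD => //; exact: tameZ.
  rewrite ler_wpM2l ?powR_ge0// avgD//; last exact: tameZ.
  rewrite avgZ//; have : m%:R^-1 * avg (fun t => w t ^+ 2) <= 3.
    by rewrite ler_pdivrMl// mulrC.
  by move=> h; rewrite (le_trans (lerD w1 h))//; clear; lra.
rewrite powRM ?powR_ge0// -powRrM mulrBl mul1r mulVf ?gt_eqF// mulrC.
by rewrite ler_wpM2r ?powR_ge0// -[leLHS]powRr1// ler_powR ?(ltW P1)//; lra.
Qed.

Lemma flat_polynomials (p : \bar R) (q : R) : (1 < p)%E -> (p^-1 + q%:E^-1 = 1)%E ->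
  exists2 D : R, 0 < D & flat p (Num.max 2 q)^-1 D.
Proof.
move=> p1 pq; have [P [P1 P2 PQ _ [->|pP]]] := conjugate_exponents p1 pq.
  by exists 2 => //; exact: flat_sup.
exists 5 => //; rewrite pP (_ : _^-1 = 1 - P^-1); first exact: flat_product.
by rewrite -[in RHS]PQ addrAC subrr add0r.
Qed.

End flat_polynomials.

(** * Parameters attached to a polynomial target *)

Section target_parameters.
Local Open Scope complex_scope.
Context {R : realType}.
Local Notation C := (Cplx R).
Implicit Types (x y r s t M B u : R) (z w l : C) (a b c q : nat -> C).

(** Polynomial factors are absorbed by a slightly larger ratio, one degree at a time:
(k+1) u^(2k) <= u^k (1 + u + ... + u^k) with u^2 the ratio. *)
Lemma poly_geo (A : nat) r : 0 <= r < 1 -> exists t M, [/\ 0 <= t < 1, 0 <= M &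
  forall k, k.+1%:R ^+ A * r ^+ k <= M * t ^+ k].
Proof.
move=> r01; elim: A => [|A [t [M [/andP[t0 t1] M0 H]]]].
  by exists r, 1; split=> // k; rewrite expr0.
have s1 : 0 <= Num.sqrt t < 1.
  by rewrite sqrtr_ge0/= -(sqrtr1 R) ltr_sqrt.
exists (Num.sqrt t), (M * (1 / (1 - Num.sqrt t))); split=> //.
  by rewrite !mulr_ge0// invr_ge0 subr_ge0 ltW//; case/andP: s1.
move=> k; rewrite exprS -mulrA (le_trans (ler_wpM2l _ (H k)))// mulrCA -mulrA ler_wpM2l//.
rewrite -{1}(sqr_sqrtr t0) -exprM mul2n -addnn exprD mulrA ler_wpM2r ?exprn_ge0 ?sqrtr_ge0//.
apply: le_trans (sum_geo_le k.+1 ler01 s1).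
rewrite mulr_natl -[in leLHS](card_ord k.+1) -sumr_const; apply: ler_sum => i _.
rewrite mul1r; case/andP: s1 => u0 u1; apply: ler_wiXn2l => //; [exact: ltW|].
by rewrite -ltnS ltn_ord.
Qed.

Lemma powR_near1 (alpha : R) (A : nat) u : `|alpha| <= A%:R -> 0 <= u <= 1 ->
  `|(1 + u) `^ alpha - 1| <= 2 ^+ A * u.
Proof.
move=> aA /andP[u0 u1]; pose y := 1 + u.
have y1 : 1 <= y by rewrite lerDl.
have y0 : 0 < y by exact: lt_le_trans y1.
have yA : 0 < y ^+ A by rewrite exprn_gt0.
have [a1 a2] : - A%:R <= alpha /\ alpha <= A%:R by apply/andP; rewrite -ler_norml.
have h1 : y `^ alpha <= y ^+ A by rewrite -powR_mulrn ?(ltW y0)// ler_powR.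
have h2 : (y ^+ A)^-1 <= y `^ alpha.
  by rewrite -powR_mulrn ?(ltW y0)// -powRN ler_powR.
have h3 : y ^+ A <= 1 + (2 ^+ A - 1) * u.
  elim: (A) => [|n IH]; first by rewrite !expr0 subrr mul0r addr0.
  have v1 : 1 <= 2 ^+ n :> R by rewrite exprn_ege1// ler1n.
  rewrite exprS exprS; apply: le_trans (ler_wpM2l (ltW y0) IH) _.
  rewrite -subr_ge0 /y; move: (2 ^+ n) v1 => v v1.
  have -> : 1 + (2 * v - 1) * u - (1 + u) * (1 + (v - 1) * u) = (v - 1) * (u * (1 - u)) by ring.
  by rewrite !mulr_ge0 ?subr_ge0.
have h4 : 2 - y ^+ A <= (y ^+ A)^-1.
  rewrite -[leRHS]mul1r ler_pdivlMr//; have := sqr_ge0 (y ^+ A - 1).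
  by move: (y ^+ A) => v; nra.
rewrite ler_norml -/y; move: h1 h2 h3 h4.
move: (y `^ alpha) (y ^+ A) (y ^+ A)^-1 (2 ^+ A) => v1 v2 v3 v4; lra.
Qed.

Lemma sum_divn (n d : nat) (F : nat -> nat -> C) : (0 < d)%N ->
  \sum_(t < n * d) F (t %/ d)%N (t %% d)%N = \sum_(i < n) \sum_(k < d) F i k.
Proof.
move=> d0; elim: n => [|n IH]; first by rewrite mul0n !big_ord0.
rewrite mulSnr big_split_ord/= IH big_ord_recr/=; congr (_ + _).
apply: eq_bigr => k _.
by rewrite divnMDl// modnMDl divn_small ?modn_small ?addn0.
Qed.

(** For a polynomial target q with precision eps on the disc of radius rho, d is the
spacing, beyond which the tail of any series with coefficients at most
O(B (k+1)^A) is negligible on that disc.  The number h, the ratio of the start of a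
block to the length of its flat polynomial, makes the weights within a block nearly
constant (3d/h is small) and absorbs the size B of the target (B <= h^s), so that
the bounds for the block means do not depend on the target. *)
Lemma target_parameters (alpha s : R) (A : nat) q (K : nat) (rho eps : R) :
  (forall k, (K <= k)%N -> q k = 0) -> 0 < s -> `|alpha| <= A%:R -> 0 < rho < 1 -> 0 < eps ->
  exists d h B, [/\ (0 < d)%N /\ (K <= d)%N, (6 * d <= h)%N,
    [/\ 1 <= B, B <= h%:R, B <= h%:R `^ s &
      \sum_(k < d) modulus (q k * (k.+1%:R `^ alpha)%:C) <= B],
    (forall b z l, (forall k, modulus (b k) <= 4 * 2 `^ `|alpha| * B * k.+1%:R ^+ A) ->
      modulus z <= rho -> cvgsum (fun k => b k * z ^+ k) l ->
      modulus (l - \sum_(k < d) b k * z ^+ k) <= eps / 2) &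
    exists2 e, e * \sum_(k < d) modulus (q k) <= eps / 2 &
      forall u, 0 <= u <= 3 * d%:R / h%:R -> `|(1 + u) `^ alpha - 1| <= e].
Proof.
move=> nq s0 aA /andP[r0 r1] e0.
pose v k := modulus (q k * (k.+1%:R `^ alpha)%:C).
pose B := 1 + \sum_(k < K) v k.
have B1 : 1 <= B by rewrite lerDl sumr_ge0// => k _; exact: modulus_ge0.
have B0 : 0 < B by exact: lt_le_trans B1.
have [t [M [t01 M0 HM]]] : exists t M, [/\ 0 <= t < 1, 0 <= M &
  forall k, k.+1%:R ^+ A * rho ^+ k <= M * t ^+ k] by apply: poly_geo; rewrite (ltW r0).
have t1 : 0 < 1 - t by case/andP: t01; rewrite subr_gt0.
pose M' := 4 * 2 `^ `|alpha| * B * M.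
have e2 : 0 < eps / 2 * (1 - t) by rewrite mulr_gt0// divr_gt0.
have [n0 Hn0] := geo_small M' t01 e2.
pose d := (K + n0).+1.
have sumd (F : nat -> R) : (forall k, (K <= k)%N -> F k = 0) ->
    \sum_(k < d) F k = \sum_(k < K) F k.
  move=> F0; rewrite /d -addnS big_split_ord/= [X in _ + X]big1 ?addr0// => i _.
  by rewrite F0// leq_addr.
pose S := \sum_(k < d) modulus (q k).
have S0 : 0 <= S by apply: sumr_ge0 => k _; exact: modulus_ge0.
have [n1 /(_ _ (leqnn _)) Hn1] := nat_large B.
have [n2 /(_ _ (leqnn _)) Hn2] := nat_large (B `^ s^-1).
have [n3 /(_ _ (leqnn _)) Hn3] := nat_large (3 * d%:R * 2 ^+ A * S / (eps / 2)).
pose h := (n1 + n2 + n3 + 6 * d)%N.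
have h0 : 0 < h%:R :> R by rewrite ltr0n /h /d addn_gt0 muln_gt0 orbT.
have n1h : n1%:R <= h%:R :> R by rewrite ler_nat /h -!addnA leq_addr.
have n2h : n2%:R <= h%:R :> R by rewrite ler_nat /h (addnC n1) -!addnA leq_addr.
have n3h : n3%:R <= h%:R :> R by rewrite ler_nat /h (addnC _ n3) -!addnA leq_addr.
exists d, h, B; split.
- by rewrite /d ltnS leqW// leq_addr.
- exact: leq_addl.
- split=> //; first exact: le_trans n1h.
    have -> : B = (B `^ s^-1) `^ s by rewrite -powRrM mulVf ?gt_eqF// powRr1// ltW.
    rewrite ge0_ler_powR ?nnegrE ?powR_ge0 ?(ltW s0) ?(ltW h0)//.
    exact: le_trans n2h.
  by rewrite (sumd v) ?lerDr// => k /nq; rewrite /v => ->; rewrite mul0r modulus0.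
- move=> b z l Hb zr cl.
  have bz k : modulus (b k * z ^+ k) <= M' * t ^+ k.
    rewrite modulusM modulusX /M' -mulrA.
    apply: (@le_trans _ _ (4 * 2 `^ `|alpha| * B * k.+1%:R ^+ A * rho ^+ k)).
      apply: ler_pM => //; first by rewrite exprn_ge0.
      by rewrite lerXn2r// nnegrE ?(ltW r0).
    by rewrite -!mulrA !ler_wpM2l ?powR_ge0 ?(ltW B0)// HM.
  apply: le_trans (cvgsum_geo_tail d t01 bz cl) _.
  by rewrite ler_pdivrMr// ltW// Hn0// /d leqW// leq_addl.
exists (2 ^+ A * (3 * d%:R / h%:R)).
  have -> : 2 ^+ A * (3 * d%:R / h%:R) * S = (3 * d%:R * 2 ^+ A * S) / h%:R by ring.
  have := le_trans Hn3 n3h; rewrite ler_pdivrMr ?divr_gt0// ler_pdivrMr//.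
  by rewrite [eps / 2 * _]mulrC.
move=> u /andP[u0 uh].
have d6 : 6 * d%:R <= h%:R :> R by rewrite -natrM ler_nat leq_addl.
have u1 : u <= 1.
  apply: le_trans uh _; rewrite ler_pdivrMr// mul1r; have : 0 <= d%:R :> R by [].
  by move: d6; clear; lra.
have uu : 0 <= u <= 1 by rewrite u0.
by apply: le_trans (powR_near1 aA uu) _; rewrite ler_wpM2l// exprn_ge0.
Qed.

End target_parameters.

(** * The block series *)

Section block_construction.
Local Open Scope complex_scope.
Context {R : realType}.
Local Notation C := (Cplx R).
Implicit Types (x j J n i k : nat) (z w l : C) (r : R).

Context (alpha s C0 : R) (A : nat) (p : \bar R) (q : nat -> nat -> C) (rho eps : nat -> R)
  (d h : nat -> nat) (B : nat -> R) (c : nat -> nat -> C).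

Context (p1 : (1 < p)%E) (C0_gt0 : 0 < C0) (aA : `|alpha| + 1 <= A%:R)
  (d0 : forall x, (0 < d x)%N) (hd : forall x, (6 * d x <= h x)%N)
  (B1 : forall x, 1 <= B x) (Bh : forall x, B x <= (h x)%:R) (Bs : forall x, B x <= (h x)%:R `^ s)
  (qB : forall x, \sum_(k < d x) modulus (q x k * (k.+1%:R `^ alpha)%:C) <= B x)
  (Htail : forall x b z l,
      (forall k, modulus (b k) <= 4 * 2 `^ `|alpha| * B x * k.+1%:R ^+ A) ->
      modulus z <= rho x -> cvgsum (fun k => b k * z ^+ k) l ->
      modulus (l - \sum_(k < d x) b k * z ^+ k) <= eps x / 2)
  (Hnear : forall x, exists2 e, e * \sum_(k < d x) modulus (q x k) <= eps x / 2 &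
      forall u, 0 <= u <= 3 * (d x)%:R / (h x)%:R -> `|(1 + u) `^ alpha - 1| <= e)
  (rho1 : forall x, 0 < rho x < 1)
  (c0 : forall k i, (3 * 2 ^ k <= i)%N -> c k i = 0) (c1 : forall k i, modulus (c k i) <= 1)
  (cones : forall k, (2 ^ k <= 2 * count_ones (c k) (3 * 2 ^ k))%N)
  (cflat : forall k d' r, (0 < d')%N -> 0 < r < 1 ->
        mean_le p (spaced (2 ^ k) (c k) d') r (C0 * (2 ^ k)%:R `^ s)).

(** The exponent of 2 in j takes every natural value infinitely often. *)
Definition target_of j := logn 2 j.
(** Block j uses a flat polynomial of length comparable to len j = 2^level j and occupies
the degrees from start j to 2 start j.  Adding h at each step makes the sequence
start lacunary. *)
Definition level j : nat := (\sum_(i < j) (2 + h (target_of i)))%N.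
Definition len j : nat := (2 ^ level j)%N.
Definition start j : nat := (len j * h (target_of j))%N.
Definition weighted_target x k : C := q x k * (k.+1%:R `^ alpha)%:C.
(** The degree start j + d i + k carries the product of the i-th coefficient of the flat
polynomial and of the k-th weighted coefficient of the target. *)
Definition block_coef j n : C := if (start j <= n)%N then
  ((start j)%:R `^ (- alpha))%:C *
    (c (level j) ((n - start j) %/ d (target_of j))%N * weighted_target (target_of j) ((n - start j) %% d (target_of j))%N)
  else 0.
(** Since j < start j, only blocks with j <= n reach the degree n. *)
Definition series_coef n : C := \sum_(j < n.+1) block_coef j n.

Lemma h_gt0 x : (0 < h x)%N.
Proof. by rewrite (leq_trans _ (hd x))// muln_gt0 d0. Qed.

Lemma len_gt0 j : (0 < len j)%N.
Proof. by rewrite expn_gt0. Qed.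

Lemma start_gt0 j : (0 < start j)%N.
Proof. by rewrite muln_gt0 len_gt0 h_gt0. Qed.

Lemma start_4 j : (4 * start j <= start j.+1)%N.
Proof.
rewrite /start /len /level big_ord_recr/= !expnD.
have h1 : (h (target_of j) < 2 ^ h (target_of j))%N by exact: ltn_expl.
have h2 := h_gt0 (target_of j.+1); set a := (2 ^ _)%N; set b := (2 ^ h _)%N.
have : (h (target_of j) <= b * h (target_of j.+1))%N.
  by rewrite (leq_trans (ltnW h1))// leq_pmulr.
move=> H; rewrite mulnCA -!mulnA leq_mul2l; apply/orP; right.
by rewrite !mulnA -mulnA leq_mul2l.
Qed.

Lemma start_ge j : (4 ^ j <= start j)%N.
Proof.
elim: j => [|j IH]; first exact: start_gt0.
by rewrite expnS (leq_trans _ (start_4 j))// leq_mul2l IH orbT.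
Qed.

Lemma start_lt i j : (i < j)%N -> (4 * start i <= start j)%N.
Proof.
elim: j => // j IH; rewrite ltnS leq_eqVlt => /orP[/eqP->|/IH H]; first exact: start_4.
by rewrite (leq_trans H)// (leq_trans _ (start_4 j))// leq_pmull.
Qed.

Lemma j_lt_start j : (j < start j)%N.
Proof. by rewrite (leq_trans _ (start_ge j))// ltn_expl. Qed.

Lemma start_dm j : (6 * (len j * d (target_of j)) <= start j)%N.
Proof. by rewrite mulnCA leq_mul2l hd orbT. Qed.

Lemma block_coef_small j n : (n < start j)%N -> block_coef j n = 0.
Proof. by rewrite /block_coef ltnNge => /negbTE ->. Qed.

Lemma block_coef_large j n : (2 * start j <= n)%N -> block_coef j n = 0.
Proof.
move=> jn; rewrite /block_coef; case: ifP => // sn.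
rewrite (_ : c _ _ = 0) ?mul0r ?mulr0//; apply: c0.
rewrite leq_divRL// -/(len j); have := start_dm j; rewrite -mulnA.
move: (len j * d (target_of j))%N => a; move: jn; clear; lia.
Qed.

Lemma weighted_target_le x k : (k < d x)%N -> modulus (weighted_target x k) <= B x.
Proof.
move=> kd; apply: le_trans (qB x); rewrite (bigD1 (Ordinal kd))//= lerDl.
by apply: sumr_ge0 => i _; exact: modulus_ge0.
Qed.

Lemma block_coef_le j n : modulus (block_coef j n) <= (start j)%:R `^ (- alpha) * B (target_of j).
Proof.
have B0 x : 0 <= B x by rewrite (le_trans ler01).
rewrite /block_coef; case: ifP => _; last by rewrite modulus0 mulr_ge0 ?powR_ge0.
rewrite modulusM modulus_real ger0_norm ?powR_ge0// ler_wpM2l ?powR_ge0//.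
by rewrite modulusM -[leRHS]mul1r ler_pM// weighted_target_le// ltn_pmod.
Qed.

Lemma series_coef_lt J n : (n < start J)%N -> series_coef n = \sum_(j < J) block_coef j n.
Proof.
move=> nJ.
have stable i k : (i <= k)%N -> (n < start i)%N -> \sum_(j < k) block_coef j n = \sum_(j < i) block_coef j n.
  move=> ik ni; rewrite -(subnKC ik) big_split_ord/= [X in _ + X]big1 ?addr0// => j _.
  apply: block_coef_small; case: (posnP j) => [->|j0]; first by rewrite addn0.
  rewrite (leq_trans ni)// (leq_trans (leq_pmull _ (ltn0Sn 3)))// start_lt//.
  by rewrite -{1}(addn0 i) ltn_add2l.
rewrite /series_coef -(@stable _ (maxn n.+1 J)) ?leq_maxl//.
  by apply: stable => //; exact: leq_maxr.
by rewrite (leq_trans _ (j_lt_start n.+1))// ltnW.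
Qed.

Lemma series_coef_block J n : (start J <= n < 2 * start J)%N -> series_coef n = block_coef J n.
Proof.
move=> /andP[n1 n2]; rewrite (@series_coef_lt J.+1).
  rewrite big_ord_recr/= big1 ?add0r// => j _; apply: block_coef_large.
  rewrite (leq_trans _ n1)// (leq_trans _ (start_lt (ltn_ord j)))// leq_mul2r orbT//.
by rewrite (leq_trans n2)// (leq_trans _ (start_4 J))// leq_mul2r orbT.
Qed.

Lemma series_coef_cases n : series_coef n = 0 \/ exists J, (start J <= n < 2 * start J)%N.
Proof.
have [[J nJ]|H] := pselect (exists J, (start J <= n < 2 * start J)%N).
  by right; exists J.
left; rewrite /series_coef big1// => j _.
have [nj|jn] := ltnP n (start j); first exact: block_coef_small.
apply: block_coef_large; rewrite leqNgt; apply/negP => nj; apply: H; exists (nat_of_ord j).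
by rewrite jn.
Qed.

Lemma one_sub_alpha_le : 1 - alpha <= A%:R.
Proof. by rewrite (le_trans _ aA)// addrC lerD2r -normrN ler_norm. Qed.

Lemma series_coef_weight J n : (start J <= n < 2 * start J)%N ->
  modulus (series_coef n) * n.+1%:R `^ alpha <= 2 `^ `|alpha| * B (target_of J).
Proof.
move=> nJ; rewrite (series_coef_block nJ); case/andP: nJ => n1 n2.
have N0 : 0 < (start J)%:R :> R by rewrite ltr0n start_gt0.
have B0 : 0 <= B (target_of J) by rewrite (le_trans ler01).
have w : n.+1%:R `^ alpha <= 2 `^ `|alpha| * (start J)%:R `^ alpha.
  rewrite -ler_pdivrMr ?powR_gt0// -powR_div//; apply: powR_absr_le.
  rewrite ler_pdivlMr// mul1r ler_pdivrMr// -natrM !ler_nat.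
  by rewrite (leq_trans n1)//=.
apply: le_trans (ler_pM (modulus_ge0 _) (powR_ge0 _ _) (block_coef_le J n) w) _.
rewrite powRN le_eqVlt; apply/orP; left; apply/eqP; field.
by rewrite gt_eqF// powR_gt0.
Qed.

(** The size B of the target met at degree n is at most h, hence at most the start of its
block, which is at most n: the bound no longer refers to the target. *)
Lemma series_coef_weight_le n : modulus (series_coef n) * n.+1%:R `^ alpha <= 2 `^ `|alpha| * n.+1%:R.
Proof.
have [->|[J nJ]] := series_coef_cases n; first by rewrite modulus0 mul0r mulr_ge0// powR_ge0.
apply: le_trans (series_coef_weight nJ) _; rewrite ler_wpM2l ?powR_ge0//.
apply: le_trans (Bh _) _; rewrite ler_nat; case/andP: nJ => n1 _.
by rewrite ltnW// ltnS (leq_trans _ n1)// leq_pmull// len_gt0.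
Qed.

Definition block_sum := power_sum series_coef.

Lemma has_series_block_sum : has_series series_coef block_sum.
Proof.
apply: has_series_power_sum => r /andP[r0 r1].
have r01 : 0 <= r < 1 by rewrite (ltW r0).
have [t [M [/andP[t0 t1] M0 HM]]] := poly_geo A r01.
exists (2 `^ `|alpha| * M) => k.
have k0 : 0 < k.+1%:R :> R by rewrite ltr0n.
have a1 := one_sub_alpha_le.
have h1 : modulus (series_coef k) <= 2 `^ `|alpha| * k.+1%:R ^+ A.
  rewrite -(ler_pM2r (powR_gt0 alpha k0)) (le_trans (series_coef_weight_le k))//.
  rewrite -mulrA ler_wpM2l ?powR_ge0// -powR_mulrn// -powRDp//.
  rewrite -[leLHS]powRr1// ler_powR ?ler1n// -lerBlDr//.
apply: le_trans (ler_wpM2r (exprn_ge0 k (ltW r0)) h1) _.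
rewrite -mulrA ler_wpM2l ?powR_ge0// (le_trans (HM k))// ler_piMr//.
by rewrite exprn_ile1// ltW.
Qed.

(** Write n = start J + d i.  The first d coefficients of T^n f are those of q multiplied
by (1 + u)^alpha with 0 <= u <= 3d/h.  The later ones are O((k+1)^A): within the
block because of the weight, and beyond it because there k is comparable to n. *)
Lemma shift_near J i z : (i < 3 * len J)%N -> c (level J) i = 1 -> modulus z <= rho (target_of J) ->
  modulus (iter (start J + d (target_of J) * i)%N (taylor_shift alpha) block_sum z -
    \sum_(k < d (target_of J)) q (target_of J) k * z ^+ k) <= eps (target_of J).
Proof.
move=> im ci zr; pose x := target_of J; pose N := start J.
rewrite -/x -/N; pose n := (N + d x * i)%N.
have N0 : 0 < N%:R :> R by rewrite ltr0n start_gt0.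
have di : (2 * (d x * i.+1) <= N)%N.
  apply: leq_trans (start_dm J); rewrite -(mulnA 2 3) leq_mul2l/= mulnA mulnC leq_mul2r.
  by rewrite im orbT.
have diS : (d x * i.+1 = d x * i + d x)%N by rewrite mulnS addnC.
pose b := shift_coef alpha n series_coef.
have bE k : b k = series_coef (n + k)%N * (((n + k).+1%:R / k.+1%:R) `^ alpha)%:C by [].
have z1 : modulus z < 1 by case/andP: (rho1 x) => _; apply: le_lt_trans.
have cl := iter_shift_series alpha n has_series_block_sum z1; rewrite -/b in cl.
have a1 := one_sub_alpha_le.
have B0 : 0 <= B x by rewrite (le_trans ler01).
have Hb k : modulus (b k) <= 4 * 2 `^ `|alpha| * B x * k.+1%:R ^+ A.
  have k0 : 0 < k.+1%:R :> R by rewrite ltr0n.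
  rewrite bE modulusM modulus_real ger0_norm ?powR_ge0// powR_div// mulrA.
  rewrite ler_pdivrMr ?powR_gt0//.
  (* past the end of the block, n + k + 1 <= 4 (k + 1) *)
  have H1 : modulus (series_coef (n + k)) * (n + k).+1%:R `^ alpha <= 4 * 2 `^ `|alpha| * B x * k.+1%:R.
    have K1 : 1 <= k.+1%:R :> R by rewrite ler1n.
    have [nk|nk] := ltnP (n + k) (2 * N).
      have nk' : (start J <= n + k < 2 * start J)%N by rewrite nk andbT /n -addnA leq_addr.
      apply: le_trans (series_coef_weight nk') _; rewrite -/x -[leLHS]mulr1.
      apply: ler_pM => //; rewrite ?mulr_ge0 ?powR_ge0//.
      by rewrite -mulrA ler_peMl ?mulr_ge0 ?powR_ge0// ler1n.
    apply: le_trans (series_coef_weight_le _) _.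
    rewrite [4 * _]mulrC -!mulrA ler_wpM2l ?powR_ge0//.
    have nk4 : ((n + k).+1 <= 4 * k.+1)%N.
      by move: nk di diS; rewrite /n /N; move: (d x * i.+1)%N (d x * i)%N (d x) (start J); clear; lia.
    have nk4R : (n + k).+1%:R <= 4 * k.+1%:R :> R by rewrite -natrM ler_nat.
    apply: le_trans nk4R _; rewrite ler_wpM2l// ler_peMl//.
  apply: le_trans H1 _; rewrite -[leRHS]mulrA ler_wpM2l ?mulr_ge0 ?powR_ge0//.
  rewrite -powR_mulrn ?(ltW k0)// -powRDp// -[leLHS]powRr1 ?(ltW k0)// ler_powR ?ler1n// -lerBlDr//.
have T1 := Htail Hb zr cl.
have [e He1 He2] := Hnear x.
have bk k : (k < d x)%N -> modulus (b k - q x k) <= e * modulus (q x k).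
  move=> kd; have k0 : 0 < k.+1%:R :> R by rewrite ltr0n.
  have nk : (start J <= n + k < 2 * start J)%N.
    move: di diS; move: kd; rewrite /n /N; move: (d x * i.+1)%N (d x * i)%N (d x) (start J); clear; lia.
  (* n + k + 1 = N (1 + u), and the two factors (k + 1)^alpha cancel *)
  pose u : R := (d x * i + k).+1%:R / N%:R.
  have uE : (n + k).+1%:R = N%:R * (1 + u).
    rewrite mulrDr mulr1 /u mulrCA mulfV ?mulr1 ?gt_eqF// -natrD; congr (_%:R).
    by rewrite /n -addnA addnS.
  have u0 : 0 <= u by rewrite divr_ge0// ltW.
  have u01 : 0 <= u <= 3 * (d x)%:R / (h x)%:R.
    rewrite u0/= /u /N /start -/x ler_pdivrMr ?ltr0n ?muln_gt0 ?len_gt0 ?h_gt0//.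
    have -> : 3 * (d x)%:R / (h x)%:R * (len J * h x)%:R = (d x * (3 * len J))%:R :> R.
      by rewrite !natrM; field; rewrite pnatr_eq0 -lt0n h_gt0.
    rewrite ler_nat (@leq_trans (d x * i.+1))// ?leq_mul2l ?im ?orbT//.
    by rewrite mulnS [(d x + _)%N]addnC ltn_add2l.
  have -> : b k - q x k = q x k * (((1 + u) `^ alpha)%:C - 1).
    rewrite mulrBr mulr1; congr (_ - _); rewrite bE (series_coef_block nk) /block_coef.
    rewrite (_ : start J <= n + k)%N; last by case/andP: nk.
    have -> : (n + k - start J = i * d x + k)%N by rewrite /n -/N -addnA addKn mulnC.
    rewrite divnMDl// modnMDl divn_small// modn_small// addn0 ci mul1r /weighted_target -/x.
    rewrite uE powR_div ?mulr_ge0 ?addr_ge0 ?(ltW N0)// powRM ?addr_ge0 ?(ltW N0)// powRN.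
    rewrite mulrCA -!mulrA; congr (_ * _); rewrite -!rmorphM/=; congr (_%:C).
    rewrite -/N; field.
    by rewrite !gt_eqF ?powR_gt0.
  rewrite modulusM mulrC ler_wpM2r// (_ : _ - 1 = ((1 + u) `^ alpha - 1)%:C).
    by rewrite modulus_real He2.
  by rewrite rmorphB/= rmorph1.
rewrite -(subrK (\sum_(k < d x) b k * z ^+ k) (iter _ _ _ _)) -addrA.
rewrite (le_trans (modulusD _ _))// [leRHS](splitr (eps x)) lerD//.
apply: le_trans He1; rewrite -sumrB mulr_sumr (le_trans (modulus_sum _ _ _))// ler_sum// => k _.
rewrite -mulrBl modulusM modulusX -[leRHS]mulr1 ler_pM ?exprn_ge0//; first exact: bk.
by rewrite exprn_ile1// ltW.
Qed.

(** Among the first 2 start J integers there are at least len J / 2 good times, and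
start J = h len J. *)
Lemma good_density x (G : set nat) :
  (forall J i, target_of J = x -> (i < 3 * len J)%N -> c (level J) i = 1 ->
     G (start J + d x * i)%N) ->
  forall N, exists2 n, (N <= n)%N &
    (4 * (h x)%:R)^-1 * n%:R <= (count (mem G) (iota 1 n))%:R :> R.
Proof.
move=> HG N; pose J := (2 ^ x * (2 * N).+1)%N.
have sJ : target_of J = x.
  rewrite /target_of /J lognM ?expn_gt0// pfactorK// [X in (_ + X)%N](_ : _ = 0%N) ?addn0//.
  by apply: logn_coprime; rewrite coprime2n /= mul2n odd_double.
have NJ : (N <= start J)%N.
  rewrite (leq_trans _ (ltnW (j_lt_start J)))// (leq_trans _ (leq_pmull _ _)) ?expn_gt0//.
  by rewrite leqW// mul2n -addnn leq_addr.
exists (2 * start J)%N; first by rewrite (leq_trans NJ)// leq_pmull.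
have hx : 0 < (h x)%:R :> R by rewrite ltr0n h_gt0.
rewrite natrM /start sJ natrM.
have -> : (4 * (h x)%:R)^-1 * (2 * ((len J)%:R * (h x)%:R)) = (len J)%:R / 2 :> R.
  by field; rewrite gt_eqF.
rewrite ler_pdivrMr// mulrC -natrM ler_nat.
apply: leq_trans (cones _) _; rewrite leq_mul2l/=.
have -> : count_ones (c (level J)) (3 * 2 ^ level J) =
    count (fun i => c (level J) i == 1) (iota 0 (3 * len J)).
  rewrite -sum1_count big_mkcond /count_ones -/(len J).
  rewrite -(big_mkord xpredT (fun i => nat_of_bool (c (level J) i == 1))) /index_iota subn0.
  by apply: eq_bigr => i _; case: eqP.
rewrite -!size_filter -(size_map (fun i => (start J + d x * i)%N)).
apply: uniq_leq_size.
  rewrite map_inj_uniq ?filter_uniq ?iota_uniq// => i j /addnI/eqP.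
  by rewrite eqn_pmul2l// => /eqP.
move=> _ /mapP[i + ->]; rewrite mem_filter mem_iota/= add0n => /andP[/eqP ci im].
rewrite mem_filter; apply/andP; split.
  by change ((start J + d x * i)%N \in G); apply/mem_set; exact: HG.
rewrite mem_iota add1n ltnS (leq_trans (start_gt0 J)) ?leq_addr//=.
have := start_dm J; rewrite sJ => H.
have sE : start J = (len J * h x)%N by rewrite /start sJ.
rewrite -sE mul2n -addnn leq_add2l (leq_trans _ H)//.
rewrite mulnC (mulnA 6) leq_mul2r (leq_trans (ltnW im)) ?orbT// leq_mul2r orbT//.
Qed.

Lemma has_series_poly (a : nat -> C) n :
  has_series (fun k => if (k < n)%N then a k else 0) (fun z => \sum_(k < n) a k * z ^+ k).
Proof.
move=> z _; have := @cvgsum_fin R n (fun k => (if (k < n)%N then a k else 0) * z ^+ k).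
under [X in cvgsum _ X]eq_bigr do rewrite ltn_ord.
by apply=> k nk; rewrite ltnNge nk mul0r.
Qed.

Definition block j : C -> C := fun z => \sum_(n < 2 * start j) block_coef j n * z ^+ n.

Lemma block_trunc j n z : (2 * start j <= n)%N -> \sum_(k < n) block_coef j k * z ^+ k = block j z.
Proof.
move=> jn; rewrite -(subnKC jn) big_split_ord/= [X in _ + X]big1 ?addr0// => i _.
by rewrite block_coef_large ?mul0r// leq_addr.
Qed.

Lemma partial_blocks J z : \sum_(k < start J) series_coef k * z ^+ k = \sum_(j < J) block j z.
Proof.
transitivity (\sum_(k < start J) \sum_(j < J) block_coef j k * z ^+ k).
  by apply: eq_bigr => k _; rewrite (@series_coef_lt J) ?mulr_suml.
rewrite exchange_big; apply: eq_bigr => j _; apply: block_trunc.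
by rewrite (leq_trans _ (start_lt (ltn_ord j)))// leq_mul2r orbT.
Qed.

Lemma blockE j z : block j z = ((start j)%:R `^ (- alpha))%:C * z ^+ start j *
  (spaced (len j) (c (level j)) (d (target_of j)) z * \sum_(k < d (target_of j)) weighted_target (target_of j) k * z ^+ k).
Proof.
rewrite /block mul2n -addnn big_split_ord/= big1 ?add0r; last first.
  by move=> i _; rewrite block_coef_small ?mul0r.
set N := start j; set x := target_of j.
have dm : (3 * len j * d x <= N)%N.
  by apply: leq_trans (start_dm j); rewrite -mulnA leq_mul2r orbT.
transitivity (\sum_(t < N) (N%:R `^ (- alpha))%:C * z ^+ N *
   (c (level j) (t %/ d x)%N * weighted_target x (t %% d x)%N * z ^+ (t %/ d x * d x + t %% d x)%N)).
  apply: eq_bigr => t _; rewrite -divn_eq exprD /block_coef leq_addr addKn -/N -/x; ring.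
rewrite -mulr_sumr; congr (_ * _).
rewrite -(subnKC dm) big_split_ord/= [X in _ + X]big1 ?addr0; last first.
  move=> i _; rewrite (_ : c _ _ = 0) ?mul0r//; apply: c0.
  by rewrite leq_divRL// leq_addr.
rewrite (sum_divn _ (fun i k => c (level j) i * weighted_target x k * z ^+ (i * d x + k)))//.
rewrite /spaced mulr_suml; apply: eq_bigr => i _; rewrite mulr_sumr; apply: eq_bigr => k _.
by rewrite exprD [(i * _)%N]mulnC; ring.
Qed.

Lemma block_tame j r : 0 < r < 1 -> circ_tame (block j) r.
Proof. by move=> r01; apply: has_series_tame r01; exact: has_series_poly. Qed.

(** Apart from the flat polynomial, a block has modulus at most start^(-alpha) r^start B;
B <= h^s completes len^s to start^s. *)
Lemma block_mean j r : 0 < r < 1 ->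
  mean_le p (block j) r (C0 * ((start j)%:R `^ (s - alpha) * r ^+ start j)).
Proof.
move=> r01; case/andP: (r01) => r0 r1; set N := start j; set x := target_of j.
have B0 : 0 <= B x by rewrite (le_trans ler01).
have N0 : 0 < N%:R :> R by rewrite ltr0n start_gt0.
pose k : R := N%:R `^ (- alpha) * r ^+ N * B x.
have k0 : 0 <= k by rewrite !mulr_ge0 ?powR_ge0 ?exprn_ge0// ltW.
have M0 : 0 <= C0 * (len j)%:R `^ s by rewrite mulr_ge0 ?powR_ge0// ltW.
have H : mean_le p (block j) r (k * (C0 * (len j)%:R `^ s)).
  apply: mean_le_scale (cflat _ (d0 x) r01) => //; [exact: block_tame|exact: spaced_tame|].
  move=> t; rewrite blockE -/N -/x !modulusM modulus_real ger0_norm ?powR_ge0//.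
  rewrite modulusX modulus_circle gtr0_norm// /k -/(len j).
  rewrite -!mulrA !ler_wpM2l ?powR_ge0 ?exprn_ge0 ?(ltW r0)//.
  rewrite [leRHS]mulrC ler_wpM2l//; apply: le_trans (qB x).
  apply: le_trans (modulus_sum _ _ _) _; apply: ler_sum => i _.
  rewrite modulusM modulusX modulus_circle gtr0_norm// ler_piMr//.
  by rewrite exprn_ile1// ltW.
apply: mean_le_mono H => //; first exact: mulr_ge0.
rewrite mulrCA ler_wpM2l ?(ltW C0_gt0)// /k addrC powRDp// -!mulrA ler_wpM2l ?powR_ge0//.
rewrite [leRHS]mulrC ler_wpM2l ?exprn_ge0 ?(ltW r0)//.
rewrite /N /start natrM powRM// mulrC ler_wpM2l ?powR_ge0//.
Qed.

Lemma blocks_mean J r : 0 < r < 1 ->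
  mean_le p (fun z => \sum_(j < J) block j z) r
    (1 + C0 * \sum_(j < J) (start j)%:R `^ (s - alpha) * r ^+ start j).
Proof.
move=> r01; case/andP: (r01) => r0 r1.
have tJ k : circ_tame (fun z => \sum_(j < k) block j z) r.
  rewrite /circ_tame; under eq_fun do rewrite -partial_blocks.
  by apply: (has_series_tame (@has_series_poly series_coef (start k))).
elim: J => [|J IH].
  apply: mean_le_sup => //; first by rewrite big_ord0 mulr0 addr0.
  by move=> t; rewrite !big_ord0 modulus0 mulr0 addr0.
have E : (fun z => \sum_(j < J.+1) block j z) = (fun z => (\sum_(j < J) block j z) + block J z).
  by apply/funext => z; rewrite big_ord_recr.
rewrite big_ord_recr/= mulrDr addrA; have := tJ J.+1; rewrite E => tE.
have v0 j : 0 < (start j)%:R `^ (s - alpha) * r ^+ start j.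
  by rewrite mulr_gt0 ?powR_gt0 ?exprn_gt0// ltr0n start_gt0.
apply: mean_leD => //; [|exact: mulr_gt0|exact: block_tame|exact: block_mean].
by rewrite ltr_wpDr// mulr_ge0 ?(ltW C0_gt0)// sumr_ge0// => j _; rewrite ltW.
Qed.

(** On one circle f differs by at most 1 from a finite sum of blocks. *)
Lemma block_sum_mean r : 0 < r < 1 -> exists J,
  mean_le p block_sum r (2 + C0 * \sum_(j < J) (start j)%:R `^ (s - alpha) * r ^+ start j).
Proof.
move=> r01; case/andP: (r01) => r0 r1.
have [J HJ] := has_series_tail has_series_block_sum r01 ltr01.
exists J; pose g z := \sum_(j < J) block j z.
have dser : has_series (fun k => series_coef k - (if (k < start J)%N then series_coef k else 0))
    (fun z => block_sum z - g z).
  move=> z z1; have h1 := has_series_block_sum z1; have := @has_series_poly series_coef (start J) z z1.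
  rewrite partial_blocks => h2; have := cvgsumB h1 h2; apply: eq_cvgsum => k.
  by rewrite mulrBl.
have gser : has_series (fun k => if (k < start J)%N then series_coef k else 0) g.
  by move=> z z1; rewrite /g -partial_blocks; exact: has_series_poly.
have E : block_sum = (fun z => g z + (block_sum z - g z)) by apply/funext => z; rewrite addrC subrK.
rewrite [X in mean_le _ X]E.
set S := C0 * _; have -> : 2 + S = (1 + S) + 1 by rewrite addrAC.
have S0 : 0 <= S.
  rewrite mulr_ge0 ?(ltW C0_gt0)// sumr_ge0// => j _.
  by rewrite mulr_ge0 ?powR_ge0 ?exprn_ge0// ltW.
apply: mean_leD => //.
- by rewrite ltr_wpDr.
- exact: has_series_tame gser r01.
- exact: has_series_tame dser r01.
- by have := has_series_block_sum; rewrite {1}E => /has_series_tame; apply.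
- exact: blocks_mean.
apply: mean_le_sup => //; first exact: has_series_tame dser r01.
move=> t; pose z : C := circle_pt r t.
have zr : modulus z = r by rewrite modulus_circle gtr0_norm.
by rewrite -/z /g -partial_blocks HJ ?zr// ltnW// j_lt_start.
Qed.

Lemma block_sum_growth : exists2 D : R, 0 < D & forall r, 0 < r < 1 ->
  (alpha < s -> mean_le p block_sum r (D * (1 - r) `^ (alpha - s))) /\
  (s < alpha -> mean_le p block_sum r D).
Proof.
have sum0 J r : 0 < r < 1 -> 0 <= \sum_(j < J) (start j)%:R `^ (s - alpha) * r ^+ start j.
  move=> /andP[r0 _]; apply: sumr_ge0 => j _.
  by rewrite mulr_ge0 ?powR_ge0 ?exprn_ge0// ltW.
have [sa|sa|sa] := ltgtP s alpha.
- have sa0 : s - alpha < 0 by rewrite subr_lt0.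
  have [D D0 HD] := lacunary_neg sa0 (start_gt0 0) start_4.
  exists (2 + C0 * D) => [|r r01]; first by rewrite addr_gt0// mulr_gt0.
  split=> // _; have [J HJ] := block_sum_mean r01; apply: mean_le_mono HJ => //.
    by rewrite addr_ge0// mulr_ge0 ?sum0// ltW.
  by rewrite lerD2l ler_wpM2l ?(ltW C0_gt0)// HD.
- have sa0 : 0 < s - alpha by rewrite subr_gt0.
  have [D D0 HD] := lacunary_pos sa0 (start_gt0 0) start_4.
  exists (2 + C0 * D) => [|r r01]; first by rewrite addr_gt0// mulr_gt0.
  split=> // _; have [J HJ] := block_sum_mean r01; apply: mean_le_mono HJ => //.
    by rewrite addr_ge0// mulr_ge0 ?sum0// ltW.
  have := HD J r r01; rewrite opprB => H.
  have y1 : 1 <= (1 - r) `^ (alpha - s).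
    case/andP: r01 => r0 r1; have x0 : 0 < 1 - r by rewrite subr_gt0.
    rewrite -[alpha - s]opprB powRN invf_ge1 ?powR_gt0//.
    have e1 : 1 `^ (s - alpha) = 1 :> R by rewrite powR1.
    by rewrite -[leRHS]e1 ge0_ler_powR ?nnegrE ?(ltW sa0) ?(ltW x0)// gerBl ltW.
  rewrite mulrDl lerD ?ler_peMr// -mulrA ler_wpM2l ?(ltW C0_gt0)//.
by exists 1.
Qed.

End block_construction.

(** * Optimality *)

Section optimality.
Local Open Scope complex_scope.
Context {R : realType}.
Local Notation C := (Cplx R).
Implicit Types (r e : R) (z w l : C) (a : nat -> C) (f g : C -> C).

(** Targets are coded by natural numbers: rational coefficients together with a
natural number from which the radius and the precision are derived. *)
Definition target (x : nat) : seq (rat * rat) * nat := odflt ([::], 0%N) (unpickle x).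
Definition target_coef (x k : nat) : C :=
  let ab := nth (0, 0) (target x).1 k in ratr ab.1 +i* ratr ab.2.
Definition target_radius (x : nat) : R := 1 - (target x).2.+2%:R^-1.
Definition target_error (x : nat) : R := (target x).2.+1%:R^-1.

Lemma target_coef0 x k : (size (target x).1 <= k)%N -> target_coef x k = 0.
Proof. by move=> xk; rewrite /target_coef nth_default//= !rmorph0. Qed.

Lemma target_radius01 x : 0 < target_radius x < 1.
Proof.
rewrite /target_radius subr_gt0 invf_lt1 ?ltr0n// ltr1n/=.
by rewrite gtrBl invr_gt0 ltr0n.
Qed.

Lemma rational_approx z e : 0 < e -> exists ab : rat * rat,
  modulus ((ratr ab.1 +i* ratr ab.2 : C) - z) <= e.
Proof.
case: z => x y e0; have e2 : 0 < e / 2 by rewrite divr_gt0.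
have lt2 (v : R) : v < v + e / 2 by rewrite ltrDl.
have [a] := rat_in_itvoo (lt2 x); have [b] := rat_in_itvoo (lt2 y).
rewrite !in_itv/= => /andP[b1 b2] /andP[a1 a2]; exists (a, b).
apply: le_trans (modulus_le_ReIm _) _ => /=.
rewrite !ger0_norm ?subr_ge0 ?(ltW a1) ?(ltW b1)//; lra.
Qed.

(** Truncate the Taylor series of g, approximate the coefficients by rational points and
choose the precision parameter large. *)
Lemma target_dense g r e : analytic_disc g -> 0 < r < 1 -> 0 < e ->
  exists x, [/\ r <= target_radius x, target_error x < e / 2 &
    forall z n, (size (target x).1 <= n)%N -> modulus z <= r ->
      modulus (g z - \sum_(k < n) target_coef x k * z ^+ k) <= e / 2].
Proof.
move=> /analytic_has_series[a ag] r01 e0; case/andP: (r01) => r0 r1.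
have e4 : 0 < e / 4 by rewrite divr_gt0.
have [K HK] := has_series_tail ag r01 e4.
have eK : 0 < e / 4 / K.+1%:R by rewrite divr_gt0.
have [ab Hab] := choice (fun k => rational_approx (a k) eK).
have [N1 HN1] := nat_large (1 - r)^-1; have [N2 HN2] := nat_large (e / 2)^-1.
pose N := (N1 + N2)%N; exists (pickle (mkseq ab K, N)).
rewrite /target_radius /target_error /target_coef /target pickleK/= size_mkseq; split.
- rewrite lerBrDr -lerBrDl -[leRHS]invrK lef_pV2 ?posrE ?invr_gt0 ?subr_gt0//.
  by apply: HN1; rewrite /N -!addnS leq_addr.
- rewrite -[ltRHS]invrK ltf_pV2 ?posrE ?invr_gt0 ?divr_gt0//.
  by apply: (@le_lt_trans _ _ N%:R); [apply: HN2; exact: leq_addl|rewrite ltr_nat].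
move=> z n Kn zr.
have -> : \sum_(k < n) ((let ab0 := nth (0, 0) (mkseq ab K) k in ratr ab0.1 +i* ratr ab0.2) : C) * z ^+ k
   = \sum_(k < K) (ratr (ab k).1 +i* ratr (ab k).2) * z ^+ k.
  rewrite -(subnKC Kn) big_split_ord/= [X in _ + X]big1 ?addr0; last first.
    by move=> i _; rewrite nth_default ?size_mkseq ?leq_addr//= !rmorph0 mul0r.
  by apply: eq_bigr => i _; rewrite nth_mkseq.
rewrite -(subrK (\sum_(k < K) a k * z ^+ k) (g z)) -addrA.
rewrite (le_trans (modulusD _ _))// (_ : e / 2 = e / 4 + e / 4); last by lra.
rewrite lerD ?HK// -sumrB (le_trans (modulus_sum _ _ _))//.
apply: (@le_trans _ _ (\sum_(k < K) e / 4 / K.+1%:R)).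
  apply: ler_sum => k _; rewrite -mulrBl modulusM modulusX -[leRHS]mulr1.
  apply: ler_pM; rewrite ?exprn_ge0//; first by rewrite modulusBC.
  by rewrite exprn_ile1// (le_trans zr)// ltW.
rewrite sumr_const card_ord -[_ *+ K]mulr_natr -mulrA ler_piMr ?(ltW e4)//.
by rewrite mulrC ler_pdivrMr// mul1r ler_nat.
Qed.

Lemma hypercyclic_optimal (alpha : R) (p : \bar R) (q : R)
    (hp : (1 < p)%E) (hpq : (p^-1 + q%:E^-1 = 1)%E) :
  exists (f : C -> C) (K : R),
     [/\ analytic_disc f, U_frequently_hypercyclic alpha f, 0 < K &
         forall r : R, 0 < r < 1 ->
           (alpha < (Num.max 2 q)^-1 ->
              (integral_mean p f r
                 <= (K * (1 - r) `^ (alpha - (Num.max 2 q)^-1))%:E)%E) /\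
           ((Num.max 2 q)^-1 < alpha -> (integral_mean p f r <= K%:E)%E)].
Proof.
have [D0 D00 Hflat] := flat_polynomials hp hpq.
set s := (Num.max 2 q)^-1 in Hflat *.
have s0 : 0 < s by rewrite invr_gt0 (lt_le_trans (ltr0n _ 2))// le_max lexx.
have [A0 /(_ _ (leqnn _)) HA0] := nat_large (`|alpha| + 1).
have aA : `|alpha| <= A0%:R by rewrite (le_trans _ HA0)// lerDl.
have [c Hc] := choice Hflat.
have e0 x : 0 < target_error x by rewrite invr_gt0.
have Hpar x := target_parameters (@target_coef0 x) s0 aA (target_radius01 x) (e0 x).
have [d Hd] := choice Hpar; have [h Hh] := choice Hd; have [B HB] := choice Hh.
have d0 x : (0 < d x)%N by have [[]] := HB x.
have dK x : (size (target x).1 <= d x)%N by have [[]] := HB x.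
have hd x : (6 * d x <= h x)%N by have [] := HB x.
have B1 x : 1 <= B x by have [_ _ []] := HB x.
have Bh x : B x <= (h x)%:R by have [_ _ []] := HB x.
have Bs x : B x <= (h x)%:R `^ s by have [_ _ []] := HB x.
have qB x : \sum_(k < d x) modulus (target_coef x k * (k.+1%:R `^ alpha)%:C) <= B x.
  by have [_ _ []] := HB x.
have Htail x := let: And5 _ _ _ H _ := HB x in H.
have Hnear x := let: And5 _ _ _ _ H := HB x in H.
have c0 k := let: And4 H _ _ _ := Hc k in H.
have c1 k := let: And4 _ H _ _ := Hc k in H.
have cones k := let: And4 _ _ H _ := Hc k in H.
have cflat k := let: And4 _ _ _ H := Hc k in H.
pose f := block_sum alpha target_coef d h c.
have fser : has_series (series_coef alpha target_coef d h c) f.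
  exact: (has_series_block_sum HA0 d0 hd B1 Bh qB c0 c1).
have [K K0 HK] := block_sum_growth hp D00 HA0 d0 hd B1 Bh Bs qB c0 c1 cflat.
exists f, K; split => //.
- exact: has_series_analytic fser.
- move=> U oU [g ag Ug]; have [r [e [r01 e00 HU]]] := disc_fun_open oU Ug.
  have [x [xr xe xg]] := target_dense ag r01 e00.
  have hx : 0 < (h x)%:R :> R by rewrite ltr0n (leq_trans _ (hd x))// muln_gt0 d0.
  apply: (@gt0_upper_density R _ (4 * (h x)%:R)^-1); first by rewrite invr_gt0 mulr_gt0.
  apply: (good_density d0 hd cones) => J i xJ im ci; split.
    exact: has_series_analytic (iter_shift_series alpha _ fser).
  apply: HU => z zr.
  have := shift_near HA0 d0 hd B1 Bh qB Htail Hnear target_radius01 c0 c1 im ci.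
  rewrite xJ => /(_ z (le_trans zr xr)) H1.
  have H2 := xg z (d x) (dK x) zr.
  move: H1 H2; set S := \sum_(k < _) _; rewrite -/f; set v := iter _ _ _ _ => H1 H2.
  rewrite -(subrK S v) -addrA (le_lt_trans (modulusD _ _))// [ltRHS](splitr e).
  by apply: ltr_leD; [exact: le_lt_trans H1 xe|rewrite modulusBC].
move=> r r01; have [H1 H2] := HK r r01.
have tf : circ_tame f r by exact: has_series_tame fser r01.
split=> sa; apply: integral_mean_le => //; [|exact: H1|exact: ltW|exact: H2].
by rewrite mulr_ge0 ?powR_ge0// ltW.
Qed.

End optimality.

Theorem theorem3p3 (R : realType) (alpha : R) (p : \bar R) (q : R)
    (hp : (1 < p)%E) (hpq : (p^-1 + q%:E^-1 = 1)%E) :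
  (forall f : Cplx R -> Cplx R,
     analytic_disc f -> U_frequently_hypercyclic alpha f ->
     [/\ alpha < (Num.max 2 q)^-1 ->
           (0 < limf_esup (fun r : R =>
                  ((1 - r) `^ ((Num.max 2 q)^-1 - alpha))%:E
                    * integral_mean p f r) (1 : R)^'-)%E,
         alpha = (Num.max 2 q)^-1 ->
           limf_esup (integral_mean p f) (1 : R)^'- = +oo%E &
         (Num.max 2 q)^-1 < alpha ->
           (0 < limf_esup (integral_mean p f) (1 : R)^'-)%E])
  /\
  (alpha <> (Num.max 2 q)^-1 ->
   exists (f : Cplx R -> Cplx R) (C : R),
     [/\ analytic_disc f, U_frequently_hypercyclic alpha f, 0 < C &
         forall r : R, 0 < r < 1 ->
           (alpha < (Num.max 2 q)^-1 ->
              (integral_mean p f r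
                 <= (C * (1 - r) `^ (alpha - (Num.max 2 q)^-1))%:E)%E) /\
           ((Num.max 2 q)^-1 < alpha -> (integral_mean p f r <= C%:E)%E)]).
Proof.
split=> [f af Uf|_]; first exact: hypercyclic_mean_growth hp hpq _ af Uf.
exact: hypercyclic_optimal.
Qed.
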